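(* Let $r\in\mathbb N$, let $g\in C[0,\infty)$ and $f_\pm\in C[0,\infty)$ satisfy Assumptions 1, 2 and 3 listed in the context. Then there exist two non-increasing sequences $\{a_n^+\}_{n=1}^\infty$, $\{a_n^-\}_{n=1}^\infty$ of positive numbers with $\lim_{n\to\infty}a_n^\pm=0$ and (with $a_0^\pm:=\infty$), for each $n\in\mathbb Z_+$ and each $\tau\in[a_{n+1}^\pm,a_n^\pm)$, a perfect $g$-spline $G_\tau^\pm\in\Gamma^r_{n,g}[0,\infty)$, such that the following hold. (a) For each $n\in\mathbb Z_+$ and $\tau\in[a_{n+1}^\pm,a_n^\pm)$, $G_\tau^\pm$ has exactly $n$ knots and $n+1$ points of oscillation (positively oriented for $G_\tau^+$ and negatively oriented for $G_\tau^-$) between $-\tau f_-$ and $\tau f_+$. (b) For each $n\in\mathbb Z_+$, all $\tau\in[a_{n+1}^\pm,a_n^\pm)$ and $s=0,1,\ldots,r-1$, the function $(G_\tau^\pm)^{(s)}$ is $(n+1)$-piecewise monotone. Moreover, for $s=0,\ldots,r$, $$\operatorname{sgn}(G_\tau^\pm)^{(s)}(0)=\pm(-1)^s.$$ (c) For each $n\in\mathbb Z_+$, $$\inf_{G\in\Gamma^r_{n,g}[0,\infty)}\|G\|_{C[0,\infty),f_-,f_+}=\min\{a_{n+1}^+,a_{n+1}^-\}.$$ If $a_{n+1}^+<a_{n+1}^-$, then the infimum is attained on $G^+_{a_{n+1}^+}$; otherwise it is attained on $G^-_{a_{n+1}^-}$.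
   Context: Notation: $f(\infty):=\lim_{t\to+\infty}f(t)$; $\mathbb Z_+=\{0,1,2,\ldots\}$. Every occurrence of $\pm$ is read as two statements, one with all upper and one with all lower signs. Auxiliary functions: $g_0:=g$ and $g_k(t):=\int_0^t g_{k-1}(s)\,ds$, $t\ge0$, $k=1,\ldots,r$. Put $A_0:=\int_0^\infty g(t)\,dt$ and, for $k=1,\ldots,r-1$, $$A_k:=\int_0^\infty\Big[\sum_{s=0}^{k-1}\frac{(-1)^{k-s-1}A_s}{(k-s-1)!}t^{k-s-1}+(-1)^kg_k(t)\Big]dt .$$ Put $$P_r(t):=(-1)^r\sum_{s=0}^{r-1}\frac{(-1)^{r-s-1}A_s}{(r-s-1)!}t^{r-s-1}+g_r(t).$$ ($P_r$ is the $r$-th order primitive of $g$ which, together with its derivatives of orders $1,\ldots,r-1$, tends to $0$ at infinity.) Assumption 1: $g\in C[0,\infty)$ is positive, non-increasing, and $A_k<\infty$ for $k=0,1,\ldots,r-1$. Assumption 2: $f_+,f_-\in C[0,\infty)$ are non-increasing, positive, and $f_\pm(\infty)>0$. Assumption 3: $\liminf_{t\to\infty}\frac{f_\pm(t)-f_\pm(\infty)}{|P_r(t)|}=0$ (for each of the two functions $f_+$, $f_-$). Norm: $\|x\|_{C[0,\infty),f_-,f_+}:=\sup_{t\ge0}\Big|\frac{\max\{x(t),0\}}{f_+(t)}+\frac{\max\{-x(t),0\}}{f_-(t)}\Big|$ (possibly $+\infty$). Perfect $g$-splines: $G\in C^{r-1}[0,\infty)$ is a perfect $g$-spline of order $r$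 with $n\in\mathbb N$ knots $0<t_1<\ldots<t_n<\infty$ if, with $t_0:=0$, $t_{n+1}:=\infty$, there is $\epsilon\in\{1,-1\}$ such that for each $i=0,\ldots,n$ the derivative $G^{(r)}$ exists on $(t_i,t_{i+1})$ and $G^{(r)}(t)=\epsilon(-1)^ig(t)$ there. An $r$-th order primitive of $g$ or of $-g$ is a perfect $g$-spline of order $r$ with $0$ knots. $\Gamma^r_{n,g}[0,\infty)$ is the set of all perfect $g$-splines of order $r$ on $[0,\infty)$ with at most $n$ knots. Oscillation: for continuous $\varphi<\Phi$ on $[0,\infty)$, a continuous $x$ has $n$ positively oriented points of oscillation between $\varphi$ and $\Phi$ if $\varphi(t)\le x(t)\le\Phi(t)$ for all $t$ and there are points $s_1<\ldots<s_n$ in $[0,\infty)$ with $x(s_k)=\Phi(s_k)$ for odd $k$ and $x(s_k)=\varphi(s_k)$ for even $k$. The points are negatively oriented if instead $x(s_k)=\Phi(s_k)$ for even $k$ and $x(s_k)=\varphi(s_k)$ for odd $k$. Piecewise monotonicity: $x\in C[0,\infty)$ is $n$-piecewise monotone if there exist $\epsilon\in\{1,-1\}$ and $0=t_0<t_1<\ldots<t_{n-1}<t_n=\infty$ such that $\epsilon(-1)^kx$ is increasing on $(t_{k-1},t_k)$, $k=1,\ldots,n$. Sign convention: for a locally absolutely continuous function $y$, $\operatorname{sgn}y'(t)=1$ (resp. $-1$) means that $y$ is increasing (resp. decreasing) in some neighbourhood of $t$ (relative to $[0,\infty)$); $\operatorname{sgn}G^{(s)}(0)$, $s\ge1$, is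 meant in this sense with $y=G^{(s-1)}$, and $\operatorname{sgn}G(0)$ is the usual sign. *)

(* Defs.v *)
(* A function on [0,oo) is represented by a total function R -> R; all the
   notions below depend only on its values on [0,oo). *)
From Stdlib Require Import Reals Lia Factorial FunctionalExtensionality.
From Coquelicot Require Import Coquelicot.
Open Scope R_scope.

Definition half_line (t : R) : Prop := 0 <= t.

Definition non_increasing (f : R -> R) : Prop :=
  forall s t, 0 <= s -> s <= t -> f t <= f s.

Definition positive (f : R -> R) : Prop := forall t, 0 <= t -> 0 < f t.

Definition at_infinity (f : R -> R) : R := real (Lim f p_infty).

(* Same shape as Coquelicot's is_LimInf_seq at a finite limit. *)
Definition is_liminf_infinity (h : R -> R) (l : R) : Prop :=
  forall eps : posreal,
    (forall T, exists t, T <= t /\ h t < l + eps) /\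
    (exists T, forall t, T <= t -> l - eps < h t).

(* [is_derive] relative to [0,oo): two-sided for 0 < t, one-sided at t = 0. *)
Definition is_derive_half (x : R -> R) (t l : R) : Prop :=
  filterdiff x (within half_line (locally t)) (fun h : R => scal h l).

(* y is the derivative of order s of x on [0,oo); y is thereby determined
   on [0,oo). *)
Fixpoint is_derive_n_half (s : nat) (x y : R -> R) : Prop :=
  match s with
  | O => forall t, 0 <= t -> y t = x t
  | S s' => exists z, is_derive_n_half s' x z /\
                      forall t, 0 <= t -> is_derive_half z t (y t)
  end.

Fixpoint primitive (g : R -> R) (k : nat) : R -> R :=
  match k with
  | O => g
  | S k' => fun t => RInt (primitive g k') 0 t
  end.

(* sum_{s=0}^{k-1} (-1)^(k-s-1) A_s t^(k-s-1) / (k-s-1)!, for 1 <= k: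
   sum_n includes its upper index. *)
Definition poly_part (A : nat -> R) (k : nat) (t : R) : R :=
  sum_n (fun s => (-1) ^ (k - s - 1) * A s / INR (fact (k - s - 1))
                  * t ^ (k - s - 1)) (k - 1).

Definition A_integrand (g : R -> R) (A : nat -> R) (k : nat) (t : R) : R :=
  match k with
  | O => g t
  | S _ => poly_part A k t + (-1) ^ k * primitive g k t
  end.

(* The integral of [h] over [0,oo) converges / its value, as an improper
   Riemann integral; on the integrands used here, which are nonnegative when
   g is, convergence means that the integral is finite. *)
Definition ex_RInt_half (h : R -> R) : Prop :=
  ex_RInt_gen h (at_point 0) (Rbar_locally p_infty).

Definition RInt_half (h : R -> R) : R :=
  RInt_gen h (at_point 0) (Rbar_locally p_infty).

(* A_k is defined from A_0, ..., A_{k-1}: [A_table g m] has the right values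
   at the indices smaller than m. The recursion is made explicit in
   [A_coefE]. *)
Fixpoint A_table (g : R -> R) (m : nat) : nat -> R :=
  match m with
  | O => fun _ => 0
  | S m' => fun k =>
      if Nat.ltb k m' then A_table g m' k
      else RInt_half (A_integrand g (A_table g m') m')
  end.

Definition A_coef (g : R -> R) (k : nat) : R := A_table g (S k) k.

Lemma A_tableE g m k : (k < m)%nat -> A_table g m k = A_coef g k.
Proof.
unfold A_coef; induction m as [|m IH]; intros Hk; [lia|].
destruct (Nat.eq_dec k m) as [->|Hkm]; [reflexivity|].
simpl A_table at 1.
destruct (Nat.ltb_spec k m) as [H|H]; [now apply IH | lia].
Qed.

Lemma A_coefE g k : A_coef g k = RInt_half (A_integrand g (A_coef g) k).
Proof.
unfold A_coef at 1; simpl.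
rewrite Nat.ltb_irrefl; f_equal.
apply functional_extensionality; intros t.
destruct k as [|k]; [reflexivity|].
unfold A_integrand, poly_part; f_equal.
apply sum_n_ext_loc; intros s Hs.
rewrite A_tableE; [reflexivity | lia].
Qed.

Definition P_fun (r : nat) (g : R -> R) (t : R) : R :=
  (-1) ^ r * poly_part (A_coef g) r t + primitive g r t.

Definition admissible_kernel (r : nat) (g : R -> R) : Prop :=
  continuous_on half_line g /\ positive g /\ non_increasing g /\
  forall k, (k < r)%nat -> ex_RInt_half (A_integrand g (A_coef g) k).

Definition admissible_weight (f : R -> R) : Prop :=
  continuous_on half_line f /\ non_increasing f /\ positive f /\
  0 < at_infinity f.

Definition weight_kernel_condition (r : nat) (g f : R -> R) : Prop :=
  is_liminf_infinity
    (fun t => (f t - at_infinity f) / Rabs (P_fun r g t)) 0.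

Definition wnorm (fm fp x : R -> R) : Rbar :=
  Lub_Rbar (fun v => exists t, 0 <= t /\
    v = Rabs (Rmax (x t) 0 / fp t + Rmax (- x t) 0 / fm t)).

(* 0 = t_0 < t_1 < ... < t_m = +oo *)
Definition subdivision (m : nat) (t : nat -> Rbar) : Prop :=
  t O = Finite 0 /\ t m = p_infty /\
  forall i, (i < m)%nat -> Rbar_lt (t i) (t (S i)).

Definition is_unit_sign (eps : R) : Prop := eps = 1 \/ eps = -1.

(* Perfect g-splines of order r (1 <= r) with exactly n knots. The knots are
   t_1, ..., t_n; y is the derivative of order r - 1 of G. *)
Definition perfect_spline (r : nat) (g : R -> R) (n : nat) (G : R -> R)
  : Prop :=
  exists y : R -> R,
    is_derive_n_half (r - 1) G y /\ continuous_on half_line y /\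
    exists (eps : R) (t : nat -> Rbar),
      is_unit_sign eps /\ subdivision (S n) t /\
      forall (i : nat) (u : R), (i <= n)%nat ->
        Rbar_lt (t i) u -> Rbar_lt u (t (S i)) ->
        is_derive y u (eps * (-1) ^ i * g u).

Definition Gamma (r n : nat) (g : R -> R) (G : R -> R) : Prop :=
  exists m, (m <= n)%nat /\ perfect_spline r g m G.

Definition lies_between (phi Phi x : R -> R) : Prop :=
  continuous_on half_line x /\ forall t, 0 <= t -> phi t <= x t <= Phi t.

(* s_1 < ... < s_n in [0,oo); s 0 is irrelevant. *)
Definition increasing_points (n : nat) (s : nat -> R) : Prop :=
  (forall k, (1 <= k <= n)%nat -> 0 <= s k) /\
  (forall k, (1 <= k)%nat -> (k < n)%nat -> s k < s (S k)).

Definition oscillates_pos (n : nat) (phi Phi x : R -> R) : Prop :=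
  lies_between phi Phi x /\
  exists s, increasing_points n s /\
    forall k, (1 <= k <= n)%nat ->
      (Nat.Odd k -> x (s k) = Phi (s k)) /\
      (Nat.Even k -> x (s k) = phi (s k)).

Definition oscillates_neg (n : nat) (phi Phi x : R -> R) : Prop :=
  lies_between phi Phi x /\
  exists s, increasing_points n s /\
    forall k, (1 <= k <= n)%nat ->
      (Nat.Even k -> x (s k) = Phi (s k)) /\
      (Nat.Odd k -> x (s k) = phi (s k)).

(* The monotonicity is strict. *)
Definition piecewise_monotone (n : nat) (x : R -> R) : Prop :=
  continuous_on half_line x /\
  exists (eps : R) (t : nat -> Rbar),
    is_unit_sign eps /\ subdivision n t /\
    forall (k : nat) (u v : R), (1 <= k <= n)%nat ->
      Rbar_lt (t (k - 1)%nat) u -> u < v -> Rbar_lt v (t k) ->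
      eps * (-1) ^ k * x u < eps * (-1) ^ k * x v.

Definition derivative_piecewise_monotone (n s : nat) (G : R -> R) : Prop :=
  exists y, is_derive_n_half s G y /\ piecewise_monotone n y.

(* sgn y'(t) = sigma, in the sense that y is strictly increasing (sigma = 1)
   or strictly decreasing (sigma = -1) in a neighbourhood of t relative to
   [0,oo). *)
Definition sgn_derivative (y : R -> R) (t sigma : R) : Prop :=
  exists d : posreal,
    (sigma = 1 /\
     forall u v, 0 <= u -> t - d < u -> u < v -> v < t + d -> y u < y v) \/
    (sigma = -1 /\
     forall u v, 0 <= u -> t - d < u -> u < v -> v < t + d -> y v < y u).

(* sgn G^(s)(0) = sigma *)
Definition sgn_derivative_n_at_0 (s : nat) (G : R -> R) (sigma : R) : Prop :=
  match s with
  | O => sign (G 0) = sigma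
  | S s' => exists y, is_derive_n_half s' G y /\ sgn_derivative y 0 sigma
  end.

(* A sequence a_1, a_2, ... is a function on nat whose value at 0 is ignored:
   a_0 stands for +oo. *)
Definition with_infinity (a : nat -> R) (n : nat) : Rbar :=
  match n with
  | O => p_infty
  | S _ => Finite (a n)
  end.

(* tau in [a_{n+1}, a_n) *)
Definition in_step (a : nat -> R) (n : nat) (tau : R) : Prop :=
  a (S n) <= tau /\ Rbar_lt tau (with_infinity a n).

Definition threshold_sequence (a : nat -> R) : Prop :=
  (forall n, (1 <= n)%nat -> 0 < a n) /\
  (forall n, (1 <= n)%nat -> a (S n) <= a n) /\
  is_lim_seq a 0.

(* Main.v *)
Require Import Defs.
From Stdlib Require Import Reals Lra Lia Classical.
From Stdlib Require Import IndefiniteDescription FunctionalExtensionality Cantor Factorial.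
From Coquelicot Require Import Coquelicot.
Open Scope R_scope.

(** Let T be the tail integral, T z t = the integral of z over [t,oo), and Q_k = T^k g, so that
    |P_r| = Q_r. A bounded perfect g-spline with n knots is, up to a sign, G = c + T^(r-1) y
    where y equals +Q_1 or -Q_1 up to a constant on each of n + 1 consecutive intervals, the
    signs alternating. By Rolle's theorem and the decay at infinity, k successive alternating
    descents of G give k alternating descents of y; this yields the monotonicity in (b).

    Comparison: suppose that G lies between -tau f_- and tau f_+, and that G' has n' + 1
    points of oscillation for some tau' > tau. Then G' - G has n' alternating descents, hence
    so has y' - y. As y' is nowhere steeper than y, each change of direction of y' - y needs a
    knot of G, so that n' is at most the number of these knots. This gives
    the lower bound in (c), and shows that the set of tau admitting an oscillating spline with
    at most n knots is closed upwards; its infimum is a_{n+1}.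

    Existence for every tau > 0: replace the sign pattern by the smooth product of the factors
    (v - th_i) / (v + th_i), v = exp (- nu s). The derivatives with respect to the th_i form a
    Chebyshev system, so that in a spline with n + 1 contacts all heights but one can be raised
    simultaneously. An extremal choice of c therefore leaves no excess over the bounds;
    Assumption 3 keeps the last contact from escaping to infinity. Letting nu tend to infinity
    gives perfect splines by compactness, and the same compactness shows that the infima
    a_{n+1} are attained and positive. *)

(** * Tail integrals *)

(** A true sign pattern jumps at its knots and cannot be differentiated in them pointwise. The
    rational factors can: after clearing denominators their partial derivatives are polynomials of
    degree below n in v^2, which is the source of the Chebyshev property. The parameter th runs over
    [0,1]: th = 0 is a knot at infinity, th = 1 a knot at the origin, and the knots are not ordered,
    so that the parameter space is compact.

    In limits knots may merge or escape. Being a perfect spline is therefore expressed by the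
    absence of slack chains, a condition closed under uniform convergence; the number of knots is
    recovered afterwards by counting descents. A contact may escape too, but only the last one, and
    it takes a knot with it.

    No uniqueness of the snakes is involved: they are chosen, and counting alone ties their knots to
    the thresholds.

    Analysis takes place on the whole line, with g and the weights continued constantly to the left
    of 0. Both orientations are one statement about weights w_k of period two in k: the negative one
    arises by exchanging f_+ and f_- and passing from G to -G. *)

Lemma mvt (f f' : R -> R) (a b : R) :
  (forall t, is_derive f t (f' t)) -> a < b ->
  exists c, f b - f a = f' c * (b - a) /\ a < c < b.
Proof.
intros Hf Hab; apply MVT_cor2; [assumption|].
intros c _; apply is_derive_Reals, Hf.
Qed.

Lemma derive_increment_le (f f' g g' : R -> R) (a b : R) :
  (forall t, is_derive f t (f' t)) -> (forall t, is_derive g t (g' t)) ->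
  (forall t, a <= t <= b -> f' t <= g' t) -> a <= b ->
  f b - f a <= g b - g a.
Proof.
intros Hf Hg Hle [Hab| ->]; [|lra].
destruct (mvt (fun t => g t - f t) (fun t => g' t - f' t) a b) as (c & Hc & Hc').
- intros t; apply (is_derive_minus (V := R_NormedModule)); auto.
- exact Hab.
- specialize (Hle c ltac:(lra)); nra.
Qed.

Lemma derive_increment_abs_le (f f' g g' : R -> R) (a b : R) :
  (forall t, is_derive f t (f' t)) -> (forall t, is_derive g t (g' t)) ->
  (forall t, a <= t <= b -> Rabs (f' t) <= g' t) -> a <= b ->
  Rabs (f b - f a) <= g b - g a.
Proof.
intros Hf Hg Hle Hab; apply Rabs_le; split.
- enough (- g b - - g a <= f b - f a) by lra.
  apply (derive_increment_le (fun t => - g t) (fun t => - g' t) f f'); auto.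
  + intros t; apply (is_derive_opp (V := R_NormedModule)); auto.
  + intros t Ht; specialize (Hle t Ht); apply Rabs_le_between in Hle; lra.
- apply (derive_increment_le f f' g g'); auto.
  intros t Ht; specialize (Hle t Ht); apply Rabs_le_between in Hle; lra.
Qed.

Lemma is_lim_p_infty_eps (f : R -> R) (l : R) :
  is_lim f p_infty l <->
  forall eps, 0 < eps -> exists X, forall t, X <= t -> Rabs (f t - l) < eps.
Proof.
split.
- intros H eps He.
  apply is_lim_spec in H; destruct (H (mkposreal eps He)) as [X HX].
  exists (X + 1); intros t Ht; apply HX; lra.
- intros H; apply is_lim_spec; intros eps.
  destruct (H eps (cond_pos eps)) as [X HX].
  exists X; intros t Ht; apply HX; lra.
Qed.

Lemma is_derive_continuous (f : R -> R) (t l : R) : is_derive f t l -> continuous f t.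
Proof. intros H; apply (ex_derive_continuous (V := R_NormedModule)); exists l; exact H. Qed.

(** A differential equation with a condition at infinity instead of an integral: sums, multiples and
    uniqueness then follow from rules for derivatives and limits, without questions of
    convergence. *)
Definition tail_of (z phi : R -> R) : Prop :=
  (forall t, is_derive phi t (- z t)) /\ is_lim phi p_infty 0.

Definition tail (z : R -> R) (t : R) : R :=
  real (Lim (fun X => RInt z 0 X) p_infty) - RInt z 0 t.

Lemma is_derive_RInt_from_0 (z : R -> R) :
  (forall t, continuous z t) -> forall t, is_derive (fun X => RInt z 0 X) t (z t).
Proof.
intros Hz t; apply (is_derive_RInt (V := R_CompleteNormedModule) z _ 0); [|apply Hz].
apply filter_forall; intros x; apply (RInt_correct (V := R_CompleteNormedModule)).
apply (ex_RInt_continuous (V := R_CompleteNormedModule)); intros; apply Hz.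
Qed.

Lemma tail_of_unique (z phi psi : R -> R) :
  tail_of z phi -> tail_of z psi -> forall t, phi t = psi t.
Proof.
intros [H1 L1] [H2 L2] t.
assert (Hd : forall u, is_derive (fun t => phi t - psi t) u (- z u - - z u))
  by (intros u; apply (is_derive_minus (V := R_NormedModule)); auto).
assert (HL : is_lim (fun t => phi t - psi t) p_infty (0 - 0))
  by (apply is_lim_minus'; assumption).
apply Rminus_diag_uniq, Rabs_eq_0, Rle_antisym; [|apply Rabs_pos].
apply le_epsilon; intros eps He.
destruct (proj1 (is_lim_p_infty_eps _ _) HL eps He) as [X HX].
set (Y := Rmax X (t + 1)).
assert (HY : t < Y) by (unfold Y; generalize (Rmax_r X (t + 1)); lra).
destruct (mvt _ _ t Y Hd HY) as (c & Hc & _).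
specialize (HX Y (Rmax_l _ _)).
replace ((phi Y - psi Y) - (phi t - psi t)) with (- (phi t - psi t - (phi Y - psi Y))) in Hc by ring.
replace (phi t - psi t) with (phi Y - psi Y) by lra.
replace (phi Y - psi Y - (0 - 0)) with (phi Y - psi Y) in HX by ring; lra.
Qed.

Lemma tail_of_nonneg (z phi : R -> R) (a : R) :
  tail_of z phi -> (forall t, a <= t -> 0 <= z t) -> forall t, a <= t -> 0 <= phi t.
Proof.
intros [Hd HL] Hz t Ht.
apply Rnot_lt_le; intros Hneg.
destruct (proj1 (is_lim_p_infty_eps _ _) HL (- phi t) ltac:(lra)) as [X HX].
set (Y := Rmax X (t + 1)).
assert (HY : t < Y) by (unfold Y; generalize (Rmax_r X (t + 1)); lra).
destruct (mvt _ _ t Y Hd HY) as (c & Hc & Hc').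
specialize (HX Y (Rmax_l _ _)); apply Rabs_def2 in HX.
specialize (Hz c ltac:(lra)); nra.
Qed.

Lemma tail_of_plus (z1 z2 phi1 phi2 : R -> R) :
  tail_of z1 phi1 -> tail_of z2 phi2 ->
  tail_of (fun t => z1 t + z2 t) (fun t => phi1 t + phi2 t).
Proof.
intros [H1 L1] [H2 L2]; split.
- intros t; replace (- (z1 t + z2 t)) with (- z1 t + - z2 t) by ring.
  apply (is_derive_plus (V := R_NormedModule)); auto.
- replace 0 with (0 + 0) by ring; apply is_lim_plus'; assumption.
Qed.

Lemma tail_of_scal (k : R) (z phi : R -> R) :
  tail_of z phi -> tail_of (fun t => k * z t) (fun t => k * phi t).
Proof.
intros [H1 L1]; split.
- intros t; replace (- (k * z t)) with (k * - z t) by ring.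
  apply (is_derive_scal); auto.
- replace (Finite 0) with (Rbar_mult k 0) by (simpl; f_equal; ring).
  apply is_lim_scal_l; assumption.
Qed.

Lemma tail_of_ext (z1 z2 phi1 phi2 : R -> R) :
  (forall t, z1 t = z2 t) -> (forall t, phi1 t = phi2 t) ->
  tail_of z1 phi1 -> tail_of z2 phi2.
Proof.
intros Hz Hp [H1 L1]; split.
- intros t; rewrite <- Hz; apply (is_derive_ext phi1); auto.
- apply (is_lim_ext phi1); auto.
Qed.

Lemma tail_spec_of_lim (z : R -> R) (l : R) :
  (forall t, continuous z t) -> is_lim (fun X => RInt z 0 X) p_infty l ->
  tail_of z (tail z).
Proof.
intros Hz HL; split.
- intros t; unfold tail.
  replace (- z t) with (0 - z t) by ring.
  apply (is_derive_minus (V := R_NormedModule)).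
  + apply (is_derive_const (V := R_NormedModule)).
  + apply is_derive_RInt_from_0, Hz.
- unfold tail; rewrite (is_lim_unique _ _ _ HL); simpl.
  replace (Finite 0) with (Finite (l - l)) by (f_equal; ring).
  apply is_lim_minus'; [apply is_lim_const | exact HL].
Qed.

(** Increments of the integral of [z] are bounded by those of [M * phi], whence the Cauchy criterion
    at infinity. The bound holds since [M * phi + tail z] and [M * phi - tail z] are tails of
    nonnegative functions. *)
Lemma tail_spec (z q phi : R -> R) (M : R) :
  (forall t, continuous z t) -> tail_of q phi -> (forall t, Rabs (z t) <= M * q t) ->
  tail_of z (tail z) /\ (forall t, Rabs (tail z t) <= M * phi t).
Proof.
intros Hz Hq Hzq.
assert (HF := is_derive_RInt_from_0 z Hz); set (F := fun X => RInt z 0 X) in *.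
assert (HG : forall t, is_derive (fun t => - (M * phi t)) t (M * q t)).
{ intros t; replace (M * q t) with (- (M * - q t)) by ring.
  apply (is_derive_opp (V := R_NormedModule)), (is_derive_scal), Hq. }
assert (Hinc : forall s t, s <= t -> Rabs (F t - F s) <= M * phi s - M * phi t).
{ intros s t Hst.
  generalize (derive_increment_abs_le F z _ _ s t HF HG (fun t _ => Hzq t) Hst); lra. }
assert (HML : is_lim (fun t => M * phi t) p_infty 0) by apply (tail_of_scal M q phi Hq).
assert (Hex : exists l : R, filterlim F (Rbar_locally p_infty) (locally l)).
{ apply (filterlim_locally_cauchy (U := R_CompleteSpace)).
  intros eps.
  destruct (proj1 (is_lim_p_infty_eps _ _) HML (eps / 2)) as [X HX];
    [generalize (cond_pos eps); lra|].
  exists (fun u => X < u); split; [exists X; auto|].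
  assert (Hw : forall u v, X < u -> u <= v -> Rabs (F v - F u) < eps).
  { intros u v Hu Huv; apply Rle_lt_trans with (1 := Hinc u v Huv).
    generalize (HX u ltac:(lra)) (HX v ltac:(lra)); intros A B.
    apply Rabs_def2 in A; apply Rabs_def2 in B; lra. }
  intros u v Hu Hv; unfold ball; simpl; unfold AbsRing_ball, minus, plus, opp; simpl.
  destruct (Rle_dec u v) as [Huv|Huv].
  - apply Hw; auto.
  - unfold abs; simpl; rewrite <- Rabs_Ropp.
    replace (- (F v + - F u)) with (F u - F v) by ring; apply Hw; lra. }
destruct Hex as [l Hl].
assert (HT : tail_of z (tail z)) by (apply (tail_spec_of_lim z l Hz Hl)).
split; [exact HT|].
assert (Hp := tail_of_plus _ _ _ _ (tail_of_scal M _ _ Hq) HT).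
assert (Hm := tail_of_plus _ _ _ _ (tail_of_scal M _ _ Hq) (tail_of_scal (-1) _ _ HT)).
intros t; apply Rabs_le; split.
- enough (0 <= M * phi t + tail z t) by lra.
  apply (tail_of_nonneg _ _ t Hp); [|lra].
  intros u _; generalize (Hzq u); intros B; apply Rabs_le_between in B; lra.
- enough (0 <= M * phi t + -1 * tail z t) by lra.
  apply (tail_of_nonneg _ _ t Hm); [|lra].
  intros u _; generalize (Hzq u); intros B; apply Rabs_le_between in B; lra.
Qed.

Lemma tail_of_continuous (z phi : R -> R) : tail_of z phi -> forall t, continuous phi t.
Proof. intros [H _] t; eapply is_derive_continuous, H. Qed.

Lemma tail_of_eps (z phi : R -> R) (eps : R) :
  tail_of z phi -> 0 < eps -> exists X, 0 <= X /\ forall t, X <= t -> Rabs (phi t) < eps.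
Proof.
intros [_ HL] He.
destruct (proj1 (is_lim_p_infty_eps _ _) HL eps He) as [X HX].
exists (Rmax X 0); split; [apply Rmax_r|].
intros t Ht; replace (phi t) with (phi t - 0) by ring.
apply HX; generalize (Rmax_l X 0); lra.
Qed.

Lemma continuous_Rplus (f g : R -> R) (t : R) :
  continuous f t -> continuous g t -> continuous (fun t => f t + g t) t.
Proof. apply (continuous_plus (V := R_NormedModule)). Qed.

Lemma continuous_Rminus (f g : R -> R) (t : R) :
  continuous f t -> continuous g t -> continuous (fun t => f t - g t) t.
Proof. apply (continuous_minus (V := R_NormedModule)). Qed.

Lemma continuous_Rmult (f g : R -> R) (t : R) :
  continuous f t -> continuous g t -> continuous (fun t => f t * g t) t.
Proof. apply (continuous_mult (K := R_AbsRing)). Qed.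

(** * Alternation and monotone pieces *)

Definition sg (k : nat) : R := (-1) ^ k.

Lemma sg_S k : sg (S k) = - sg k.
Proof. unfold sg; simpl; ring. Qed.

Lemma sg_cases k : is_unit_sign (sg k).
Proof.
induction k as [|k [H|H]]; [left; reflexivity | right | left]; rewrite sg_S, H; lra.
Qed.

Lemma is_unit_sign_opp s : is_unit_sign s -> is_unit_sign (- s).
Proof. intros [-> | ->]; [right | left]; lra. Qed.

Lemma unit_sign_abs s x : is_unit_sign s -> s * x <= Rabs x.
Proof. intros [-> | ->]; unfold Rabs; destruct (Rcase_abs x); lra. Qed.

(** Unlike [alternates], this notion is invariant under adding constants to [phi], so that the limit
    of a spline at infinity does not affect it. *)
Fixpoint descents (k : nat) (s a : R) (phi : R -> R) : Prop :=
  match k with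
  | O => True
  | S k' => exists x x', a <= x /\ x < x' /\ 0 < s * (phi x - phi x')
                         /\ descents k' (- s) x' phi
  end.

Fixpoint alternates (k : nat) (s a : R) (phi : R -> R) : Prop :=
  match k with
  | O => True
  | S k' => exists x, a <= x /\ 0 < s * phi x /\ alternates k' (- s) x phi
  end.

Lemma descents_weaken k s a b phi : b <= a -> descents k s a phi -> descents k s b phi.
Proof.
destruct k; [trivial|]; intros Hb (x & x' & H1 & H2); exists x, x'; split; [lra|exact H2].
Qed.

Lemma alternates_weaken k s a b phi :
  b <= a -> alternates k s a phi -> alternates k s b phi.
Proof. destruct k; [trivial|]; intros Hb (x & H1 & H2); exists x; split; [lra|exact H2]. Qed.

Lemma descents_ext k s a phi psi :
  (forall u v, a <= u -> u <= v -> phi u - phi v = psi u - psi v) ->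
  descents k s a phi -> descents k s a psi.
Proof.
revert s a; induction k as [|k IH]; [trivial|].
intros s a He (x & x' & H1 & H2 & H3 & H4); exists x, x'; repeat split; auto.
- rewrite <- He; auto; lra.
- apply IH; [|exact H4]; intros; apply He; lra.
Qed.

Lemma descents_alternates (z phi : R -> R) k s a :
  tail_of z phi -> descents k s a phi -> alternates k s a z.
Proof.
intros [Hd _]; revert s a; induction k as [|k IH]; [trivial|].
intros s a (x & x' & H1 & H2 & H3 & H4).
destruct (mvt _ _ x x' Hd H2) as (c & Hc & Hc').
exists c; split; [lra|split].
- assert (0 < (s * z c) * (x' - x)) by nra.
  apply Rmult_lt_reg_r with (x' - x); lra.
- apply (alternates_weaken _ _ x'); [lra|]; apply IH, H4.
Qed.

(** Two successive points of opposite sign already form a descent; behind the last point the decay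
    to 0 supplies one. Together with [descents_alternates] this passes through a tail without any
    loss in the count, unlike Rolle's theorem on a bounded interval. *)
Lemma alternates_descents (phi : R -> R) k s a :
  is_lim phi p_infty 0 -> alternates k s a phi -> descents k s a phi.
Proof.
intros HL; revert s a; induction k as [|k IH]; [trivial|].
intros s a (x & H1 & H2 & H3); destruct k as [|k].
- assert (Hp : phi x <> 0) by (intros E; rewrite E in H2; lra).
  assert (Hs : s <> 0) by (intros E; rewrite E in H2; lra).
  assert (Hp' := Rabs_pos_lt _ Hp).
  destruct (proj1 (is_lim_p_infty_eps _ _) HL _ Hp') as [X HX].
  exists x, (Rmax X (x + 1)); split; [exact H1|].
  assert (HY := Rmax_r X (x + 1)).
  split; [lra|split; [|exact I]].
  specialize (HX _ (Rmax_l X (x + 1))); rewrite Rminus_0_r in HX.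
  revert HX Hp' H2 Hs; generalize (phi (Rmax X (x + 1))) (phi x); clear.
  intros p q; unfold Rabs; destruct (Rcase_abs p), (Rcase_abs q); nra.
- destruct H3 as (x' & H4 & H5 & H6).
  exists x, x'; split; [exact H1|].
  assert (x <> x') by (intros E; rewrite <- E in H5; lra).
  split; [lra|split; [lra|]].
  apply IH; exists x'; split; [lra|auto].
Qed.

(** One scheme for weakly monotone, strictly monotone and extremal pieces. The number [m] counts the
    interior breakpoints, hence there are [m + 1] intervals, the last one unbounded. *)
Fixpoint pieces (P : R -> R -> Rbar -> Prop) (m : nat) (s a : R) : Prop :=
  match m with
  | O => P s a p_infty
  | S m' => exists b : R, a < b /\ P s a b /\ pieces P m' (- s) b
  end.

Lemma pieces_impl (P P' : R -> R -> Rbar -> Prop) m s a :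
  is_unit_sign s -> (forall s a b, is_unit_sign s -> P s a b -> P' s a b) ->
  pieces P m s a -> pieces P' m s a.
Proof.
intros Hs HP; revert s a Hs; induction m as [|m IH]; intros s a Hs; simpl; [auto|].
intros (b & H1 & H2 & H3); exists b; repeat split; auto using is_unit_sign_opp.
Qed.

Lemma pieces_flip (P P' : R -> R -> Rbar -> Prop) m s a :
  is_unit_sign s -> (forall s a b, is_unit_sign s -> P s a b -> P' (- s) a b) ->
  pieces P m s a -> pieces P' m (- s) a.
Proof.
intros Hs HP; revert s a Hs; induction m as [|m IH]; intros s a Hs; simpl; [auto|].
intros (b & H1 & H2 & H3); exists b; repeat split; auto using is_unit_sign_opp.
Qed.

Lemma pieces_subdivision (P : R -> R -> Rbar -> Prop) m s a :
  pieces P m s a ->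
  exists t : nat -> Rbar, t O = Finite a /\ t (S m) = p_infty /\
    forall i, (i <= m)%nat ->
      is_finite (t i) /\ Rbar_lt (t i) (t (S i)) /\ P (s * (-1) ^ i) (t i) (t (S i)).
Proof.
revert s a; induction m as [|m IH]; intros s a.
- intros H; exists (fun i => match i with O => Finite a | _ => p_infty end).
  repeat split; destruct i; try lia; simpl; auto; try reflexivity.
  rewrite Rmult_1_r; exact H.
- intros (b & H1 & H2 & H3).
  destruct (IH _ _ H3) as (t & T0 & T1 & Ht).
  exists (fun i => match i with O => Finite a | S j => t j end).
  split; [reflexivity|split; [exact T1|]].
  intros [|i] Hi; simpl.
  + rewrite T0, Rmult_1_r; simpl; repeat split; auto.
  + destruct (Ht i ltac:(lia)) as (A & B & C); repeat split; auto.
    replace (s * (-1 * (-1) ^ i)) with (- s * (-1) ^ i) by ring; exact C.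
Qed.

Lemma subdivision_pieces (P : R -> R -> Rbar -> Prop) m s a (t : nat -> Rbar) :
  t O = Finite a -> t (S m) = p_infty ->
  (forall i, (i <= m)%nat -> Rbar_lt (t i) (t (S i))) ->
  (forall i, (i <= m)%nat -> P (s * (-1) ^ i) (t i) (t (S i))) ->
  pieces P m s a.
Proof.
revert s a t; induction m as [|m IH]; intros s a t T0 T1 Hlt HP; simpl.
- specialize (HP O (le_n _)); simpl in HP; rewrite T0, T1, Rmult_1_r in HP; exact HP.
- assert (H0 := Hlt O ltac:(lia)); assert (H1 := Hlt 1%nat ltac:(lia)).
  assert (HP0 := HP O ltac:(lia)); rewrite T0 in H0, HP0; simpl in HP0.
  destruct (t 1%nat) as [b| |] eqn:E; simpl in H0, H1; try (exfalso; tauto).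
  + exists b; rewrite Rmult_1_r in HP0; repeat split; auto.
    apply (IH (- s) b (fun i => t (S i))); auto.
    * intros i Hi; apply Hlt; lia.
    * intros i Hi; specialize (HP (S i) ltac:(lia)).
      replace (- s * (-1) ^ i) with (s * (-1) ^ S i) by (simpl; ring); exact HP.
Qed.

Lemma first_piece (P : R -> R -> Rbar -> Prop) m s a :
  pieces P m s a -> exists b : Rbar, Rbar_lt a b /\ P s a b.
Proof.
destruct m; simpl; [intros H; exists p_infty; split; [exact I|exact H]|].
intros (b & Hb & H & _); exists b; auto.
Qed.

Lemma last_piece (P : R -> R -> Rbar -> Prop) m s a :
  pieces P m s a -> exists X, a <= X /\ P (s * sg m) X p_infty.
Proof.
revert s a; induction m as [|m IH]; intros s a HP.
- exists a; split; [lra|]; unfold sg; simpl; rewrite Rmult_1_r; exact HP.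
- destruct HP as (b & Hb & _ & HP); destruct (IH (- s) b HP) as (X & HX & HE).
  exists X; split; [lra|].
  replace (s * sg (S m)) with (- s * sg m) by (rewrite sg_S; ring); exact HE.
Qed.

Definition weakly_decreasing_on (phi : R -> R) (s a : R) (b : Rbar) : Prop :=
  forall u v, a <= u -> u <= v -> Rbar_le v b -> 0 <= s * (phi u - phi v).

Definition strictly_decreasing_on (phi : R -> R) (s a : R) (b : Rbar) : Prop :=
  forall u v, a <= u -> u < v -> Rbar_le v b -> 0 < s * (phi u - phi v).

Lemma descents_skip (phi : R -> R) k s a b :
  (forall u v, a <= u -> u <= v -> v <= b -> s * (phi u - phi v) <= 0) ->
  descents k s a phi -> descents k s b phi.
Proof.
intros Hm; destruct k; [trivial|]; intros (x & x' & H1 & H2 & H3 & H4).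
assert (b < x').
{ apply Rnot_le_lt; intros Hb; specialize (Hm x x' H1 ltac:(lra) Hb); lra. }
exists (Rmax x b), x'; unfold Rmax; destruct (Rle_dec x b).
- specialize (Hm x b H1 ltac:(lra) ltac:(lra)); repeat split; auto; lra.
- repeat split; auto; lra.
Qed.

(** A first descent of sign opposite to the first piece must end beyond that piece, and by
    [descents_skip] its start can be moved to the breakpoint. A first descent of the same sign is
    dropped, which leaves the opposite case. So each piece pays for at most one descent. *)
Lemma descents_bound (phi : R -> R) m s a k s' :
  is_unit_sign s -> pieces (weakly_decreasing_on phi) m s a -> descents k s' a phi ->
  (s' = s -> (k <= m + 1)%nat) /\ (s' = - s -> (k <= m)%nat).
Proof.
revert s a k s'; induction m as [|m IH]; intros s a k s' Hs HP.
- assert (H0 : forall k, descents k (- s) a phi -> (k <= 0)%nat).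
  { intros [|j]; [lia|]; intros (x & x' & H1 & H2 & H3 & H4).
    simpl in HP; specialize (HP x x' H1 ltac:(lra) I); lra. }
  intros HD; split; intros ->; [|auto].
  destruct k as [|k]; [lia|]; destruct HD as (x & x' & H1 & H2 & H3 & H4).
  assert (k <= 0)%nat by (apply H0, (descents_weaken _ _ x'); [lra|exact H4]); lia.
- destruct HP as (b & Hb & HP & HQ).
  assert (H0 : forall k, descents k (- s) a phi -> (k <= S m)%nat).
  { intros j Hj; destruct (IH (- s) b j (- s)) as [H _]; auto using is_unit_sign_opp.
    - apply (descents_skip _ _ _ a); [|exact Hj].
      intros u v H1 H2 H3; specialize (HP u v H1 H2 H3); lra.
    - specialize (H eq_refl); lia. }
  intros HD; split; intros ->; [|auto].
  destruct k as [|k]; [lia|]; destruct HD as (x & x' & H1 & H2 & H3 & H4).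
  assert (k <= S m)%nat by (apply H0, (descents_weaken _ _ x'); [lra|exact H4]); lia.
Qed.

(** Degenerate intervals and zeros are allowed: the predicate bounds the number of sign changes from
    above, as [alternates] does from below. *)
Fixpoint sign_pattern (n : nat) (s a : R) (phi : R -> R) : Prop :=
  match n with
  | O => forall t, a <= t -> 0 <= s * phi t
  | S n' => exists b, a <= b /\ (forall t, a <= t <= b -> 0 <= s * phi t)
                      /\ sign_pattern n' (- s) b phi
  end.

Lemma sign_pattern_start n s a phi : sign_pattern n s a phi -> 0 <= s * phi a.
Proof.
destruct n; simpl; [intros H; apply H; lra|].
intros (b & H1 & H2 & _); apply H2; lra.
Qed.

Lemma sign_pattern_extend n s a b phi :
  a <= b -> (forall t, a <= t <= b -> 0 <= s * phi t) ->
  sign_pattern n s b phi -> sign_pattern n s a phi.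
Proof.
intros Hab H; destruct n; simpl.
- intros H' t Ht; destruct (Rle_dec t b); [apply H; lra|apply H'; lra].
- intros (c & H1 & H2 & H3); exists c; split; [lra|split; [|exact H3]].
  intros t Ht; destruct (Rle_dec t b); [apply H; lra|apply H2; lra].
Qed.

Lemma alternates_skip (phi : R -> R) k s a b :
  (forall t, a <= t <= b -> s * phi t <= 0) ->
  alternates k s a phi -> alternates k s b phi.
Proof.
intros Hm; destruct k; [trivial|]; intros (x & H1 & H2 & H3).
exists x; repeat split; auto.
apply Rnot_lt_le; intros Hx; specialize (Hm x ltac:(lra)); lra.
Qed.

Lemma alternates_bound (phi : R -> R) m s a k s' :
  sign_pattern m s a phi -> alternates k s' a phi ->
  (s' = s -> (k <= m + 1)%nat) /\ (s' = - s -> (k <= m)%nat).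
Proof.
revert s a k s'; induction m as [|m IH]; intros s a k s' HP.
- assert (H0 : forall k, alternates k (- s) a phi -> (k <= 0)%nat).
  { intros [|j]; [lia|]; intros (x & H1 & H2 & _); specialize (HP x H1); lra. }
  intros HD; split; intros ->; [|auto].
  destruct k as [|k]; [lia|]; destruct HD as (x & H1 & H2 & H3).
  assert (k <= 0)%nat by (apply H0, (alternates_weaken _ _ x); auto); lia.
- destruct HP as (b & Hb & HP & HQ).
  assert (H0 : forall k, alternates k (- s) a phi -> (k <= S m)%nat).
  { intros j Hj; destruct (IH (- s) b j (- s)) as [H _]; auto.
    - apply (alternates_skip _ _ _ a); [|exact Hj].
      intros t Ht; specialize (HP t Ht); lra.
    - specialize (H eq_refl); lia. }
  intros HD; split; intros ->; [|auto].
  destruct k as [|k]; [lia|]; destruct HD as (x & H1 & H2 & H3).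
  assert (k <= S m)%nat by (apply H0, (alternates_weaken _ _ x); auto); lia.
Qed.

Lemma pieces_nonvanishing (phi : R -> R) m s a u v :
  pieces (strictly_decreasing_on phi) m s a -> a <= u -> u < v ->
  exists w, u < w < v /\ phi w <> 0.
Proof.
assert (K : forall s a b u v, strictly_decreasing_on phi s a b -> a <= u -> u < v ->
          Rbar_le v b -> exists w, u < w < v /\ phi w <> 0).
{ clear; intros s a b u v H Hu Huv Hv.
  set (w1 := u + (v - u) / 3); set (w2 := u + 2 * (v - u) / 3).
  specialize (H w1 w2 ltac:(unfold w1; lra) ltac:(unfold w1, w2; lra)).
  assert (Rbar_le w2 b) by (apply Rbar_le_trans with v; [simpl; unfold w2; lra|exact Hv]).
  specialize (H H0).
  destruct (Req_dec (phi w1) 0) as [E|E].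
  - exists w2; split; [unfold w2; lra|]; intros E2; rewrite E, E2 in H; lra.
  - exists w1; split; [unfold w1; lra|exact E]. }
revert s a u v; induction m as [|m IH]; intros s a u v.
- intros H Hu Huv; apply (K s a p_infty); simpl; auto.
- intros (b & H1 & H2 & H3) Hu Huv; destruct (Rlt_dec u b) as [Hb|Hb].
  + destruct (K s a b u (Rmin v b) H2 Hu) as (w & Hw & Hw').
    * apply Rmin_glb_lt; auto.
    * simpl; apply Rmin_r.
    * exists w; generalize (Rmin_l v b); split; [lra|auto].
  + apply (IH _ _ u v H3); lra.
Qed.

(** To be read from the right: on the last piece [s * phi] decreases to 0 and so is nonnegative, and
    each further piece to the left adds at most one sign change. A piece that adds none leads to the
    second alternative, which then persists. *)
Lemma pieces_sign_pattern (phi : R -> R) n s a :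
  (forall t, continuous phi t) -> is_lim phi p_infty 0 -> is_unit_sign s ->
  pieces (strictly_decreasing_on phi) n s a ->
  exists m s', is_unit_sign s' /\ sign_pattern m s' a phi /\
    ((m = n /\ s' = s) \/ (m < n)%nat).
Proof.
intros Hc HL; revert s a; induction n as [|n IH]; intros s a Hs.
- intros H; exists O, s; split; [auto|split; [|auto]].
  intros t Ht; apply Rnot_lt_le; intros Hneg.
  destruct (proj1 (is_lim_p_infty_eps _ _) HL (- (s * phi t)) ltac:(lra)) as [X HX].
  set (Y := Rmax X (t + 1)); assert (HY := Rmax_r X (t + 1)); fold Y in HY.
  specialize (HX Y (Rmax_l _ _)); rewrite Rminus_0_r in HX.
  simpl in H; specialize (H t Y Ht ltac:(lra) I).
  assert (A := unit_sign_abs (- s) (phi Y) (is_unit_sign_opp s Hs)); lra.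
- intros (b & H1 & H2 & H3).
  destruct (IH (- s) b (is_unit_sign_opp s Hs) H3) as (m & s' & Hs' & HS & Hm).
  assert (Hb := sign_pattern_start _ _ _ _ HS).
  assert (Hdec : forall t, a <= t <= b -> s * phi b <= s * phi t <= s * phi a).
  { intros t [[Ht|<-] [Ht'| ->]]; try lra.
    - assert (A := H2 a t ltac:(lra) Ht ltac:(simpl; lra)).
      assert (B := H2 t b ltac:(lra) Ht' ltac:(simpl; lra)); lra.
    - assert (A := H2 a b ltac:(lra) Ht ltac:(simpl; lra)); lra.
    - assert (B := H2 a b ltac:(lra) Ht' ltac:(simpl; lra)); lra. }
  assert (Hcase : s' = s \/ s' = - s)
    by (destruct Hs as [-> | ->], Hs' as [-> | ->]; lra).
  destruct Hcase as [-> | ->].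
  + assert (m < n)%nat.
    { destruct Hm as [[_ E]|]; [|lia].
      destruct Hs as [-> | ->]; lra. }
    exists m, s; split; [auto|split; [|right; lia]].
    apply (sign_pattern_extend _ _ _ b); auto; [lra|].
    intros t Ht; specialize (Hdec t Ht); lra.
  + destruct (Rle_dec (s * phi a) 0) as [Ha|Ha].
    * exists m, (- s); split; [auto|split; [|right; lia]].
      apply (sign_pattern_extend _ _ _ b); auto; [lra|].
      intros t Ht; specialize (Hdec t Ht); lra.
    * destruct (IVT_gen (fun t => s * phi t) a b 0) as (z & Hz & Hz0).
      -- intros x; apply continuity_pt_filterlim.
         apply (continuous_scal_r (V := R_NormedModule) s phi), Hc.
      -- split; [apply Rle_trans with (s * phi b); [apply Rmin_r|lra]
                |apply Rle_trans with (s * phi a); [lra|apply Rmax_l]].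
      -- rewrite Rmin_left, Rmax_right in Hz by lra.
         assert (Hdz : forall t, (a <= t <= z -> 0 <= s * phi t) /\
                                 (z <= t <= b -> 0 <= - s * phi t)).
         { intros t; split; intros [[Ht|<-] [Ht'| ->]]; try lra.
           - assert (A := H2 t z ltac:(lra) Ht' ltac:(simpl; lra)); lra.
           - assert (A := H2 z t ltac:(lra) Ht ltac:(simpl; lra)); lra. }
         exists (S m), s; split; [auto|split].
         ++ exists z; split; [lra|split; [apply Hdz|]].
            apply (sign_pattern_extend _ _ _ b); auto; [lra|]; apply Hdz.
         ++ destruct Hm as [[-> _]|Hm]; [left; auto|right; lia].
Qed.

(** Otherwise the monotone function [s * psi] would be constant on [[u,v]], and the derivative
    [- phi] of [psi] would vanish at [w]. *)
Lemma strict_descent (phi psi : R -> R) s u v :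
  tail_of phi psi -> u < v -> (forall t, u <= t <= v -> 0 <= s * phi t) ->
  (exists w, u < w < v /\ s * phi w <> 0) -> 0 < s * (psi u - psi v).
Proof.
intros [Hd _] Huv Hpos (w & Hw & Hne).
assert (Hmon : forall x y, u <= x -> x <= y -> y <= v -> s * psi y <= s * psi x).
{ intros x y H1 H2 H3.
  destruct H2 as [H2| ->]; [|lra].
  destruct (mvt _ _ x y Hd H2) as (c & Hc & Hc').
  specialize (Hpos c ltac:(lra)).
  assert (s * (psi y - psi x) = - (s * phi c * (y - x))) by (rewrite Hc; ring).
  nra. }
assert (H1 := Hmon u v ltac:(lra) ltac:(lra) ltac:(lra)).
destruct (Rle_lt_dec (s * psi u) (s * psi v)) as [H2|H2]; [exfalso|lra].
apply Hne.
assert (Hconst : locally w (fun t => s * psi t = s * psi u)).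
{ assert (He : 0 < Rmin (w - u) (v - w)) by (apply Rmin_glb_lt; lra).
  exists (mkposreal _ He); intros t Ht.
  unfold ball in Ht; simpl in Ht; unfold AbsRing_ball, minus, plus, opp, abs in Ht; simpl in Ht.
  apply Rabs_def2 in Ht.
  generalize (Rmin_l (w - u) (v - w)) (Rmin_r (w - u) (v - w)); intros.
  generalize (Hmon u t ltac:(lra) ltac:(lra) ltac:(lra)).
  generalize (Hmon t v ltac:(lra) ltac:(lra) ltac:(lra)); lra. }
assert (D1 : is_derive (fun t => s * psi t) w (s * - phi w)) by (apply is_derive_scal, Hd).
assert (D2 : is_derive (fun t => s * psi t) w 0).
{ apply (is_derive_ext_loc (fun _ => s * psi u)).
  - apply (filter_imp (fun t => s * psi t = s * psi u)); auto.
  - apply (is_derive_const (V := R_NormedModule)). }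
apply is_derive_unique in D1; apply is_derive_unique in D2; lra.
Qed.

Lemma sign_pattern_pieces (phi psi : R -> R) n s a :
  tail_of phi psi -> is_unit_sign s ->
  (forall u v, a <= u -> u < v -> exists w, u < w < v /\ phi w <> 0) ->
  sign_pattern n s a phi -> alternates (S n) s a phi ->
  pieces (strictly_decreasing_on psi) n s a.
Proof.
intros HT; revert s a; induction n as [|n IH]; intros s a Hs Hnz HS HA.
- intros u v Hu Huv _; apply (strict_descent phi); auto.
  + intros t Ht; apply HS; lra.
  + destruct (Hnz u v Hu Huv) as (w & Hw & Hw'); exists w; split; auto.
    destruct Hs as [-> | ->]; lra.
- destruct HS as (b & Hb & H1 & H2).
  assert (HA' : alternates (S n) (- s) b phi).
  { destruct HA as (x & Hx & Hx' & HA); apply (alternates_skip _ _ _ a).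
    - intros t Ht; specialize (H1 t Ht); lra.
    - apply (alternates_weaken _ _ x); auto. }
  destruct Hb as [Hb|<-].
  + exists b; split; [auto|split].
    * intros u v Hu Huv Hv; simpl in Hv; apply (strict_descent phi); auto.
      -- intros t Ht; apply H1; lra.
      -- destruct (Hnz u v Hu Huv) as (w & Hw & Hw'); exists w; split; auto.
         destruct Hs as [-> | ->]; lra.
    * apply IH; auto using is_unit_sign_opp.
      intros u v Hu; apply Hnz; lra.
  + destruct (alternates_bound _ _ _ _ _ s H2 HA) as [_ B].
    specialize (B ltac:(ring)); lia.
Qed.

(** The full number [S n] of alternations excludes every sign pattern of [phi] except the one with
    [n] changes that starts with [s]; its intervals are the monotone pieces of the tail. Iteration
    carries the pieces of [y] up to the spline. *)
Lemma strict_pieces_tail (phi psi : R -> R) n s a :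
  (forall t, continuous phi t) -> is_lim phi p_infty 0 -> tail_of phi psi ->
  is_unit_sign s -> alternates (S n) s a phi ->
  pieces (strictly_decreasing_on phi) n s a ->
  pieces (strictly_decreasing_on psi) n s a.
Proof.
intros Hc HL HT Hs HA HP.
apply (sign_pattern_pieces phi); auto.
- intros u v; apply (pieces_nonvanishing _ _ _ _ _ _ HP).
- destruct (pieces_sign_pattern phi n s a Hc HL Hs HP) as (m & s' & Hs' & HS & Hm).
  destruct (alternates_bound _ _ _ _ _ _ HS HA) as [B1 B2].
  destruct Hm as [[-> ->]|Hm]; [exact HS|exfalso].
  destruct Hs as [-> | ->], Hs' as [-> | ->];
    try (specialize (B1 eq_refl); lia);
    (specialize (B2 ltac:(lra)); lia).
Qed.

(** * Contracted functions, extremal pieces and slack *)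

Definition contracted (q y : R -> R) : Prop :=
  forall u v, u <= v -> Rabs (y u - y v) <= q u - q v.

(** With [q] the first tail of g, [contracted] is the integrated form of |y'| <= g, and this is y' =
    - s g. Both make sense across knots and survive uniform limits. *)
Definition extremal_on (q y : R -> R) (s a : R) (b : Rbar) : Prop :=
  forall u v, a <= u -> u <= v -> Rbar_le v b -> y u - y v = s * (q u - q v).

(* An obstruction, open under uniform convergence, to y being extremal on at most k intervals
   with alternating signs starting with s. *)
Fixpoint slack_chain (q y : R -> R) (k : nat) (s a eta : R) : Prop :=
  match k with
  | O => True
  | S k' => exists x x', a <= x /\ x < x' /\ s * (y x - y x') < q x - q x' - eta
                         /\ slack_chain q y k' (- s) x' eta
  end.

Lemma contracted_continuous (q y : R -> R) :
  contracted q y -> (forall t, continuous q t) -> forall t, continuous y t.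
Proof.
intros Hy Hq t; apply continuity_pt_filterlim; intros eps He.
assert (Hq' : continuity_pt q t) by apply continuity_pt_filterlim, Hq.
destruct (Hq' eps He) as (d & Hd & H); exists d; split; [exact Hd|].
intros x Hx; specialize (H x Hx); simpl in *; unfold Rdist in *.
apply Rle_lt_trans with (2 := H).
destruct (Rle_dec x t) as [Hxt|Hxt].
- apply Rle_trans with (1 := Hy x t Hxt), Rle_abs.
- rewrite <- Rabs_Ropp, Ropp_minus_distr.
  apply Rle_trans with (1 := Hy t x ltac:(lra)).
  rewrite <- (Rabs_Ropp (q x - q t)), Ropp_minus_distr; apply Rle_abs.
Qed.

(** Equality between the ends leaves no slack on any of the three parts [[a,u]], [[u,v]] and
    [[v,b]]. *)
Lemma extremal_on_of_ends (q y : R -> R) s a b :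
  contracted q y -> is_unit_sign s -> y a - y b = s * (q a - q b) ->
  extremal_on q y s a b.
Proof.
intros Hy Hs He u v Hu Huv Hv; simpl in Hv.
assert (A := Hy a u Hu); assert (B := Hy u v Huv); assert (C := Hy v b Hv).
assert (A1 := unit_sign_abs _ (y a - y u) Hs); assert (B1 := unit_sign_abs _ (y u - y v) Hs).
assert (C1 := unit_sign_abs _ (y v - y b) Hs).
destruct Hs as [-> | ->]; lra.
Qed.

Lemma extremal_on_trans (q y : R -> R) s a b c :
  a <= b -> extremal_on q y s a (Finite b) -> extremal_on q y s b c -> extremal_on q y s a c.
Proof.
intros Hab H1 H2 u v Hu Huv Hv.
destruct (Rle_dec v b) as [Hvb|Hvb]; [apply H1; auto|].
destruct (Rle_dec b u) as [Hbu|Hbu]; [apply H2; auto|].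
assert (A := H1 u b Hu ltac:(lra) ltac:(simpl; lra)).
assert (B := H2 b v ltac:(lra) ltac:(lra) Hv); lra.
Qed.

Lemma pieces_extremal_extend (q y : R -> R) m s a b :
  a <= b -> extremal_on q y s a (Finite b) ->
  pieces (extremal_on q y) m s b -> pieces (extremal_on q y) m s a.
Proof.
intros Hab H; destruct m; simpl.
- apply extremal_on_trans; auto.
- intros (c & H1 & H2 & H3); exists c; split; [lra|split; [|exact H3]].
  apply (extremal_on_trans _ _ _ _ b); auto.
Qed.

(** Greedy choice of breakpoints: [b] is the last point up to which [y] is extremal with sign [s].
    Beyond it every interval starting at [a] has slack, so a chain from [b] with sign [- s] could be
    prolonged by one link on the left. The alternative [s' = - s] covers an empty first interval. *)
Lemma no_slack_pieces (q y : R -> R) n s a :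
  contracted q y -> (forall t, continuous q t) -> is_unit_sign s ->
  ~ slack_chain q y (S n) s a 0 ->
  exists m s', pieces (extremal_on q y) m s' a /\
    (((m <= n)%nat /\ s' = s) \/ ((m < n)%nat /\ s' = - s)).
Proof.
intros Hy Hq; revert s a; induction n as [|n IH]; intros s a Hs HN.
- exists O, s; split; [|left; auto].
  intros u v Hu [Huv| ->] _; [|ring].
  assert (A := Hy u v ltac:(lra)); assert (B := unit_sign_abs s (y u - y v) Hs).
  destruct (Rlt_dec (s * (y u - y v)) (q u - q v - 0)) as [C|C].
  + exfalso; apply HN; exists u, v; repeat split; auto.
  + destruct Hs as [-> | ->]; lra.
(* The slack accumulated since [a]: nondecreasing because [y] is contracted, and 0 at [t] as long as
   [y] is extremal on [[a,t]]. *)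
- set (e := fun t => (q a - q t) - s * (y a - y t)).
  assert (Hyc := contracted_continuous q y Hy Hq).
  assert (Hmon : forall t t', t <= t' -> e t <= e t').
  { intros t t' Ht; unfold e; assert (A := Hy t t' Ht).
    assert (B := unit_sign_abs s (y t - y t') Hs); lra. }
  destruct (classic (forall t, a <= t -> e t <= 0)) as [Hall|Hex].
  { exists O, s; split; [|left; split; [lia|auto]].
    intros u v Hu Huv _.
    apply (extremal_on_of_ends q y s a v); auto; simpl; try lra.
    assert (A := Hall v ltac:(lra)); assert (B := Hy a v ltac:(lra)).
    assert (C := unit_sign_abs s (y a - y v) Hs); unfold e in A.
    destruct Hs as [-> | ->]; lra. }
  apply not_all_ex_not in Hex; destruct Hex as [T HT].
  apply imply_to_and in HT; destruct HT as [HaT HT].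
  destruct (completeness (fun t => a <= t /\ e t <= 0)) as [b [Hub Hlub]].
  { exists T; intros t [_ Ht]; apply Rnot_lt_le; intros C; apply HT.
    apply Rle_trans with (2 := Ht), Hmon; lra. }
  { exists a; split; [lra|unfold e; lra]. }
  assert (Hab : a <= b) by (apply Hub; split; [lra|unfold e; lra]).
  assert (Hec : continuity e).
  { intros t; unfold e; apply continuity_pt_filterlim.
    apply (continuous_Rminus (fun t => q a - q t) (fun t => s * (y a - y t))).
    - apply (continuous_Rminus (fun _ => q a) q); [apply continuous_const|apply Hq].
    - apply (continuous_Rmult (fun _ => s) (fun t => y a - y t)); [apply continuous_const|].
      apply (continuous_Rminus (fun _ => y a) y); [apply continuous_const|apply Hyc]. }
  assert (Heb : e b <= 0).
  { apply Rnot_lt_le; intros C.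
    destruct (Hec b (e b) C) as (d & Hd & H).
    assert (Hup : b <= b - d / 2); [|lra].
    apply Hlub; intros t [Ht Ht']; apply Rnot_lt_le; intros Hlt.
    assert (Htb : t <= b) by (apply Hub; split; auto).
    destruct (Req_dec b t) as [<-|Hne]; [lra|].
    specialize (H t); simpl in H; unfold Rdist in H.
    assert (Hr : Rabs (e t - e b) < e b).
    { apply H; split; [split; [exact I|exact Hne]|apply Rabs_def1; lra]. }
    apply Rabs_def2 in Hr; lra. }
  assert (Hbeyond : forall t, b < t -> 0 < e t).
  { intros t Ht; apply Rnot_le_lt; intros C.
    assert (t <= b) by (apply Hub; split; [lra|auto]); lra. }
  assert (Hext : extremal_on q y s a b).
  { apply extremal_on_of_ends; auto.
    assert (B := Hy a b Hab); assert (C := unit_sign_abs s (y a - y b) Hs).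
    unfold e in Heb; destruct Hs as [-> | ->]; lra. }
  assert (HN' : ~ slack_chain q y (S n) (- s) b 0).
  { intros (x & x' & H1 & H2 & H3 & H4); apply HN.
    (* The slack of the link from [t] to [x']. By continuity it is still positive at some [w] to the
       right of [x], which makes room for the additional link from [a] to [w] even when [x = b]. *)
    set (d := fun t => (q t - q x') + s * (y t - y x')).
    assert (Hdc : continuity d).
    { intros t; unfold d; apply continuity_pt_filterlim.
      apply (continuous_Rplus (fun t => q t - q x') (fun t => s * (y t - y x'))).
      - apply (continuous_Rminus q (fun _ => q x')); [apply Hq|apply continuous_const].
      - apply (continuous_Rmult (fun _ => s) (fun t => y t - y x')); [apply continuous_const|].
        apply (continuous_Rminus y (fun _ => y x')); [apply Hyc|apply continuous_const]. }
    assert (Hdx : 0 < d x) by (unfold d; lra).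
    destruct (Hdc x (d x) Hdx) as (del & Hdel & H).
    set (w := x + Rmin (del / 2) ((x' - x) / 2)).
    assert (Hw : 0 < Rmin (del / 2) ((x' - x) / 2)) by (apply Rmin_glb_lt; lra).
    assert (Hw1 := Rmin_l (del / 2) ((x' - x) / 2)).
    assert (Hw2 := Rmin_r (del / 2) ((x' - x) / 2)).
    assert (Hdw : 0 < d w).
    { specialize (H w); simpl in H; unfold Rdist in H.
      assert (Hr : Rabs (d w - d x) < d x).
      { apply H; split; [split; [exact I|unfold w; lra]|].
        unfold w; rewrite Rplus_minus_l, Rabs_right; lra. }
      apply Rabs_def2 in Hr; lra. }
    exists a, w; split; [lra|split; [unfold w; lra|split]].
    - assert (A := Hbeyond w ltac:(unfold w; lra)); unfold e in A; lra.
    - exists w, x'; split; [lra|split; [unfold w; lra|split; [|exact H4]]].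
      unfold d in Hdw; lra. }
  destruct (IH (- s) b (is_unit_sign_opp s Hs) HN') as (m & s' & HP & Hm).
  destruct Hm as [[Hm ->]|[Hm ->]].
  + destruct Hab as [Hab| <-].
    * exists (S m), s; split; [|left; split; [lia|auto]].
      exists b; auto.
    * exists m, (- s); split; [auto|right; split; [lia|auto]].
  + rewrite Ropp_involutive in HP; exists m, s; split; [|left; split; [lia|auto]].
    apply (pieces_extremal_extend _ _ _ _ _ b); auto.
Qed.

Lemma difference_pieces (q y1 y2 : R -> R) m s a :
  contracted q y1 -> is_unit_sign s -> pieces (extremal_on q y2) m s a ->
  pieces (weakly_decreasing_on (fun t => y1 t - y2 t)) m (- s) a.
Proof.
intros H1 Hs; apply pieces_flip; auto.
clear s Hs; intros s b c Hs H u v Hu Huv Hv.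
specialize (H u v Hu Huv Hv).
assert (A := H1 u v Huv); assert (B := unit_sign_abs s (y1 u - y1 v) Hs).
replace (- s * (y1 u - y2 u - (y1 v - y2 v)))
  with (s * (y2 u - y2 v) - s * (y1 u - y1 v)) by ring.
rewrite H; replace (s * (s * (q u - q v))) with ((s * s) * (q u - q v)) by ring.
replace (s * s) with 1 by (destruct Hs as [-> | ->]; ring); lra.
Qed.

(* y1 - y2 can only ascend where y2 descends at the maximal rate, so an
   alternation of the difference consumes the knots of y2. *)
Lemma difference_descents_bound (q y1 y2 : R -> R) m s a k :
  contracted q y1 -> is_unit_sign s -> pieces (extremal_on q y2) m s a ->
  descents k s a (fun t => y1 t - y2 t) -> (k <= m)%nat.
Proof.
intros H1 Hs H2 HD.
assert (HP := difference_pieces q y1 y2 m s a H1 Hs H2).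
destruct (descents_bound _ _ _ _ _ s (is_unit_sign_opp s Hs) HP HD) as [_ B].
apply B; ring.
Qed.

(** * Iterated tails *)

Fixpoint itail (i : nat) (z : R -> R) : R -> R :=
  match i with O => z | S i' => tail (itail i' z) end.

Lemma itail_S i z : itail (S i) z = itail i (tail z).
Proof. induction i as [|i IH]; [reflexivity|]; simpl in *; rewrite IH; reflexivity. Qed.

Definition tail_chain (r : nat) (Q : nat -> R -> R) : Prop :=
  (forall t, continuous (Q O) t) /\ (forall t, 0 < Q O t) /\
  (forall s t, s <= t -> Q O t <= Q O s) /\
  (forall k, (k < r)%nat -> tail_of (Q k) (Q (S k))).

(** The class on which iterated tails converge: a tail raises [k] by one and keeps the constant
    [M]. *)
Definition dominated (Q : nat -> R -> R) (M : R) (k : nat) (z : R -> R) : Prop :=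
  (forall t, continuous z t) /\ forall t, Rabs (z t) <= M * Q k t.

Lemma tail_increment (z phi q psi : R -> R) M u v :
  tail_of z phi -> tail_of q psi -> (forall t, Rabs (z t) <= M * q t) -> u <= v ->
  Rabs (phi u - phi v) <= M * (psi u - psi v).
Proof.
intros [Hd _] [Hq _] Hz Huv.
rewrite <- Rabs_Ropp, Ropp_minus_distr.
replace (M * (psi u - psi v)) with (- M * psi v - - M * psi u) by ring.
apply (derive_increment_abs_le phi (fun t => - z t) (fun t => - M * psi t) (fun t => - M * - q t));
  auto.
- intros t; apply is_derive_scal, Hq.
- intros t _; rewrite Rabs_Ropp; specialize (Hz t); lra.
Qed.

Section Chain.
Variables (r : nat) (Q : nat -> R -> R).
Hypothesis HQ : tail_chain r Q.

Lemma chain_tail k : (k < r)%nat -> tail_of (Q k) (Q (S k)).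
Proof. apply HQ. Qed.

Lemma chain_pos k : (k <= r)%nat -> forall t, 0 < Q k t.
Proof.
induction k as [|k IH]; intros Hk t; [apply HQ|].
assert (HT := chain_tail k ltac:(lia)).
assert (Hn : forall u, 0 <= Q (S k) u).
{ intros u; apply (tail_of_nonneg (Q k) _ u HT); [|lra].
  intros v _; apply Rlt_le, IH; lia. }
destruct HT as [Hd _].
destruct (mvt _ _ t (t + 1) Hd ltac:(lra)) as (c & Hc & _).
specialize (IH ltac:(lia) c); specialize (Hn (t + 1)); lra.
Qed.

Lemma chain_continuous k : (k <= r)%nat -> forall t, continuous (Q k) t.
Proof.
destruct k as [|k]; intros Hk; [apply HQ|].
apply (tail_of_continuous (Q k)), chain_tail; lia.
Qed.

Lemma chain_decreasing k u v : (k < r)%nat -> u < v -> Q (S k) v < Q (S k) u.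
Proof.
intros Hk Huv; destruct (chain_tail k Hk) as [Hd _].
destruct (mvt _ _ u v Hd Huv) as (c & Hc & _).
assert (A := chain_pos k ltac:(lia) c); nra.
Qed.

Lemma dominated_tail M k z :
  (k < r)%nat -> dominated Q M k z ->
  tail_of z (tail z) /\ dominated Q M (S k) (tail z).
Proof.
intros Hk [Hc Hb].
destruct (tail_spec z (Q k) (Q (S k)) M Hc (chain_tail k Hk) Hb) as [H1 H2].
split; [exact H1|split; [|exact H2]].
apply (tail_of_continuous z), H1.
Qed.

Lemma dominated_itail M k i z :
  (k + i <= r)%nat -> dominated Q M k z -> dominated Q M (k + i) (itail i z).
Proof.
induction i as [|i IH]; intros Hi Hz; [rewrite Nat.add_0_r; exact Hz|].
rewrite Nat.add_succ_r; apply dominated_tail; [lia|apply IH; [lia|exact Hz]].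
Qed.

Lemma itail_tail M k i z :
  (k + i < r)%nat -> dominated Q M k z -> tail_of (itail i z) (itail (S i) z).
Proof.
intros Hi Hz; apply (dominated_tail M (k + i)); [lia|].
apply dominated_itail; [lia|exact Hz].
Qed.

Lemma dominated_lim M k z : (k < r)%nat -> dominated Q M (S k) z -> is_lim z p_infty 0.
Proof.
intros Hk [_ Hb]; apply is_lim_p_infty_eps; intros eps He.
destruct (tail_of_scal M _ _ (chain_tail k Hk)) as [_ HL].
destruct (proj1 (is_lim_p_infty_eps _ _) HL eps He) as [X HX].
exists X; intros t Ht; rewrite Rminus_0_r.
specialize (HX t Ht); rewrite Rminus_0_r in HX.
apply Rle_lt_trans with (1 := Hb t), Rle_lt_trans with (2 := HX), Rle_abs.
Qed.

Lemma dominated_lincomb M1 M2 k a b z1 z2 :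
  dominated Q M1 k z1 -> dominated Q M2 k z2 ->
  dominated Q (Rabs a * M1 + Rabs b * M2) k (fun t => a * z1 t + b * z2 t).
Proof.
intros [C1 B1] [C2 B2]; split.
- intros t; apply (continuous_Rplus (fun t => a * z1 t) (fun t => b * z2 t));
    [apply (continuous_Rmult (fun _ => a))|apply (continuous_Rmult (fun _ => b))];
    auto; apply continuous_const.
- intros t; apply Rle_trans with (1 := Rabs_triang _ _).
  rewrite !Rabs_mult, Rmult_plus_distr_r, !Rmult_assoc.
  apply Rplus_le_compat; apply Rmult_le_compat_l; auto using Rabs_pos.
Qed.

Lemma itail_lincomb M1 M2 k i a b z1 z2 :
  (k + i <= r)%nat -> dominated Q M1 k z1 -> dominated Q M2 k z2 ->
  forall t, itail i (fun t => a * z1 t + b * z2 t) t = a * itail i z1 t + b * itail i z2 t.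
Proof.
intros Hi H1 H2; induction i as [|i IH]; [reflexivity|].
intros t; apply (tail_of_unique (itail i (fun t => a * z1 t + b * z2 t))
  (itail (S i) (fun t => a * z1 t + b * z2 t))
  (fun t => a * itail (S i) z1 t + b * itail (S i) z2 t)).
- apply (itail_tail (Rabs a * M1 + Rabs b * M2) k); [lia|].
  apply dominated_lincomb; auto.
- apply (tail_of_ext (fun t => a * itail i z1 t + b * itail i z2 t)
                     _ (fun t => a * itail (S i) z1 t + b * itail (S i) z2 t)).
  + intros u; symmetry; apply IH; lia.
  + reflexivity.
  + apply tail_of_plus; apply tail_of_scal;
      [apply (itail_tail M1 k)|apply (itail_tail M2 k)]; auto; lia.
Qed.

Lemma itail_nonneg M k i z a :
  (k + i <= r)%nat -> dominated Q M k z -> (forall t, a <= t -> 0 <= z t) ->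
  forall t, a <= t -> 0 <= itail i z t.
Proof.
intros Hi Hz Hn; induction i as [|i IH]; [exact Hn|].
apply (tail_of_nonneg (itail i z)); [apply (itail_tail M k); auto; lia|].
apply IH; lia.
Qed.

Lemma chain_itail k i : (k + i <= r)%nat -> forall t, itail i (Q k) t = Q (k + i)%nat t.
Proof.
assert (HD : dominated Q 1 k (Q k) \/ (r < k)%nat).
{ destruct (Nat.le_gt_cases k r) as [Hk|Hk]; [left|right; lia]; split.
  - apply chain_continuous, Hk.
  - intros t; rewrite Rabs_right; [lra|]; apply Rle_ge, Rlt_le, chain_pos, Hk. }
intros Hi; destruct HD as [HD|]; [|lia].
induction i as [|i IH]; intros t; [rewrite Nat.add_0_r; reflexivity|].
rewrite Nat.add_succ_r.
apply (tail_of_unique (itail i (Q k)) (itail (S i) (Q k)) (Q (S (k + i)))).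
- apply (itail_tail 1 k); auto; lia.
- apply (tail_of_ext (Q (k + i)%nat) _ (Q (S (k + i)))).
  + intros u; symmetry; apply IH; lia.
  + reflexivity.
  + apply chain_tail; lia.
Qed.

(** [descents_alternates] and [alternates_descents] in turn. The latter asks for a function tending
    to 0, and at level [S k] this decay is part of [tail_chain]. *)
Lemma descents_itail M k i z n s a c :
  (S k + i <= r)%nat -> dominated Q M (S k) z ->
  descents n s a (fun t => c + itail i z t) -> descents n s a z.
Proof.
revert c; induction i as [|i IH]; intros c Hi Hz HD.
- apply (descents_ext _ _ _ (fun t => c + itail 0 z t)); [|exact HD].
  intros u v _ _; simpl; ring.
- apply (IH 0); [lia|exact Hz|].
  apply (descents_ext _ _ _ (itail i z)); [intros; ring|].
  apply alternates_descents.
  + apply (dominated_lim M (k + i)); [lia|].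
    apply (dominated_itail M (S k) i z); [lia|exact Hz].
  + apply (descents_alternates _ (itail (S i) z)).
    * apply (itail_tail M (S k)); [lia|exact Hz].
    * apply (descents_ext _ _ _ (fun t => c + itail (S i) z t)); [intros; ring|exact HD].
Qed.

(** Beyond [X] the tail is at most [M * Q (S k)], small for every such [z]; before [X] it changes by
    at most [d] times the length. So smallness of [z] on a compact interval is enough. *)
Lemma tail_small k M eps :
  (k < r)%nat -> 0 <= M -> 0 < eps ->
  exists X d, 0 <= X /\ 0 < d /\ forall z, dominated Q M k z ->
    (forall t, 0 <= t <= X -> Rabs (z t) <= d) ->
    forall t, 0 <= t -> Rabs (tail z t) <= eps.
Proof.
intros Hk HM He.
destruct (tail_of_eps _ _ (eps / 2) (tail_of_scal M _ _ (chain_tail k Hk)) ltac:(lra))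
  as (X & HX & HXe).
exists X, (eps / 2 / (X + 1)); split; [exact HX|].
assert (Hd : 0 < eps / 2 / (X + 1)) by (apply Rdiv_lt_0_compat; lra).
split; [exact Hd|]; intros z Hz Hsm.
destruct (dominated_tail M k z Hk Hz) as [HT [_ HB]].
assert (Hfar : forall t, X <= t -> Rabs (tail z t) <= eps / 2).
{ intros t Ht; apply Rle_trans with (1 := HB t), Rlt_le.
  apply Rle_lt_trans with (2 := HXe t Ht), Rle_abs. }
intros t Ht; destruct (Rle_dec X t) as [HXt|HXt].
- specialize (Hfar t HXt); lra.
- assert (A : Rabs (tail z X - tail z t)
              <= eps / 2 / (X + 1) * X - eps / 2 / (X + 1) * t).
  { apply (derive_increment_abs_le _ (fun t => - z t) (fun t => eps / 2 / (X + 1) * t)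
             (fun _ => eps / 2 / (X + 1))); [apply HT| | |lra].
    - intros u; auto_derive; [exact I|ring].
    - intros u Hu; rewrite Rabs_Ropp; apply Hsm; lra. }
  assert (B := Hfar X ltac:(lra)).
  assert (C : eps / 2 / (X + 1) * X <= eps / 2).
  { replace (eps / 2) with (eps / 2 / (X + 1) * (X + 1)) at 2 by (field; lra).
    apply Rmult_le_compat_l; lra. }
  assert (D : 0 <= eps / 2 / (X + 1) * t) by (apply Rmult_le_pos; lra).
  apply Rabs_le_between in A; apply Rabs_le_between in B; apply Rabs_le; lra.
Qed.

Lemma itail_small k i M eps :
  (k + i <= r)%nat -> 0 <= M -> 0 < eps ->
  exists d, 0 < d /\ forall z, dominated Q M k z ->
    (forall t, 0 <= t -> Rabs (z t) <= d) ->
    forall t, 0 <= t -> Rabs (itail i z t) <= eps.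
Proof.
intros Hi HM; revert eps; induction i as [|i IH]; intros eps He.
- exists eps; split; [exact He|]; intros z _ H; exact H.
- destruct (tail_small (k + i) M eps ltac:(lia) HM He) as (X & d & HX & Hd & H).
  destruct (IH ltac:(lia) d Hd) as (d' & Hd' & H').
  exists d'; split; [exact Hd'|]; intros z Hz Hs.
  apply H; [apply dominated_itail; [lia|exact Hz]|].
  intros t Ht; apply H'; auto; lra.
Qed.

Lemma itail_small_local k i M eps :
  (k + S i <= r)%nat -> 0 <= M -> 0 < eps ->
  exists X d, 0 <= X /\ 0 < d /\ forall z, dominated Q M k z ->
    (forall t, 0 <= t <= X -> Rabs (z t) <= d) ->
    forall t, 0 <= t -> Rabs (itail (S i) z t) <= eps.
Proof.
intros Hi HM He.
destruct (itail_small (S k) i M eps ltac:(lia) HM He) as (d & Hd & H).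
destruct (tail_small k M d ltac:(lia) HM Hd) as (X & d' & HX & Hd' & H').
exists X, d'; split; [exact HX|split; [exact Hd'|]]; intros z Hz Hs t Ht.
rewrite itail_S; apply H; auto; apply dominated_tail; [lia|exact Hz].
Qed.

End Chain.

(** * Linear systems, zero counting and polynomials *)

Fixpoint fsum (f : nat -> R) (n : nat) : R :=
  match n with O => 0 | S n' => fsum f n' + f n' end.

Lemma fsum_ext f g n : (forall i, (i < n)%nat -> f i = g i) -> fsum f n = fsum g n.
Proof.
induction n as [|n IH]; intros H; [reflexivity|]; simpl.
rewrite IH, H; auto.
Qed.

Lemma fsum_lincomb f g a b n :
  fsum (fun i => a * f i + b * g i) n = a * fsum f n + b * fsum g n.
Proof. induction n as [|n IH]; simpl; [ring|rewrite IH; ring]. Qed.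

Lemma fsum_zero f n : (forall i, (i < n)%nat -> f i = 0) -> fsum f n = 0.
Proof.
induction n as [|n IH]; intros H; [reflexivity|]; simpl.
rewrite IH, H; auto; ring.
Qed.

(** Gaussian elimination: the last unknown is eliminated with a pivot row [p] if its column is
    nonzero; otherwise the last unit vector is a solution. *)
Lemma exists_kernel_vector m (A : nat -> nat -> R) :
  exists b : nat -> R, (exists i, (i <= m)%nat /\ b i <> 0) /\
    forall k, (k < m)%nat -> fsum (fun i => b i * A k i) (S m) = 0.
Proof.
revert A; induction m as [|m IH]; intros A.
- exists (fun _ => 1); split; [exists O; split; [lia|lra]|intros; lia].
- destruct (classic (exists p, (p < S m)%nat /\ A p (S m) <> 0)) as [(p & Hp & HA)|Hno].
  + set (row := fun k => if Nat.ltb k p then k else S k).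
    destruct (IH (fun k i => A (row k) i - A (row k) (S m) / A p (S m) * A p i))
      as (b & (i0 & Hi0 & Hb0) & Hb).
    set (last := - fsum (fun i => b i * A p i) (S m) / A p (S m)).
    exists (fun i => if Nat.eqb i (S m) then last else b i); split.
    * exists i0; split; [lia|].
      destruct (Nat.eqb_spec i0 (S m)); [lia|auto].
    * assert (E : forall k, fsum (fun i => (if Nat.eqb i (S m) then last else b i) * A k i)
                              (S (S m))
              = fsum (fun i => b i * A k i) (S m) + last * A k (S m)).
      { intros k; change (fsum ?f (S (S m))) with (fsum f (S m) + f (S m)); cbv beta.
        rewrite Nat.eqb_refl; f_equal; apply fsum_ext; intros i Hi.
        destruct (Nat.eqb_spec i (S m)); [lia|reflexivity]. }
      intros k Hk; rewrite E.
      destruct (Nat.eq_dec k p) as [->|Hkp]; [unfold last; field; exact HA|].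
      assert (Hrow : exists k', (k' < m)%nat /\ row k' = k).
      { destruct (Nat.lt_total k p) as [Hlt|[Heq|Hgt]]; [|lia|].
        - exists k; split; [lia|]; unfold row; destruct (Nat.ltb_spec k p); lia.
        - exists (pred k); split; [lia|]; unfold row.
          destruct (Nat.ltb_spec (pred k) p); lia. }
      destruct Hrow as (k' & Hk' & <-).
      specialize (Hb k' Hk').
      rewrite (fsum_ext _ (fun i => 1 * (b i * A (row k') i)
                 + - (A (row k') (S m) / A p (S m)) * (b i * A p i))) in Hb
        by (intros; ring).
      rewrite fsum_lincomb in Hb.
      assert (Hl : last * A (row k') (S m)
        = - (A (row k') (S m) / A p (S m)) * fsum (fun i => b i * A p i) (S m))
        by (unfold last; field; exact HA).
      lra.
  + exists (fun i => if Nat.eqb i (S m) then 1 else 0); split.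
    * exists (S m); split; [lia|]; rewrite Nat.eqb_refl; lra.
    * intros k Hk.
      change (fsum ?f (S (S m))) with (fsum f (S m) + f (S m)); cbv beta.
      rewrite fsum_zero, Nat.eqb_refl.
      -- assert (A k (S m) = 0); [|lra].
         apply NNPP; intros HA; apply Hno; exists k; auto.
      -- intros i Hi; destruct (Nat.eqb_spec i (S m)); [lia|ring].
Qed.

Fixpoint zeros (k : nat) (a : R) (phi : R -> R) : Prop :=
  match k with
  | O => True
  | S k' => exists x, a < x /\ phi x = 0 /\ zeros k' x phi
  end.

Lemma zeros_weaken k a b phi : b <= a -> zeros k a phi -> zeros k b phi.
Proof. destruct k; [trivial|]; intros Hb (x & H1 & H2); exists x; split; [lra|exact H2]. Qed.

Lemma zeros_impl k a phi psi :
  (forall t, a < t -> phi t = 0 -> psi t = 0) -> zeros k a phi -> zeros k a psi.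
Proof.
revert a; induction k as [|k IH]; [trivial|]; intros a H (x & H1 & H2 & H3).
exists x; repeat split; auto; apply IH; auto; intros; apply H; auto; lra.
Qed.

(** A nonzero value [phi t] is preceded and followed by the value [phi t / 2], because [phi] is 0 at
    [x] and tends to 0; the derivative vanishes between the two occurrences. *)
Lemma rolle_at_infinity (z phi : R -> R) x :
  tail_of z phi -> phi x = 0 -> exists c, x < c /\ z c = 0.
Proof.
intros [Hd HL] Hx.
assert (Hcont : forall t, continuity_pt phi t).
{ intros t; apply continuity_pt_filterlim, (is_derive_continuous _ _ _ (Hd t)). }
destruct (classic (exists t, x < t /\ phi t <> 0)) as [(t & Ht & Hne)|Hno].
- assert (Hp := Rabs_pos_lt _ Hne).
  destruct (proj1 (is_lim_p_infty_eps _ _) HL (Rabs (phi t) / 2) ltac:(lra)) as [X HX].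
  set (Y := Rmax X (t + 1)); assert (HY := Rmax_r X (t + 1)); fold Y in HY.
  specialize (HX Y (Rmax_l _ _)); rewrite Rminus_0_r in HX; apply Rabs_def2 in HX.
  assert (Hmid : Rmin (phi x) (phi t) <= phi t / 2 <= Rmax (phi x) (phi t)).
  { rewrite Hx; unfold Rmin, Rmax; destruct (Rle_dec 0 (phi t)); lra. }
  assert (Hmid' : Rmin (phi t) (phi Y) <= phi t / 2 <= Rmax (phi t) (phi Y)).
  { unfold Rmin, Rmax; destruct (Rle_dec (phi t) (phi Y)) as [H|H];
      revert HX H; unfold Rabs; destruct (Rcase_abs (phi t)); lra. }
  destruct (IVT_gen phi x t (phi t / 2) Hcont Hmid) as (u & Hu & Hu').
  destruct (IVT_gen phi t Y (phi t / 2) Hcont Hmid') as (w & Hw & Hw').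
  rewrite Rmin_left, Rmax_right in Hu, Hw by lra.
  assert (u <> t) by (intros E; rewrite E in Hu'; lra).
  assert (u <> x) by (intros E; rewrite E in Hu'; lra).
  destruct (mvt _ _ u w Hd ltac:(lra)) as (c & Hc & Hc').
  exists c; split; [lra|].
  rewrite Hu', Hw' in Hc.
  assert (E : z c * (w - u) = 0) by lra.
  apply Rmult_integral in E; lra.
- destruct (mvt _ _ (x + 1) (x + 2) Hd ltac:(lra)) as (c & Hc & Hc').
  exists c; split; [lra|].
  assert (forall t, x < t -> phi t = 0) as H0.
  { intros t Ht; apply NNPP; intros H; apply Hno; exists t; auto. }
  rewrite !H0 in Hc by lra; lra.
Qed.

(** Between [k] zeros Rolle's theorem finds only [k - 1]; the missing one lies beyond the last zero,
    where the tail returns to 0 at infinity. *)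
Lemma zeros_tail (z phi : R -> R) k a : tail_of z phi -> zeros k a phi -> zeros k a z.
Proof.
intros HT.
assert (K : forall k x, phi x = 0 -> zeros k x phi -> zeros (S k) x z).
{ clear k a; induction k as [|k IH]; intros x Hx.
  - intros _; destruct (rolle_at_infinity z phi x HT Hx) as (c & H1 & H2).
    exists c; simpl; auto.
  - intros (x' & H1 & H2 & H3).
    destruct HT as [Hd _]; destruct (mvt _ _ x x' Hd H1) as (c & Hc & Hc').
    exists c; split; [lra|split].
    + assert (E : z c * (x' - x) = 0) by lra.
      apply Rmult_integral in E; lra.
    + apply (zeros_weaken _ x'); [lra|]; apply IH; auto. }
destruct k as [|k]; [trivial|]; intros (x & H1 & H2 & H3).
apply (zeros_weaken _ x); [lra|]; apply K; auto.
Qed.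

(** Polynomial functions of degree below [d] in Horner form, so that splitting off a root is a
    structural induction. *)
Fixpoint poly_below (d : nat) (f : R -> R) : Prop :=
  match d with
  | O => forall z, f z = 0
  | S d' => exists (a : R) (h : R -> R), poly_below d' h /\ forall z, f z = a + z * h z
  end.

Lemma poly_below_S d f : poly_below d f -> poly_below (S d) f.
Proof.
revert f; induction d as [|d IH]; intros f H.
- exists 0, (fun _ => 0); split; [intros z; reflexivity|intros z; rewrite H; ring].
- destruct H as (a & h & H1 & H2); exists a, h; split; auto.
Qed.

Lemma poly_below_lincomb d a b f g h :
  poly_below d f -> poly_below d g -> (forall z, h z = a * f z + b * g z) ->
  poly_below d h.
Proof.
revert f g h; induction d as [|d IH]; intros f g h Hf Hg H.
- intros z; rewrite H, Hf, Hg; ring.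
- destruct Hf as (a1 & h1 & P1 & E1), Hg as (a2 & h2 & P2 & E2).
  exists (a * a1 + b * a2), (fun z => a * h1 z + b * h2 z); split.
  + apply (IH h1 h2); auto.
  + intros z; rewrite H, E1, E2; ring.
Qed.

Lemma poly_below_mul_linear d q f g :
  poly_below d f -> (forall z, g z = f z * (z - q)) -> poly_below (S d) g.
Proof.
intros Hf Hg; apply (poly_below_lincomb (S d) 1 (- q) (fun z => z * f z) f).
- exists 0, f; split; [auto|intros; ring].
- apply poly_below_S, Hf.
- intros z; rewrite Hg; ring.
Qed.

Lemma poly_below_root d f q :
  poly_below (S d) f -> f q = 0 ->
  exists k, poly_below d k /\ forall z, f z = (z - q) * k z.
Proof.
intros Hf Hq.
enough (exists k, poly_below d k /\ forall z, f z - f q = (z - q) * k z) as (k & H1 & H2).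
{ exists k; split; [exact H1|]; intros z; rewrite <- H2, Hq; ring. }
clear Hq; revert f Hf; induction d as [|d IH]; intros f (a & h & H1 & H2).
- exists (fun _ => 0); split; [intros z; reflexivity|].
  intros z; rewrite !H2, !H1; ring.
- destruct (IH h H1) as (k & K1 & K2).
  exists (fun z => h z + q * k z); split.
  + apply (poly_below_lincomb (S d) 1 q h k); auto using poly_below_S.
    intros; ring.
  + intros z; rewrite !H2.
    replace (a + z * h z - (a + q * h q)) with ((z - q) * h z + q * (h z - h q)) by ring.
    rewrite K2; ring.
Qed.

(** Each zero splits off a linear factor, which does not vanish at the later zeros because [e] is
    injective. *)
Lemma poly_below_zeros d f (e : R -> R) a :
  (forall s t, s < t -> e s <> e t) -> poly_below d f -> zeros d a (fun s => f (e s)) ->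
  forall z, f z = 0.
Proof.
intros He; revert f a; induction d as [|d IH]; intros f a Hf HZ; [exact Hf|].
destruct HZ as (x & H1 & H2 & H3).
destruct (poly_below_root d f (e x) Hf H2) as (k & K1 & K2).
assert (K0 : forall z, k z = 0).
{ apply (IH k x K1), (zeros_impl _ _ (fun s => f (e s))); [|exact H3].
  intros t Ht; rewrite K2; intros E; apply Rmult_integral in E; destruct E; [|auto].
  exfalso; apply (He x t Ht); lra. }
intros z; rewrite K2, K0; ring.
Qed.

(** * Smoothed sign patterns *)

Lemma alternates_ext k s a phi psi :
  (forall t, a <= t -> phi t = psi t) -> alternates k s a phi -> alternates k s a psi.
Proof.
revert s a; induction k as [|k IH]; [trivial|]; intros s a H (x & H1 & H2 & H3).
exists x; rewrite <- H by auto; repeat split; auto.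
apply IH; auto; intros; apply H; lra.
Qed.

Lemma alternates_nonneg_factor k s a p phi :
  (forall t, a <= t -> 0 <= p t) -> alternates k s a (fun t => phi t * p t) ->
  alternates k s a phi.
Proof.
revert s a; induction k as [|k IH]; [trivial|]; intros s a H (x & H1 & H2 & H3).
exists x; repeat split; auto.
- specialize (H x H1); apply Rnot_le_lt; intros C; nra.
- apply IH; auto; intros; apply H; lra.
Qed.

Lemma alternates_nonpos_factor k s a p phi :
  (forall t, a <= t -> p t <= 0) -> alternates k s a (fun t => phi t * p t) ->
  alternates k (- s) a phi.
Proof.
revert s a; induction k as [|k IH]; [trivial|]; intros s a H (x & H1 & H2 & H3).
exists x; repeat split; auto.
- specialize (H x H1); apply Rnot_le_lt; intros C; nra.
- apply IH; auto; intros; apply H; lra.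
Qed.

(** Once negative, [p] stays so. If it is negative at the first point, all signs are reversed;
    otherwise a reversal can only occur further on and costs at most one point of the chain. *)
Lemma alternates_product k s a p phi :
  (forall x y, x <= y -> p x < 0 -> p y < 0) ->
  alternates k s a (fun t => phi t * p t) ->
  alternates k s a phi \/ alternates k (- s) a phi \/ alternates (pred k) s a phi.
Proof.
intros Hp; revert s a; induction k as [|k IH]; [intros; left; exact I|].
intros s a (x & H1 & H2 & H3).
destruct (Rlt_dec (p x) 0) as [Hx|Hx].
- right; left; apply (alternates_weaken _ _ x); [exact H1|].
  apply (alternates_nonpos_factor _ _ _ p).
  + intros t Ht; apply Rlt_le, (Hp x); auto.
  + exists x; repeat split; auto; lra.
- assert (Hphi : 0 < s * phi x) by (apply Rnot_le_lt; intros C; nra).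
  destruct (IH _ _ H3) as [H|[H|H]].
  + left; exists x; auto.
  + right; right; rewrite Ropp_involutive in H; simpl; apply (alternates_weaken _ _ x); auto.
  + destruct k as [|k]; [left; exists x; simpl; auto|].
    right; right; change (alternates (S k) s a phi); exists x; auto.
Qed.

Section Smooth.
Variable nu : R.
Hypothesis Hnu : 0 < nu.

Definition vexp (s : R) : R := exp (- (nu * s)).

(* A smooth switch from 1 to -1 where exp (- nu s) = th, namely tanh (- (nu s + ln th) / 2). *)
Definition switch (th s : R) : R := (vexp s - th) / (vexp s + th).
(** The derivative in the parameter [th], not in [s]. *)
Definition dswitch (th s : R) : R := - (2 * vexp s) / (vexp s + th) ^ 2.

(** The [th i] need not be ordered; [th i = 0] makes its factor 1 and thus removes the knot. *)
Fixpoint hprod (th : nat -> R) (n : nat) (s : R) : R :=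
  match n with O => 1 | S n' => hprod th n' s * switch (th n') s end.

Lemma vexp_pos s : 0 < vexp s.
Proof. apply exp_pos. Qed.

Lemma vexp_lt s t : s < t -> vexp t < vexp s.
Proof. intros H; apply exp_increasing; nra. Qed.

Lemma vexp_le s t : s <= t -> vexp t <= vexp s.
Proof. intros [H| ->]; [left; apply vexp_lt, H|right; reflexivity]. Qed.

Lemma switch_abs th s : 0 <= th -> Rabs (switch th s) <= 1.
Proof.
intros Ht; unfold switch; assert (A := vexp_pos s).
unfold Rdiv; rewrite Rabs_mult, (Rabs_right (/ _)) by (left; apply Rinv_0_lt_compat; lra).
apply Rmult_le_reg_r with (vexp s + th); [lra|].
rewrite Rmult_assoc, Rinv_l, Rmult_1_r, Rmult_1_l by lra.
apply Rabs_le; lra.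
Qed.

Lemma switch_0 s : switch 0 s = 1.
Proof. unfold switch; assert (A := vexp_pos s); field; lra. Qed.

Lemma switch_sign_compare th s : 0 <= th -> (switch th s < 0 <-> vexp s < th).
Proof.
intros Ht; unfold switch; assert (A := vexp_pos s); split; intros H.
- apply Rnot_le_lt; intros C; apply Rlt_not_le in H; apply H.
  apply Rdiv_le_0_compat; lra.
- apply Ropp_lt_cancel; rewrite Ropp_0, <- Rdiv_opp_l.
  apply Rdiv_lt_0_compat; lra.
Qed.

Lemma switch_sign th x y : 0 <= th -> x <= y -> switch th x < 0 -> switch th y < 0.
Proof.
intros Ht Hxy; rewrite !switch_sign_compare by auto.
assert (A := vexp_le x y Hxy); lra.
Qed.

Lemma switch_nonpos th s : 1 <= th -> 0 <= s -> switch th s <= 0.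
Proof.
intros Ht Hs; unfold switch; assert (A := vexp_pos s).
assert (B := vexp_le 0 s Hs); unfold vexp in B at 2; rewrite Rmult_0_r, Ropp_0, exp_0 in B.
apply Ropp_le_cancel; rewrite Ropp_0, <- Rdiv_opp_l.
apply Rdiv_le_0_compat; lra.
Qed.

(** The defect [1 - switch ^ 2] from a true sign is thus an exact derivative, so that its integral
    is of order [1 / nu]. This quantifies the convergence to perfect splines. *)
Lemma is_derive_switch th s :
  0 <= th -> is_derive (switch th) s (- (nu / 2) * (1 - switch th s ^ 2)).
Proof.
intros Ht; assert (A := vexp_pos s); unfold switch, vexp in *; auto_derive; [lra|].
field; lra.
Qed.

Lemma hprod_abs th n s : (forall i, (i < n)%nat -> 0 <= th i) -> Rabs (hprod th n s) <= 1.
Proof.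
induction n as [|n IH]; intros Ht; simpl; [rewrite Rabs_R1; lra|].
rewrite Rabs_mult, <- (Rmult_1_r 1).
apply Rmult_le_compat; auto using Rabs_pos, switch_abs.
Qed.

Lemma hprod_continuous th n s :
  (forall i, (i < n)%nat -> 0 <= th i) -> continuous (hprod th n) s.
Proof.
induction n as [|n IH]; intros Ht; simpl; [apply continuous_const|].
apply (continuous_Rmult (hprod th n)); [apply IH; auto|].
eapply is_derive_continuous, is_derive_switch; auto.
Qed.

Lemma hprod_ext th th' n s :
  (forall i, (i < n)%nat -> th i = th' i) -> hprod th n s = hprod th' n s.
Proof.
induction n as [|n IH]; intros Ht; simpl; [reflexivity|].
rewrite IH, Ht; auto.
Qed.

Definition update (x : nat -> R) (j : nat) (t : R) (i : nat) : R :=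
  if Nat.eqb i j then t else x i.

Lemma update_eq x j t : update x j t j = t.
Proof. unfold update; rewrite Nat.eqb_refl; reflexivity. Qed.

Lemma update_neq x j t i : i <> j -> update x j t i = x i.
Proof. intros H; unfold update; destruct (Nat.eqb_spec i j); [lia|reflexivity]. Qed.

Lemma hprod_remove th n i s :
  (i < n)%nat -> hprod th n s = hprod (update th i 0) n s * switch (th i) s.
Proof.
induction n as [|n IH]; intros Hi; [lia|]; simpl.
destruct (Nat.eq_dec i n) as [->|Hne].
- rewrite update_eq, switch_0.
  rewrite (hprod_ext (update th n 0) th); [ring|].
  intros j Hj; apply update_neq; lia.
- rewrite IH by lia; rewrite (update_neq th i 0 n) by lia; ring.
Qed.

Fixpoint count_active (th : nat -> R) (n : nat) : nat :=
  match n with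
  | O => O
  | S n' => count_active th n' + (if Req_dec_T (th n') 0 then 0 else 1)
  end.

Lemma count_active_le th n : (count_active th n <= n)%nat.
Proof. induction n as [|n IH]; simpl; [lia|]; destruct (Req_dec_T _ _); lia. Qed.

Lemma count_active_one th n i : (i < n)%nat -> th i = 0 -> (count_active th n < n)%nat.
Proof.
induction n as [|n IH]; intros Hi H0; [lia|]; simpl.
destruct (Nat.eq_dec i n) as [->|Hne].
- destruct (Req_dec_T (th n) 0); [|contradiction]; assert (A := count_active_le th n); lia.
- specialize (IH ltac:(lia) H0); destruct (Req_dec_T _ _); lia.
Qed.

Lemma count_active_two th n i j :
  (i < j)%nat -> (j < n)%nat -> th i = 0 -> th j = 0 -> (count_active th n < n - 1)%nat.
Proof.
intros Hij; induction n as [|n IH]; intros Hj Hi0 Hj0; [lia|]; simpl.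
destruct (Nat.eq_dec j n) as [->|Hne].
- assert (A := count_active_one th n i Hij Hi0).
  destruct (Req_dec_T (th n) 0); [lia|contradiction].
- specialize (IH ltac:(lia) Hi0 Hj0); destruct (Req_dec_T _ _); lia.
Qed.

(** The empty product is positive, and by [alternates_product] each active factor admits one more
    alternation. *)
Lemma hprod_alternates_bound th n a k :
  (forall i, (i < n)%nat -> 0 <= th i) ->
  (alternates k 1 a (hprod th n) -> (k <= count_active th n + 1)%nat) /\
  (alternates k (-1) a (hprod th n) -> (k <= count_active th n)%nat).
Proof.
revert k; induction n as [|n IH]; intros k Ht.
- assert (H0 : forall b j, alternates j (-1) b (hprod th 0) -> (j <= 0)%nat).
  { intros b [|j]; [lia|]; intros (x & _ & H & _); simpl in H; lra. }
  split; [|apply H0].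
  destruct k as [|k]; [lia|]; intros (x & _ & _ & H).
  specialize (H0 x k ltac:(exact H)); simpl; lia.
- assert (IH' := fun k => IH k (fun i Hi => Ht i ltac:(lia))); clear IH.
  simpl; destruct (Req_dec_T (th n) 0) as [E|E].
  + rewrite Nat.add_0_r.
    assert (Hx : forall s, alternates k s a (hprod th (S n)) -> alternates k s a (hprod th n)).
    { intros s; apply alternates_ext; intros t _; simpl; rewrite E, switch_0; ring. }
    split; intros H; apply IH', Hx, H.
  + assert (Hp : forall x y, x <= y -> switch (th n) x < 0 -> switch (th n) y < 0)
      by (intros x y; apply switch_sign; auto).
    assert (Hpred : forall s, alternates (pred k) s a (hprod th n) ->
              alternates (pred k) s a (hprod th n)) by auto.
    split; intros H; apply (alternates_product _ _ _ (switch (th n))) in H; auto;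
      destruct H as [H|[H|H]].
    * apply IH' in H; lia.
    * apply IH' in H; lia.
    * apply IH' in H; lia.
    * apply IH' in H; lia.
    * replace (- -1) with 1 in H by ring; apply IH' in H; lia.
    * apply IH' in H; lia.
Qed.

(** Every degeneracy lowers the possible number of alternations: a factor with [th i >= 1] is
    nonpositive on the half-line, and its removal reverses the signs; two equal factors form a
    square and can both be removed; [th i = 0] is inactive. *)
Lemma hprod_alternates_knots th n :
  (forall i, (i < n)%nat -> 0 <= th i) -> alternates (S n) 1 0 (hprod th n) ->
  (forall i, (i < n)%nat -> 0 < th i < 1) /\
  (forall i j, (i < j)%nat -> (j < n)%nat -> th i <> th j).
Proof.
intros Ht HA; split.
- intros i Hi; destruct (Ht i Hi) as [Hp|E].
  + split; [exact Hp|]; apply Rnot_le_lt; intros C.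
    assert (HA' : alternates (S n) (- 1) 0 (hprod (update th i 0) n)).
    { apply (alternates_nonpos_factor _ _ _ (switch (th i))).
      - intros t Ht'; apply switch_nonpos; auto.
      - apply (alternates_ext _ _ _ (hprod th n)); [|exact HA].
        intros t _; apply hprod_remove, Hi. }
    apply hprod_alternates_bound in HA'.
    * assert (A := count_active_one (update th i 0) n i Hi (update_eq _ _ _)); lia.
    * intros j Hj; unfold update; destruct (Nat.eqb j i); auto; lra.
  + apply hprod_alternates_bound in HA; auto.
    assert (A := count_active_one th n i Hi (eq_sym E)); lia.
- intros i j Hij Hj E.
  assert (HA' : alternates (S n) 1 0 (hprod (update (update th i 0) j 0) n)).
  { apply (alternates_nonneg_factor _ _ _ (fun t => switch (th i) t * switch (th i) t)).
    - intros t _; nra.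
    - apply (alternates_ext _ _ _ (hprod th n)); [|exact HA].
      intros t _; rewrite (hprod_remove th n i), (hprod_remove (update th i 0) n j) by lia.
      rewrite (update_neq th i 0 j), <- E by lia; ring. }
  apply hprod_alternates_bound in HA'.
  + assert (A := count_active_two (update (update th i 0) j 0) n i j Hij Hj).
    rewrite update_eq, (update_neq _ j 0 i), update_eq in A by lia.
    specialize (A eq_refl eq_refl); lia.
  + intros k Hk; unfold update; destruct (Nat.eqb k j), (Nat.eqb k i); auto; lra.
Qed.

(** The partial derivative of [hprod] in [th i]; [hvar] below is the derivative in the direction
    [al]. *)
Fixpoint hcoef (th : nat -> R) (n i : nat) (s : R) : R :=
  match n with
  | O => 0
  | S n' => if Nat.eqb i n' then hprod th n' s * dswitch (th n') s
            else hcoef th n' i s * switch (th n') s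
  end.

Definition hvar (th al : nat -> R) (n : nat) (s : R) : R :=
  fsum (fun i => al i * hcoef th n i s) n.

Lemma hvar_S th al n s :
  hvar th al (S n) s
  = hvar th al n s * switch (th n) s + hprod th n s * (al n * dswitch (th n) s).
Proof.
unfold hvar; simpl fsum; cbn [hcoef]; rewrite Nat.eqb_refl.
rewrite (fsum_ext _ (fun i => switch (th n) s * (al i * hcoef th n i s) + 0 * 0)).
- rewrite (fsum_lincomb _ (fun _ => 0)); ring.
- intros i Hi; destruct (Nat.eqb_spec i n); [lia|ring].
Qed.

Lemma dswitch_abs th s : 0 < th -> Rabs (dswitch th s) <= / (2 * th).
Proof.
intros Ht; assert (A := vexp_pos s); unfold dswitch.
assert (B : 0 < (vexp s + th) ^ 2) by (apply pow_lt; lra).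
rewrite Rabs_left1.
- apply Rmult_le_reg_r with ((vexp s + th) ^ 2); [exact B|].
  replace (- (- (2 * vexp s) / (vexp s + th) ^ 2) * (vexp s + th) ^ 2)
    with (2 * vexp s) by (field; lra).
  apply Rmult_le_reg_l with (2 * th); [lra|].
  replace (2 * th * (/ (2 * th) * (vexp s + th) ^ 2)) with ((vexp s + th) ^ 2) by (field; lra).
  assert (0 <= (vexp s - th) ^ 2) by apply pow2_ge_0; nra.
- apply Ropp_le_cancel; rewrite Ropp_0, <- Rdiv_opp_l, Ropp_involutive.
  apply Rdiv_le_0_compat; lra.
Qed.

Lemma dswitch_continuous th s : 0 < th -> continuous (dswitch th) s.
Proof.
intros Ht; apply (ex_derive_continuous (V := R_NormedModule)).
assert (A := vexp_pos s); unfold dswitch, vexp in *; auto_derive.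
apply Rgt_not_eq, Rmult_lt_0_compat; [lra|]; rewrite Rmult_1_r; lra.
Qed.

Lemma hcoef_regular th n i :
  (forall i, (i < n)%nat -> 0 < th i) ->
  (forall s, continuous (hcoef th n i) s) /\
  exists B, forall s, Rabs (hcoef th n i s) <= B.
Proof.
induction n as [|n IH]; intros Ht; simpl.
- split; [intros; apply continuous_const|exists 0; intros; rewrite Rabs_R0; lra].
- assert (Ht' : forall i, (i < n)%nat -> 0 <= th i) by (intros; apply Rlt_le; auto).
  destruct (Nat.eqb i n); split.
  + intros s; apply (continuous_Rmult (hprod th n)).
    * apply hprod_continuous; auto.
    * apply dswitch_continuous; auto.
  + exists (1 * / (2 * th n)); intros s; rewrite Rabs_mult.
    apply Rmult_le_compat; auto using Rabs_pos, hprod_abs, dswitch_abs.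
  + intros s; apply (continuous_Rmult (hcoef th n i)); [apply IH; auto|].
    eapply is_derive_continuous, is_derive_switch, Rlt_le; auto.
  + destruct IH as [_ [B HB]]; auto; exists (B * 1); intros s; rewrite Rabs_mult.
    apply Rmult_le_compat; auto using Rabs_pos, switch_abs, Rlt_le.
Qed.

Lemma hvar_bounded th al n :
  (forall i, (i < n)%nat -> 0 < th i) -> exists B, forall s, Rabs (hvar th al n s) <= B.
Proof.
intros Ht; unfold hvar.
enough (forall m, exists B, forall s, Rabs (fsum (fun i => al i * hcoef th n i s) m) <= B)
  by auto.
induction m as [|m [B HB]]; simpl.
- exists 0; intros; rewrite Rabs_R0; lra.
- destruct (hcoef_regular th n m Ht) as [_ [C HC]].
  exists (B + Rabs (al m) * C); intros s.
  apply Rle_trans with (1 := Rabs_triang _ _), Rplus_le_compat; auto.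
  rewrite Rabs_mult; apply Rmult_le_compat_l; auto using Rabs_pos.
Qed.

(** Multiplication by [(v + th) ^ 2] turns a switch into [v ^ 2 - th ^ 2] and its derivative in [th]
    into [- 2 v]. Over this common denominator [hvar] becomes [- 2 v] times [vpoly], a polynomial of
    degree below [n] in [v ^ 2]. *)
Fixpoint hden (th : nat -> R) (n : nat) (s : R) : R :=
  match n with O => 1 | S n' => hden th n' s * (vexp s + th n') ^ 2 end.
Fixpoint hpoly (th : nat -> R) (n : nat) (z : R) : R :=
  match n with O => 1 | S n' => hpoly th n' z * (z - th n' ^ 2) end.
Fixpoint vpoly (th al : nat -> R) (n : nat) (z : R) : R :=
  match n with
  | O => 0
  | S n' => vpoly th al n' z * (z - th n' ^ 2) + al n' * hpoly th n' z
  end.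

Lemma hprod_hden th n s :
  (forall i, (i < n)%nat -> 0 < th i) -> hprod th n s * hden th n s = hpoly th n (vexp s ^ 2).
Proof.
induction n as [|n IH]; intros Ht; cbn [hprod hden hpoly]; [ring|].
rewrite <- IH by auto; assert (A := vexp_pos s); specialize (Ht n ltac:(lia)).
unfold switch; field; lra.
Qed.

Lemma hvar_hden th al n s :
  (forall i, (i < n)%nat -> 0 < th i) ->
  hvar th al n s * hden th n s
  = - vpoly th al n (vexp s ^ 2) * (2 * vexp s).
Proof.
induction n as [|n IH]; intros Ht; [unfold hvar; simpl; ring|].
rewrite hvar_S; cbn [hden vpoly].
assert (Ht' : forall i, (i < n)%nat -> 0 < th i) by auto.
assert (E := hprod_hden th n s Ht'); specialize (IH Ht').
assert (A := vexp_pos s); specialize (Ht n ltac:(lia)).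
replace ((hvar th al n s * switch (th n) s + hprod th n s * (al n * dswitch (th n) s))
          * (hden th n s * (vexp s + th n) ^ 2))
  with ((hvar th al n s * hden th n s) * (vexp s ^ 2 - th n ^ 2)
        - (hprod th n s * hden th n s) * (al n * (2 * vexp s)))
  by (unfold switch, dswitch; field; lra).
rewrite IH, E; ring.
Qed.

Lemma hpoly_below th n : poly_below (S n) (hpoly th n).
Proof.
induction n as [|n IH]; [exists 1, (fun _ => 0); split; [intros z; reflexivity|intros; simpl; ring]|].
apply (poly_below_mul_linear _ (th n ^ 2) (hpoly th n)); auto.
Qed.

Lemma vpoly_below th al n : poly_below n (vpoly th al n).
Proof.
induction n as [|n IH]; [intros z; reflexivity|].
apply (poly_below_lincomb (S n) 1 (al n) (fun z => vpoly th al n z * (z - th n ^ 2))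
         (hpoly th n)).
- apply (poly_below_mul_linear _ (th n ^ 2) (vpoly th al n)); auto.
- apply hpoly_below.
- intros z; simpl; ring.
Qed.

Lemma hpoly_root th n i : (i < n)%nat -> hpoly th n (th i ^ 2) = 0.
Proof.
induction n as [|n IH]; intros Hi; [lia|]; cbn [hpoly].
destruct (Nat.eq_dec i n) as [->|]; [ring|rewrite IH by lia; ring].
Qed.

Lemma hpoly_neq th n z :
  (forall i, (i < n)%nat -> z <> th i ^ 2) -> hpoly th n z <> 0.
Proof.
induction n as [|n IH]; intros H; cbn [hpoly]; [lra|].
apply Rmult_integral_contrapositive; split; [auto|].
specialize (H n ltac:(lia)); lra.
Qed.

(** As in Lagrange interpolation: at [th i ^ 2] all terms but the [i]-th vanish, and its cofactor is
    nonzero since the knots are positive and distinct. *)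
Lemma vpoly_zero th al n :
  (forall i, (i < n)%nat -> 0 < th i) ->
  (forall i j, (i < j)%nat -> (j < n)%nat -> th i <> th j) ->
  (forall i, (i < n)%nat -> vpoly th al n (th i ^ 2) = 0) ->
  forall i, (i < n)%nat -> al i = 0.
Proof.
assert (Hsq : forall x y, 0 < x -> 0 < y -> x ^ 2 = y ^ 2 -> x = y).
{ intros x y Hx Hy E; assert (F : (x - y) * (x + y) = 0) by lra.
  apply Rmult_integral in F; lra. }
induction n as [|n IH]; intros Ht Hd H0; [lia|]; cbn [vpoly] in H0.
assert (Hn : al n = 0).
{ specialize (H0 n ltac:(lia)).
  assert (A : hpoly th n (th n ^ 2) <> 0).
  { apply hpoly_neq; intros i Hi E; apply (Hd i n Hi ltac:(lia)).
    symmetry; apply Hsq; auto; apply Ht; lia. }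
  assert (B : al n * hpoly th n (th n ^ 2) = 0) by lra.
  apply Rmult_integral in B; tauto. }
intros i Hi; destruct (Nat.eq_dec i n) as [->|Hne]; [exact Hn|].
apply IH; auto; [|lia].
intros j Hj; specialize (H0 j ltac:(lia)).
rewrite hpoly_root, Rmult_0_r, Rplus_0_r in H0 by exact Hj.
apply Rmult_integral in H0; destruct H0 as [H0|H0]; [exact H0|exfalso].
apply (Hd j n Hj ltac:(lia)), Hsq; [apply Ht; lia|apply Ht; lia|lra].
Qed.

(* The derivatives of hprod in its knots form a Chebyshev system. *)
Lemma hvar_zeros th al n a :
  (forall i, (i < n)%nat -> 0 < th i) ->
  (forall i j, (i < j)%nat -> (j < n)%nat -> th i <> th j) ->
  zeros n a (hvar th al n) -> forall i, (i < n)%nat -> al i = 0.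
Proof.
intros Ht Hd HZ; apply (vpoly_zero th); auto; intros i _.
apply (poly_below_zeros n (vpoly th al n) (fun s => vexp s ^ 2) a).
- intros s t Hst E; assert (A := vexp_lt s t Hst); assert (B := vexp_pos t).
  assert (C : (vexp s - vexp t) * (vexp s + vexp t) = 0) by lra.
  apply Rmult_integral in C; lra.
- apply vpoly_below.
- apply (zeros_impl _ _ (hvar th al n)); [|exact HZ].
  intros t _ E; assert (F := hvar_hden th al n t Ht); rewrite E, Rmult_0_l in F.
  assert (A := vexp_pos t); symmetry in F; apply Rmult_integral in F; lra.
Qed.

(** The remainder is exactly [2 v d^2] over [(v + th)^2 (v + th + d)]. By [(v + th)^2 >= 4 v th] and
    [v + th + d >= th / 2] the factor [v] cancels, and the bound is uniform in [s]. *)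
Lemma switch_expansion th d s :
  0 < th -> - (th / 2) <= d ->
  Rabs (switch (th + d) s - switch th s - d * dswitch th s) <= / th ^ 2 * d ^ 2.
Proof.
intros Ht Hd; assert (A := vexp_pos s).
set (v := vexp s) in *.
assert (B : 0 < (v + th) ^ 2 * (v + (th + d))) by (apply Rmult_lt_0_compat; [apply pow_lt|]; lra).
replace (switch (th + d) s - switch th s - d * dswitch th s)
  with (2 * v / ((v + th) ^ 2 * (v + (th + d))) * d ^ 2)
  by (unfold switch, dswitch; fold v; field; lra).
assert (D := pow2_ge_0 d).
rewrite Rabs_right.
- apply Rmult_le_compat_r; [exact D|].
  apply Rmult_le_reg_r with ((v + th) ^ 2 * (v + (th + d))); [exact B|].
  unfold Rdiv; rewrite Rmult_assoc, Rinv_l, Rmult_1_r by lra.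
  assert (T : 0 < th ^ 2) by (apply pow_lt, Ht).
  apply Rmult_le_reg_l with (th ^ 2); [exact T|].
  replace (th ^ 2 * (/ th ^ 2 * ((v + th) ^ 2 * (v + (th + d)))))
    with ((v + th) ^ 2 * (v + (th + d))) by (field; lra).
  apply Rle_trans with ((4 * v * th) * (th / 2)); [right; field|].
  apply Rmult_le_compat; try lra.
  + apply Rmult_le_pos; lra.
  + assert (0 <= (v - th) ^ 2) by apply pow2_ge_0; nra.
- apply Rle_ge, Rmult_le_pos; [apply Rdiv_le_0_compat; lra|exact D].
Qed.

Lemma hprod_expansion th al n :
  (forall i, (i < n)%nat -> 0 < th i) ->
  exists C d0, 0 <= C /\ 0 < d0 <= 1 /\ forall d s, Rabs d <= d0 ->
    (forall i, (i < n)%nat -> 0 < th i + d * al i) /\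
    Rabs (hprod (fun i => th i + d * al i) n s - hprod th n s - d * hvar th al n s)
      <= C * d ^ 2.
Proof.
induction n as [|n IH]; intros Ht.
- exists 0, 1; split; [lra|split; [lra|]]; intros d s _; split; [lia|].
  unfold hvar; simpl; replace (1 - 1 - d * 0) with 0 by ring; rewrite Rabs_R0; lra.
- assert (Ht' : forall i, (i < n)%nat -> 0 < th i) by auto.
  destruct (IH Ht') as (C & d0 & HC & Hd0 & H); clear IH.
  destruct (hvar_bounded th al n Ht') as [B HB].
  assert (HB0 : 0 <= B) by (apply Rle_trans with (2 := HB 0), Rabs_pos).
  specialize (Ht n ltac:(lia)); set (tn := th n) in *; set (an := al n).
  set (K := / tn ^ 2 * an ^ 2); set (L := Rabs an * / (2 * tn)).
  assert (HK : 0 <= K).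
  { apply Rmult_le_pos; [left; apply Rinv_0_lt_compat, pow_lt, Ht|apply pow2_ge_0]. }
  assert (HL : 0 <= L).
  { apply Rmult_le_pos; [apply Rabs_pos|left; apply Rinv_0_lt_compat; lra]. }
  (* Keeps [d * an] within half of [tn], as [switch_expansion] requires. *)
  set (d1 := tn / (2 * (Rabs an + 1))).
  assert (Han := Rabs_pos an).
  assert (Hd1 : 0 < d1) by (apply Rdiv_lt_0_compat; lra).
  exists (C + K + B * (L + K)), (Rmin d0 d1).
  assert (Hm1 := Rmin_l d0 d1); assert (Hm2 := Rmin_r d0 d1).
  split; [assert (0 <= B * (L + K)) by (apply Rmult_le_pos; lra); lra|].
  split; [split; [apply Rmin_glb_lt; lra|lra]|].
  intros d s Hd; destruct (H d s ltac:(lra)) as [H1 H2].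
  assert (Hda : Rabs (d * an) <= tn / 2).
  { rewrite Rabs_mult; apply Rle_trans with (d1 * (Rabs an + 1)).
    - apply Rmult_le_compat; auto using Rabs_pos; lra.
    - right; unfold d1; field; lra. }
  apply Rabs_le_between in Hda.
  split.
  + intros i Hi; destruct (Nat.eq_dec i n) as [->|Hne]; [fold tn an; lra|].
    apply H1; lia.
  + rewrite hvar_S; cbn [hprod]; fold tn an.
    set (P := hprod (fun i => th i + d * al i) n s) in *; set (P0 := hprod th n s) in *.
    set (P1 := hvar th al n s) in *.
    set (F := switch (tn + d * an) s); set (F0 := switch tn s); set (F1 := dswitch tn s).
    assert (E1 : Rabs (F - F0 - d * (an * F1)) <= K * d ^ 2).
    { replace (d * (an * F1)) with (d * an * F1) by ring.
      apply Rle_trans with (/ tn ^ 2 * (d * an) ^ 2).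
      - apply switch_expansion; lra.
      - right; unfold K; field; lra. }
    assert (EF : Rabs F <= 1) by (apply switch_abs; lra).
    assert (EP0 : Rabs P0 <= 1) by (apply hprod_abs; intros; apply Rlt_le; auto).
    assert (EF1 : Rabs (an * F1) <= L).
    { unfold L; rewrite Rabs_mult; apply Rmult_le_compat_l; auto; apply dswitch_abs, Ht. }
    assert (Hd2 : Rabs d ^ 2 = d ^ 2) by (rewrite RPow_abs; apply Rabs_right, Rle_ge, pow2_ge_0).
    assert (Hd3 := Rabs_pos d).
    assert (EFF : Rabs (F - F0) <= Rabs d * (L + K)).
    { replace (F - F0) with (d * (an * F1) + (F - F0 - d * (an * F1))) by ring.
      apply Rle_trans with (1 := Rabs_triang _ _).
      rewrite (Rabs_mult d).
      assert (Rabs d * Rabs (an * F1) <= Rabs d * L) by (apply Rmult_le_compat_l; auto).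
      assert (K * d ^ 2 <= Rabs d * K).
      { rewrite <- Hd2; replace (K * Rabs d ^ 2) with (Rabs d * (K * Rabs d)) by ring.
        apply Rmult_le_compat_l; auto.
        rewrite <- (Rmult_1_r K) at 2; apply Rmult_le_compat_l; lra. }
      lra. }
    (* The remainder of the first factors, that of the last factor, and a mixed term of second
       order; they account for the summands [C], [K] and [B * (L + K)] of the constant. *)
    replace (P * F - P0 * F0 - d * (P1 * F0 + P0 * (an * F1)))
      with ((P - P0 - d * P1) * F + P0 * (F - F0 - d * (an * F1)) + d * P1 * (F - F0)) by ring.
    apply Rle_trans with (1 := Rabs_triang _ _).
    apply Rle_trans with (Rabs ((P - P0 - d * P1) * F) + Rabs (P0 * (F - F0 - d * (an * F1)))
                          + Rabs (d * P1 * (F - F0))).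
    { apply Rplus_le_compat_r, Rabs_triang. }
    rewrite !Rabs_mult.
    assert (G1 : Rabs (P - P0 - d * P1) * Rabs F <= C * d ^ 2 * 1)
      by (apply Rmult_le_compat; auto using Rabs_pos).
    assert (G2 : Rabs P0 * Rabs (F - F0 - d * (an * F1)) <= 1 * (K * d ^ 2))
      by (apply Rmult_le_compat; auto using Rabs_pos).
    assert (G3 : Rabs d * Rabs P1 * Rabs (F - F0) <= Rabs d * B * (Rabs d * (L + K))).
    { apply Rmult_le_compat; auto using Rabs_pos.
      - apply Rmult_le_pos; auto using Rabs_pos.
      - apply Rmult_le_compat_l; auto; apply HB. }
    replace (Rabs d * B * (Rabs d * (L + K))) with (B * (L + K) * Rabs d ^ 2) in G3 by ring.
    rewrite Hd2 in G3; lra.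
Qed.

End Smooth.

(** * Extraction of convergent subsequences *)

Lemma bolzano_weierstrass (u : nat -> R) (B : R) :
  (forall n, Rabs (u n) <= B) ->
  exists phi : nat -> nat, (forall n, (n <= phi n)%nat) /\
    (forall n, (phi n < phi (S n))%nat) /\ exists l : R, is_lim_seq (fun n => u (phi n)) l.
Proof.
intros HB.
destruct (ex_LimSup_seq u) as [l Hl].
assert (Hfin : exists l0, l = Finite l0).
{ destruct l as [l0| |]; [exists l0; reflexivity| |]; exfalso; simpl in Hl.
  - destruct (Hl B O) as (n & _ & Hn); specialize (HB n); apply Rabs_le_between in HB; lra.
  - destruct (Hl (- B)) as (N & HN); specialize (HN N (le_n _)); specialize (HB N).
    apply Rabs_le_between in HB; lra. }
destruct Hfin as [l0 ->]; simpl in Hl.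
assert (Hex : forall N : nat, exists n, (N <= n)%nat /\ Rabs (u n - l0) < / (INR N + 1)).
{ intros N; assert (He : 0 < / (INR N + 1)) by (apply Rinv_0_lt_compat; generalize (pos_INR N); lra).
  destruct (Hl (mkposreal _ He)) as [H1 [M HM]]; simpl in *.
  destruct (H1 (max N M)) as (n & Hn & Hn'); exists n; split; [lia|].
  specialize (HM n ltac:(lia)); apply Rabs_def1; lra. }
destruct (functional_choice _ Hex) as [f Hf].
set (phi := fix phi n := match n with O => f O | S n' => f (S (phi n')) end).
assert (Hinc : forall n, (phi n < phi (S n))%nat).
{ intros n; destruct (Hf (S (phi n))) as [H _]; simpl; lia. }
assert (Hid : forall n, (n <= phi n)%nat).
{ induction n as [|n IH]; [lia|]; specialize (Hinc n); lia. }
exists phi; split; [exact Hid|split; [exact Hinc|]]; exists l0.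
apply is_lim_seq_spec; intros eps.
destruct (archimed_cor1 eps (cond_pos eps)) as (N & HN & HN0).
exists N; intros n Hn.
assert (Hphi : Rabs (u (phi n) - l0) < / (INR n + 1)).
{ destruct n as [|n]; [apply Hf|].
  destruct (Hf (S (phi n))) as [_ H]; simpl phi.
  apply Rlt_le_trans with (1 := H), Rinv_le_contravar.
  - generalize (pos_INR (S n)); lra.
  - apply Rplus_le_compat_r, le_INR; specialize (Hid n); lia. }
apply Rlt_trans with (1 := Hphi), Rle_lt_trans with (2 := HN).
apply Rinv_le_contravar; [apply lt_0_INR; lia|].
apply Rle_trans with (INR n); [apply le_INR; lia|lra].
Qed.

(** The rows [psi i] are nested subsequences, and from index [S i] on the diagonal selects from row
    [S i]. Of the extraction only [n <= phi n] is recorded, which is what limits along it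
    require. *)
Lemma diagonal_extraction (u : nat -> nat -> R) (B : nat -> R) :
  (forall n i, Rabs (u n i) <= B i) ->
  exists phi : nat -> nat, (forall n, (n <= phi n)%nat) /\
    forall i, exists l : R, is_lim_seq (fun n => u (phi n) i) l.
Proof.
intros HB.
assert (Hex : forall p : (nat -> nat) * nat, exists phi : nat -> nat,
   (forall n, (n <= phi n)%nat) /\ (forall n, (phi n < phi (S n))%nat) /\
   exists l : R, is_lim_seq (fun n => u (fst p (phi n)) (snd p)) l).
{ intros [psi i]; apply (bolzano_weierstrass (fun n => u (psi n) i) (B i)); intros; apply HB. }
destruct (functional_choice _ Hex) as [F HF].
set (psi := fix psi i := match i with
                         | O => fun n : nat => n
                         | S i' => fun n => psi i' (F (psi i', i') n)
                         end).
assert (Hge : forall i n, (n <= psi i n)%nat).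
{ induction i as [|i IH]; intros n; simpl; [lia|].
  destruct (HF (psi i, i)) as [H _]; specialize (H n); specialize (IH (F (psi i, i) n)); lia. }
assert (Hsub : forall i d n, exists m, (n <= m)%nat /\ psi (i + d)%nat n = psi i m).
{ intros i; induction d as [|d IH]; intros n.
  - exists n; rewrite Nat.add_0_r; auto.
  - rewrite Nat.add_succ_r; simpl.
    destruct (HF (psi (i + d)%nat, (i + d)%nat)) as [H _].
    destruct (IH (F (psi (i + d)%nat, (i + d)%nat) n)) as (m & Hm & E).
    specialize (H n); exists m; split; [lia|exact E]. }
exists (fun n => psi n n); split; [intros; apply Hge|].
intros i; destruct (HF (psi i, i)) as (_ & _ & l & Hl); exists l.
apply is_lim_seq_spec; intros eps.
apply is_lim_seq_spec in Hl; destruct (Hl eps) as [N HN]; simpl in HN.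
exists (max N (S i)); intros n Hn.
destruct (Hsub (S i) (n - S i)%nat n) as (m & Hm & E).
replace (S i + (n - S i))%nat with n in E by lia.
rewrite E; simpl; apply HN; lia.
Qed.

Lemma is_lim_seq_extract (u : nat -> R) (l : Rbar) (phi : nat -> nat) :
  (forall n, (n <= phi n)%nat) -> is_lim_seq u l -> is_lim_seq (fun n => u (phi n)) l.
Proof.
intros Hphi; apply (is_lim_seq_subseq u l phi).
intros P [N HN]; exists N; intros n Hn; apply HN; specialize (Hphi n); lia.
Qed.

Lemma is_lim_seq_inv_succ : is_lim_seq (fun j => / (INR j + 1)) 0.
Proof.
apply (is_lim_seq_ext (fun j => / INR (S j))); [intros j; rewrite S_INR; reflexivity|].
apply (is_lim_seq_incr_1 (fun j => / INR j)).
replace (Finite 0) with (Rbar_inv p_infty) by reflexivity.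
apply is_lim_seq_inv; [apply is_lim_seq_INR|discriminate].
Qed.

Lemma finite_max (f : nat -> R) n : exists M, 0 <= M /\ forall i, (i <= n)%nat -> f i <= M.
Proof.
induction n as [|n (M & H0 & HM)].
- exists (Rmax 0 (f O)); split; [apply Rmax_l|].
  intros i Hi; replace i with O by lia; apply Rmax_r.
- exists (Rmax M (f (S n))); split; [apply Rle_trans with (1 := H0), Rmax_l|].
  intros i Hi; destruct (Nat.eq_dec i (S n)) as [->|]; [apply Rmax_r|].
  apply Rle_trans with (2 := Rmax_l _ _), HM; lia.
Qed.

Lemma finite_min (f : nat -> R) n :
  (forall i, (i <= n)%nat -> 0 < f i) -> exists m, 0 < m /\ forall i, (i <= n)%nat -> m <= f i.
Proof.
induction n as [|n IH]; intros Hf.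
- exists (f O); split; [apply Hf; lia|]; intros i Hi; replace i with O by lia; lra.
- destruct IH as (m & H0 & Hm); [auto|].
  exists (Rmin m (f (S n))); split; [apply Rmin_glb_lt; auto|].
  intros i Hi; destruct (Nat.eq_dec i (S n)) as [->|]; [apply Rmin_r|].
  apply Rle_trans with (1 := Rmin_l _ _), Hm; lia.
Qed.

Lemma sg_sq k : sg k * sg k = 1.
Proof. destruct (sg_cases k) as [-> | ->]; ring. Qed.

Lemma sg_abs k x : sg k * x <= Rabs x.
Proof. apply unit_sign_abs, sg_cases. Qed.

Lemma Rabs_sg k : Rabs (sg k) = 1.
Proof. destruct (sg_cases k) as [-> | ->]; [apply Rabs_R1|rewrite Rabs_left; lra]. Qed.

Lemma sg_even k j : Nat.even k = Nat.even j -> sg k = sg j.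
Proof.
assert (H : forall i, sg i = if Nat.even i then 1 else -1).
{ induction i as [|i IH]; [reflexivity|].
  rewrite sg_S, IH, Nat.even_succ, <- Nat.negb_even; destruct (Nat.even i); simpl; ring. }
intros E; rewrite (H k), (H j), E; reflexivity.
Qed.

(** * Contact points and their descents *)

Definition points (n : nat) (x : nat -> R) : Prop :=
  0 <= x O /\ forall i, (i < n)%nat -> x i < x (S i).

Lemma points_le n x i j : points n x -> (i <= j)%nat -> (j <= n)%nat -> x i <= x j.
Proof.
intros [_ H]; induction 1 as [|j Hij IH]; intros Hj; [lra|].
specialize (H j ltac:(lia)); specialize (IH ltac:(lia)); lra.
Qed.

Lemma points_lt n x i j : points n x -> (i < j)%nat -> (j <= n)%nat -> x i < x j.
Proof.
intros H Hij Hj; apply Rlt_le_trans with (x (S i)); [apply H; lia|].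
apply (points_le n); auto.
Qed.

Lemma points_nonneg n x i : points n x -> (i <= n)%nat -> 0 <= x i.
Proof.
intros H Hi; apply Rle_trans with (x O); [apply H|apply (points_le n); auto; lia].
Qed.

Lemma descents_from_points n x X G :
  points n x -> (forall k, (k < n)%nat -> 0 < sg k * (G (x k) - G (x (S k)))) ->
  x n < X -> 0 < sg n * (G (x n) - G X) -> descents (S n) 1 (x O) G.
Proof.
intros Hx HG HX Hlast.
enough (H : forall d, (d <= n)%nat -> descents (S d) (sg (n - d)) (x (n - d)%nat) G).
{ specialize (H n (le_n _)); rewrite Nat.sub_diag in H; exact H. }
induction d as [|d IH]; intros Hd.
- rewrite Nat.sub_0_r; exists (x n), X; simpl; repeat split; auto; lra.
- specialize (IH ltac:(lia)).
  replace (n - d)%nat with (S (n - S d)) in IH by lia; rewrite sg_S in IH.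
  exists (x (n - S d)%nat), (x (S (n - S d))); repeat split; [lra| | |exact IH].
  + apply Hx; lia.
  + apply HG; lia.
Qed.

Lemma descents_of_points n x X G :
  points n x -> (forall k, (k < n)%nat -> 0 < sg k * (G (x k) - G (x (S k)))) ->
  x n < X -> 0 < sg n * (G (x n) - G X) -> descents (S n) 1 0 G.
Proof.
intros Hx HG HX Hlast; apply (descents_weaken _ _ (x O)); [apply Hx|].
apply (descents_from_points n x X); auto.
Qed.

Lemma descents_of_points_lim n x (c : R) G :
  points n x -> (forall k, (k < n)%nat -> 0 < sg k * (G (x k) - G (x (S k)))) ->
  is_lim G p_infty c -> 0 < sg n * (G (x n) - c) -> descents (S n) 1 0 G.
Proof.
intros Hx HG HL Hlast.
destruct (proj1 (is_lim_p_infty_eps _ _) HL _ Hlast) as [X HX].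
set (Y := Rmax X (x n + 1)); assert (HY := Rmax_r X (x n + 1)); fold Y in HY.
specialize (HX Y (Rmax_l _ _)).
apply (descents_of_points n x Y); auto; [lra|].
assert (A := sg_abs n (G Y - c)); lra.
Qed.

Lemma zeros_of_points n y a phi :
  (forall i, (i < n)%nat -> a < y i) ->
  (forall i, (S i < n)%nat -> y i < y (S i)) ->
  (forall i, (i < n)%nat -> phi (y i) = 0) -> zeros n a phi.
Proof.
revert y a; induction n as [|n IH]; intros y a Ha Hy H0; [exact I|].
exists (y O); repeat split; [apply Ha; lia|apply H0; lia|].
apply (IH (fun i => y (S i))).
- intros i; induction i as [|i IHi]; intros Hi; [apply Hy; lia|].
  specialize (IHi ltac:(lia)); specialize (Hy (S i) ltac:(lia)); lra.
- intros i Hi; apply Hy; lia.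
- intros i Hi; apply H0; lia.
Qed.

(** * Moving the knots of a smoothed spline *)

Section Raise.
Variables (r : nat) (Q : nat -> R -> R).
Hypothesis HQ : tail_chain r Q.
Hypothesis Hr : (1 <= r)%nat.
Variable nu : R.
Hypothesis Hnu : 0 < nu.

Definition hkernel (th : nat -> R) (n : nat) (s : R) : R := hprod nu th n s * Q O s.

Definition smooth (th : nat -> R) (n : nat) (c t : R) : R := c + itail r (hkernel th n) t.

Lemma Q0_pos t : 0 < Q O t.
Proof. apply HQ. Qed.

Lemma dominated_product M h :
  (forall t, continuous h t) -> (forall t, Rabs (h t) <= M) ->
  dominated Q M 0 (fun s => h s * Q O s).
Proof.
intros Hc Hb; split; intros t.
- apply (continuous_Rmult h); [apply Hc|apply HQ].
- rewrite Rabs_mult, (Rabs_right (Q O t)) by (left; apply Q0_pos).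
  apply Rmult_le_compat_r; [left; apply Q0_pos|apply Hb].
Qed.

Lemma hkernel_dominated th n :
  (forall i, (i < n)%nat -> 0 <= th i) -> dominated Q 1 0 (hkernel th n).
Proof.
intros Ht; apply dominated_product; intros t; [apply hprod_continuous|apply hprod_abs]; auto.
Qed.

Lemma smooth_continuous th n c t :
  (forall i, (i < n)%nat -> 0 <= th i) -> continuous (smooth th n c) t.
Proof.
intros Ht; apply (continuous_Rplus (fun _ => c)); [apply continuous_const|].
apply (dominated_itail r Q HQ 1 0 r); [lia|apply hkernel_dominated, Ht].
Qed.

Lemma smooth_lim th n c :
  (forall i, (i < n)%nat -> 0 <= th i) -> is_lim (smooth th n c) p_infty c.
Proof.
intros Ht; unfold smooth; replace (Finite c) with (Finite (c + 0)) by (f_equal; ring).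
apply is_lim_plus'; [apply is_lim_const|].
apply (dominated_lim r Q HQ 1 (r - 1)); [lia|].
replace (S (r - 1)) with r by lia.
apply (dominated_itail r Q HQ 1 0); [lia|apply hkernel_dominated, Ht].
Qed.

(** The [r] tails are undone one after the other, and the positive factor [Q O] does not affect
    signs. *)
Lemma smooth_descents th n c k s a :
  (forall i, (i < n)%nat -> 0 <= th i) ->
  descents k s a (smooth th n c) -> alternates k s a (hprod nu th n).
Proof.
intros Ht HD; unfold smooth in HD.
assert (HK := hkernel_dominated th n Ht).
assert (E : r = S (r - 1)) by lia.
rewrite E, itail_S in HD.
destruct (dominated_tail r Q HQ 1 0 _ ltac:(lia) HK) as [HT HK1].
apply (alternates_nonneg_factor _ _ _ (Q O)).
- intros t _; left; apply Q0_pos.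
- apply (descents_alternates _ (tail (hkernel th n))); [exact HT|].
  apply (descents_itail r Q HQ 1 0 (r - 1) _ _ _ _ c); [lia|exact HK1|exact HD].
Qed.

Lemma smooth_descents_bound th n c a k :
  (forall i, (i < n)%nat -> 0 <= th i) ->
  (descents k 1 a (smooth th n c) -> (k <= n + 1)%nat) /\
  (descents k (-1) a (smooth th n c) -> (k <= n)%nat).
Proof.
intros Ht; assert (A := count_active_le th n); split; intros HD;
  apply smooth_descents in HD; auto; apply hprod_alternates_bound in HD; auto; lia.
Qed.

Lemma itail_fsum (f : nat -> R -> R) al n :
  (forall i, (i < n)%nat -> exists M, dominated Q M 0 (f i)) ->
  (exists M, dominated Q M 0 (fun s => fsum (fun i => al i * f i s) n)) /\
  forall t, itail r (fun s => fsum (fun i => al i * f i s) n) t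
            = fsum (fun i => al i * itail r (f i) t) n.
Proof.
induction n as [|n IH]; intros Hf; simpl.
- assert (H0 : dominated Q 0 0 (fun _ => 0)).
  { split; intros; [apply continuous_const|rewrite Rabs_R0; lra]. }
  split; [exists 0; exact H0|]; intros t.
  destruct (dominated_itail r Q HQ 0 0 r _ ltac:(lia) H0) as [_ H].
  specialize (H t); rewrite Rmult_0_l in H.
  apply Rabs_eq_0, Rle_antisym; [exact H|apply Rabs_pos].
- destruct IH as ((M & HM) & E); [auto|].
  destruct (Hf n ltac:(lia)) as (M' & HM').
  assert (Ef : (fun s => fsum (fun i => al i * f i s) n + al n * f n s)
             = (fun s => 1 * fsum (fun i => al i * f i s) n + al n * f n s))
    by (apply functional_extensionality; intros; ring).
  rewrite Ef; split.
  + eexists; apply (dominated_lincomb Q M M'); eassumption.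
  + intros t; rewrite (itail_lincomb r Q HQ M M' 0 r) by (auto; lia).
    rewrite E; ring.
Qed.

Lemma zeros_itail M i z k a :
  (i <= r)%nat -> dominated Q M 0 z -> zeros k a (itail i z) -> zeros k a z.
Proof.
induction i as [|i IH]; intros Hi Hz HZ; [exact HZ|].
apply IH; [lia|exact Hz|].
apply (zeros_tail _ (itail (S i) z)); [apply (itail_tail r Q HQ M 0); auto; lia|exact HZ].
Qed.

Definition skip (j k : nat) : nat := if Nat.ltb k j then k else S k.

(** A system of [n] equations, one for each contact except [x j], in [n] unknowns. A homogeneous
    solution would make an [r]-fold tail vanish at [n] points, hence by Rolle's theorem also [hvar],
    and is trivial by [hvar_zeros]. *)
Lemma interpolation th n x j :
  (forall i, (i < n)%nat -> 0 < th i) ->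
  (forall i i', (i < i')%nat -> (i' < n)%nat -> th i <> th i') ->
  points n x -> (j <= n)%nat ->
  exists al, forall k, (k <= n)%nat -> k <> j ->
    itail r (fun s => hvar nu th al n s * Q O s) (x k) = sg k.
Proof.
intros Ht Hd Hx Hj.
set (f := fun i s => hcoef nu th n i s * Q O s).
assert (Hf : forall i, (i < n)%nat -> exists M, dominated Q M 0 (f i)).
{ intros i Hi; destruct (hcoef_regular nu th n i Ht) as [Hc [B HB]].
  exists B; apply dominated_product; auto. }
assert (Evar : forall al, (fun s => hvar nu th al n s * Q O s)
                          = (fun s => fsum (fun i => al i * f i s) n)).
{ intros al; apply functional_extensionality; intros s; unfold hvar, f.
  enough (forall m, fsum (fun i => al i * hcoef nu th n i s) m * Q O s
            = fsum (fun i => al i * (hcoef nu th n i s * Q O s)) m) by auto.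
  induction m as [|m IH]; simpl; [ring|rewrite <- IH; ring]. }
assert (Hskip : forall k, (k <= n)%nat -> k <> j -> exists k', (k' < n)%nat /\ skip j k' = k).
{ intros k Hk Hkj; destruct (Nat.lt_total k j) as [H|[H|H]]; [|lia|].
  - exists k; unfold skip; destruct (Nat.ltb_spec k j); lia.
  - exists (pred k); unfold skip; destruct (Nat.ltb_spec (pred k) j); lia. }
(* An additional unknown [b n], multiplying the right-hand side, makes the system homogeneous; it
   remains to see that [b n] is nonzero. *)
destruct (exists_kernel_vector n (fun k i =>
   if Nat.ltb i n then itail r (f i) (x (skip j k)) else - sg (skip j k)))
  as (b & (i0 & Hi0 & Hb0) & Hb).
assert (Hrow : forall k, (k < n)%nat ->
   fsum (fun i => b i * itail r (f i) (x (skip j k))) n = b n * sg (skip j k)).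
{ intros k Hk; specialize (Hb k Hk).
  change (fsum ?f (S n)) with (fsum f n + f n) in Hb; cbv beta in Hb.
  rewrite Nat.ltb_irrefl in Hb.
  rewrite (fsum_ext _ (fun i => b i * itail r (f i) (x (skip j k)))) in Hb; [lra|].
  intros i Hi; destruct (Nat.ltb_spec i n); [reflexivity|lia]. }
assert (Hbn : b n <> 0).
{ intros E; apply Hb0.
  destruct (Nat.eq_dec i0 n) as [->|Hne]; [exact E|].
  (* The left end is [- 1] because [zeros] asks for points strictly beyond it and the first contact
     may be 0. *)
  apply (hvar_zeros nu Hnu th b n (- 1)); auto; [|lia].
  destruct (itail_fsum f b n Hf) as ((M & HM) & Ef).
  apply (zeros_impl _ _ (fun s => fsum (fun i => b i * f i s) n)).
  - intros t _ E0; rewrite <- Evar in HM.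
    assert (E1 : hvar nu th b n t * Q O t = 0) by (rewrite <- E0; apply (f_equal (fun h => h t) (Evar b))).
    apply Rmult_integral in E1; assert (A := Q0_pos t); lra.
  - apply (zeros_itail M r); [lia|exact HM|].
    apply (zeros_of_points n (fun k => x (skip j k))).
    + intros i Hi; assert (A := points_nonneg n x (skip j i) Hx).
      assert (skip j i <= n)%nat by (unfold skip; destruct (Nat.ltb_spec i j); lia).
      specialize (A H); lra.
    + intros i Hi; apply (points_lt n); auto; unfold skip;
        destruct (Nat.ltb_spec i j), (Nat.ltb_spec (S i) j); lia.
    + intros i Hi; rewrite Ef, Hrow, E by exact Hi; ring. }
exists (fun i => b i / b n); intros k Hk Hkj.
destruct (Hskip k Hk Hkj) as (k' & Hk' & <-).
rewrite Evar; destruct (itail_fsum f (fun i => b i / b n) n Hf) as (_ & Ef); rewrite Ef.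
rewrite (fsum_ext _ (fun i => / b n * (b i * itail r (f i) (x (skip j k'))) + 0 * 0))
  by (intros; field; exact Hbn).
rewrite (fsum_lincomb _ (fun _ => 0)), Hrow by exact Hk'; field; exact Hbn.
Qed.

(** The [n + 1] descents force interior, distinct knots, so that [interpolation] gives a direction
    in which all heights [sg k * G (x k)] but the [j]-th grow at unit rate. A short step along it
    suffices. *)
Lemma raise th n c x j eps :
  (forall i, (i < n)%nat -> 0 <= th i) -> points n x ->
  (forall k, (k < n)%nat -> 0 < sg k * (smooth th n c (x k) - smooth th n c (x (S k)))) ->
  0 < sg n * (smooth th n c (x n) - c) -> (j <= n)%nat -> 0 < eps ->
  exists th', (forall i, (i < n)%nat -> 0 < th' i <= 1) /\
    (forall k, (k <= n)%nat -> k <> j ->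
       sg k * smooth th n c (x k) < sg k * smooth th' n c (x k)) /\
    Rabs (smooth th' n c (x j) - smooth th n c (x j)) < eps.
Proof.
intros Ht Hx Hosc Hlast Hj He.
assert (HA : alternates (S n) 1 0 (hprod nu th n)).
{ apply (smooth_descents th n c); auto.
  apply (descents_of_points_lim n x c); auto; apply smooth_lim, Ht. }
destruct (hprod_alternates_knots nu Hnu th n Ht HA) as [Hint Hdist].
assert (Hpos : forall i, (i < n)%nat -> 0 < th i) by (intros; apply Hint; auto).
destruct (interpolation th n x j Hpos Hdist Hx Hj) as [al Hal].
destruct (hprod_expansion nu th al n Hpos) as (C & d0 & HC & Hd0 & Hexp).
set (V := itail r (fun s => hvar nu th al n s * Q O s)) in *.
destruct (finite_max (fun i => Rabs (al i)) n) as (A & HA0 & HAl).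
destruct (finite_min (fun i => if Nat.ltb i n then 1 - th i else 1) n) as (gam & Hgam & Hgth).
{ intros i _; destruct (Nat.ltb_spec i n); [|lra].
  assert (E := Hint i H); lra. }
set (q := Q r 0).
assert (Hq : 0 < q) by (apply (chain_pos r Q HQ); lia).
set (K := C * q + 1); assert (HK : 0 < K) by (unfold K; nra).
(* The four bounds, in order: validity of the expansion, remainder at most half of the gain, knots
   at most 1, displacement at [x j] below [eps]. *)
set (d := Rmin (Rmin d0 (/ (2 * K))) (Rmin (gam / (A + 1)) (eps / (2 * (Rabs (V (x j)) + K))))).
assert (HV := Rabs_pos (V (x j))).
assert (P1 : 0 < / (2 * K)) by (apply Rinv_0_lt_compat; lra).
assert (P2 : 0 < gam / (A + 1)) by (apply Rdiv_lt_0_compat; lra).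
assert (P3 : 0 < eps / (2 * (Rabs (V (x j)) + K))) by (apply Rdiv_lt_0_compat; lra).
assert (Hd : 0 < d) by (unfold d; repeat apply Rmin_glb_lt; lra).
assert (D1 : d <= d0) by (unfold d; apply Rle_trans with (1 := Rmin_l _ _), Rmin_l).
assert (D2 : d <= / (2 * K)) by (unfold d; apply Rle_trans with (1 := Rmin_l _ _), Rmin_r).
assert (D3 : d <= gam / (A + 1)) by (unfold d; apply Rle_trans with (1 := Rmin_r _ _), Rmin_l).
assert (D4 : d <= eps / (2 * (Rabs (V (x j)) + K)))
  by (unfold d; apply Rle_trans with (1 := Rmin_r _ _), Rmin_r).
clearbody d.
assert (Hdabs : Rabs d <= d0) by (rewrite Rabs_right; lra).
set (th' := fun i => th i + d * al i).
assert (Hth' : forall i, (i < n)%nat -> 0 < th' i) by (apply (Hexp d 0 Hdabs)).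
assert (Hdiff : forall t, 0 <= t ->
  Rabs (smooth th' n c t - smooth th n c t - d * V t) <= C * d ^ 2 * q).
{ intros t Ht0.
  set (z1 := hkernel th' n); set (z0 := hkernel th n).
  set (zv := fun s => hvar nu th al n s * Q O s).
  assert (H1 : dominated Q 1 0 z1) by (apply hkernel_dominated; intros; apply Rlt_le; auto).
  assert (H0 : dominated Q 1 0 z0) by (apply hkernel_dominated; auto).
  destruct (hvar_bounded nu th al n Hpos) as [B HB].
  assert (Hv : dominated Q B 0 zv).
  { apply dominated_product; [|exact HB].
    intros s; unfold hvar.
    enough (forall m, continuous (fun s => fsum (fun i => al i * hcoef nu th n i s) m) s) by auto.
    induction m as [|m IH]; simpl; [apply continuous_const|].
    apply (continuous_Rplus (fun s => fsum (fun i => al i * hcoef nu th n i s) m)); [exact IH|].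
    apply (continuous_Rmult (fun _ => al m)); [apply continuous_const|].
    apply (hcoef_regular nu th n m Hpos). }
  assert (L1 := itail_lincomb r Q HQ _ _ 0 r 1 (- d) _ _ ltac:(lia)
                  (dominated_lincomb Q _ _ 0 1 (- 1) _ _ H1 H0) Hv t).
  rewrite (itail_lincomb r Q HQ _ _ 0 r 1 (- 1) _ _ ltac:(lia) H1 H0 t) in L1.
  replace (smooth th' n c t - smooth th n c t - d * V t)
    with (1 * (1 * itail r z1 t + - 1 * itail r z0 t) + - d * itail r zv t)
    by (unfold smooth, V; fold z1 z0 zv; ring).
  rewrite <- L1.
  assert (HE : dominated Q (C * d ^ 2) 0
                 (fun s => 1 * (1 * z1 s + - 1 * z0 s) + - d * zv s)).
  { split.
    - apply (dominated_lincomb Q _ _ 0 1 (- d) _ _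
               (dominated_lincomb Q _ _ 0 1 (- 1) _ _ H1 H0) Hv).
    - intros s; unfold z1, z0, zv, hkernel.
      replace (1 * (1 * (hprod nu th' n s * Q O s) + - 1 * (hprod nu th n s * Q O s))
               + - d * (hvar nu th al n s * Q O s))
        with ((hprod nu th' n s - hprod nu th n s - d * hvar nu th al n s) * Q O s) by ring.
      rewrite Rabs_mult, (Rabs_right (Q O s)) by (left; apply Q0_pos).
      apply Rmult_le_compat_r; [left; apply Q0_pos|apply (Hexp d s Hdabs)]. }
  destruct (dominated_itail r Q HQ _ 0 r _ ltac:(lia) HE) as [_ Hb].
  apply Rle_trans with (1 := Hb t), Rmult_le_compat_l.
  - apply Rmult_le_pos; [exact HC|apply pow2_ge_0].
  - destruct Ht0 as [Ht0|<-]; [|right; reflexivity].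
    unfold q; left; assert (E : r = S (r - 1)) by lia; rewrite E; simpl.
    apply (chain_decreasing r Q HQ); [lia|exact Ht0]. }
assert (Hsmall : C * d ^ 2 * q <= d * (d * K)).
{ replace (C * d ^ 2 * q) with (d * d * (C * q)) by ring.
  replace (d * (d * K)) with (d * d * K) by ring.
  apply Rmult_le_compat_l; [nra|unfold K; lra]. }
assert (HdK : d * K <= / 2).
{ replace (/ 2) with (/ (2 * K) * K) by (field; lra).
  apply Rmult_le_compat_r; lra. }
exists th'; split; [|split].
- intros i Hi; split; [auto|].
  assert (Hg := Hgth i ltac:(lia)); destruct (Nat.ltb_spec i n); [|lia].
  assert (Hai := HAl i ltac:(lia)); simpl in Hai.
  assert (d * al i <= gam); [|unfold th'; lra].
  apply Rle_trans with (d * (A + 1)).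
  + apply Rmult_le_compat_l; [lra|]; assert (F := Rle_abs (al i)); lra.
  + replace gam with (gam / (A + 1) * (A + 1)) by (field; lra).
    apply Rmult_le_compat_r; lra.
- intros k Hk Hkj.
  assert (F := Hdiff (x k) (points_nonneg n x k Hx Hk)); rewrite (Hal k Hk Hkj) in F.
  assert (S1 := sg_abs k (- (smooth th' n c (x k) - smooth th n c (x k) - d * sg k))).
  rewrite Rabs_Ropp in S1.
  assert (S2 := sg_sq k).
  assert (S3 : sg k * (d * sg k) = d) by (replace (sg k * (d * sg k)) with (sg k * sg k * d) by ring; rewrite S2; ring).
  assert (d * (d * K) <= d * / 2) by (apply Rmult_le_compat_l; lra).
  lra.
- assert (F := Hdiff (x j) (points_nonneg n x j Hx Hj)).
  replace (smooth th' n c (x j) - smooth th n c (x j))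
    with ((smooth th' n c (x j) - smooth th n c (x j) - d * V (x j)) + d * V (x j)) by ring.
  apply Rle_lt_trans with (1 := Rabs_triang _ _).
  rewrite (Rabs_mult d), (Rabs_right d) by lra.
  assert (d * (d * K) <= d * K).
  { apply Rmult_le_compat_l; [lra|].
    rewrite <- (Rmult_1_l K) at 2; apply Rmult_le_compat_r; lra. }
  assert (d * (Rabs (V (x j)) + K) <= eps / 2); [|lra].
  replace (eps / 2) with (eps / (2 * (Rabs (V (x j)) + K)) * (Rabs (V (x j)) + K))
    by (field; lra).
  apply Rmult_le_compat_r; lra.
Qed.

Lemma switch_lipschitz th th' s :
  0 <= th -> 0 <= th' ->
  Rabs (switch nu th' s - switch nu th s) <= 2 / vexp nu s * Rabs (th' - th).
Proof.
intros H H'; assert (A := vexp_pos nu s); unfold switch; set (v := vexp nu s) in *.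
replace ((v - th') / (v + th') - (v - th) / (v + th))
  with (2 * v / ((v + th') * (v + th)) * - (th' - th)) by (field; lra).
rewrite Rabs_mult, Rabs_Ropp; apply Rmult_le_compat_r; [apply Rabs_pos|].
assert (B : 0 < (v + th') * (v + th)) by (apply Rmult_lt_0_compat; lra).
rewrite Rabs_right by (apply Rle_ge, Rdiv_le_0_compat; lra).
apply Rmult_le_reg_r with ((v + th') * (v + th)); [exact B|].
unfold Rdiv; rewrite Rmult_assoc, Rinv_l, Rmult_1_r by lra.
apply Rmult_le_reg_l with v; [exact A|].
replace (v * (2 * / v * ((v + th') * (v + th)))) with (2 * ((v + th') * (v + th)))
  by (field; lra).
nra.
Qed.

Lemma hprod_lipschitz th th' n d X s :
  (forall i, (i < n)%nat -> 0 <= th i) -> (forall i, (i < n)%nat -> 0 <= th' i) ->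
  (forall i, (i < n)%nat -> Rabs (th' i - th i) <= d) -> s <= X ->
  Rabs (hprod nu th' n s - hprod nu th n s) <= INR n * (2 / vexp nu X * d).
Proof.
intros H H' Hd Hs; induction n as [|n IH].
- simpl; rewrite Rminus_diag, Rabs_R0; lra.
- specialize (IH ltac:(auto) ltac:(auto) ltac:(auto)).
  rewrite S_INR; cbn [hprod].
  set (P := hprod nu th' n s) in *; set (P0 := hprod nu th n s) in *.
  set (F := switch nu (th' n) s); set (F0 := switch nu (th n) s).
  replace (P * F - P0 * F0) with ((P - P0) * F + P0 * (F - F0)) by ring.
  apply Rle_trans with (1 := Rabs_triang _ _); rewrite !Rabs_mult.
  assert (A1 : Rabs F <= 1) by (apply switch_abs; auto).
  assert (A2 : Rabs P0 <= 1) by (apply hprod_abs; auto).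
  assert (A3 : Rabs (F - F0) <= 2 / vexp nu X * d).
  { apply Rle_trans with (1 := switch_lipschitz (th n) (th' n) s ltac:(auto) ltac:(auto)).
    assert (Vs := vexp_pos nu s); assert (VX := vexp_pos nu X).
    apply Rmult_le_compat; auto using Rabs_pos.
    - apply Rdiv_le_0_compat; lra.
    - apply Rmult_le_compat_l; [lra|]; apply Rinv_le_contravar; [lra|].
      apply (vexp_le nu Hnu); auto. }
  assert (B1 : Rabs (P - P0) * Rabs F <= INR n * (2 / vexp nu X * d) * 1)
    by (apply Rmult_le_compat; auto using Rabs_pos).
  assert (B2 : Rabs P0 * Rabs (F - F0) <= 1 * (2 / vexp nu X * d))
    by (apply Rmult_le_compat; auto using Rabs_pos).
  lra.
Qed.

(** The Lipschitz bound [2 / v] for [switch] in [th] grows without limit in [s], so the kernels are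
    compared on a compact interval only; [itail_small_local] turns this into uniform closeness of
    the splines. In particular knots may be brought in from infinity. *)
Lemma smooth_knot_continuity th n c eps :
  (forall i, (i < n)%nat -> 0 <= th i) -> 0 < eps ->
  exists d, 0 < d /\ forall th', (forall i, (i < n)%nat -> 0 <= th' i) ->
    (forall i, (i < n)%nat -> Rabs (th' i - th i) <= d) ->
    forall t, 0 <= t -> Rabs (smooth th' n c t - smooth th n c t) <= eps.
Proof.
intros Ht He.
destruct (itail_small_local r Q HQ 0 (r - 1) 2 eps ltac:(lia) ltac:(lra) He)
  as (X & e & HX & Hepos & Hloc).
replace (S (r - 1)) with r in Hloc by lia.
assert (VX := vexp_pos nu X); assert (Q0 := Q0_pos 0).
set (K := INR n * (2 / vexp nu X) * Q O 0).
assert (HK : 0 <= K).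
{ apply Rmult_le_pos; [apply Rmult_le_pos; [apply pos_INR|apply Rdiv_le_0_compat; lra]|lra]. }
exists (e / (K + 1)); split; [apply Rdiv_lt_0_compat; lra|].
intros th' Ht' Hd t Ht0.
assert (H1 := hkernel_dominated th' n Ht'); assert (H0 := hkernel_dominated th n Ht).
replace (smooth th' n c t - smooth th n c t)
  with (1 * itail r (hkernel th' n) t + - 1 * itail r (hkernel th n) t)
  by (unfold smooth; ring).
rewrite <- (itail_lincomb r Q HQ 1 1 0 r 1 (- 1) _ _ ltac:(lia) H1 H0).
apply Hloc; [|intros s Hs|exact Ht0].
- assert (H := dominated_lincomb Q _ _ 0 1 (- 1) _ _ H1 H0).
  rewrite Rabs_R1, (Rabs_left (-1)) in H by lra.
  replace (1 * 1 + - (-1) * 1) with 2 in H by ring; exact H.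
- unfold hkernel.
  replace (1 * (hprod nu th' n s * Q O s) + - 1 * (hprod nu th n s * Q O s))
    with ((hprod nu th' n s - hprod nu th n s) * Q O s) by ring.
  assert (Hs0 : 0 < Q O s <= Q O 0) by (split; [apply Q0_pos|apply HQ; lra]).
  rewrite Rabs_mult, (Rabs_right (Q O s)) by lra.
  apply Rle_trans with (INR n * (2 / vexp nu X * (e / (K + 1))) * Q O 0).
  + apply Rmult_le_compat; auto using Rabs_pos; try lra.
    apply hprod_lipschitz; auto; lra.
  + apply Rle_trans with (K * (e / (K + 1))); [right; unfold K at 2; ring|].
    apply Rle_trans with ((K + 1) * (e / (K + 1))); [|right; field; lra].
    apply Rmult_le_compat_r; [apply Rlt_le, Rdiv_lt_0_compat|]; lra.
Qed.

End Raise.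

(** * Snakes of the smoothed splines *)

Lemma points_locate n x t :
  points n x -> t < x O \/ (exists i, (i < n)%nat /\ x i <= t < x (S i)) \/ x n <= t.
Proof.
intros _; induction n as [|n [H|[(i & Hi & H)|H]]].
- destruct (Rlt_le_dec t (x O)); auto.
- left; exact H.
- right; left; exists i; split; [lia|exact H].
- destruct (Rlt_le_dec t (x (S n))); [right; left; exists n; auto|auto].
Qed.

Lemma points_update n x i t :
  points n x -> (i <= n)%nat -> 0 <= t -> (forall i', S i' = i -> x i' < t) ->
  ((i < n)%nat -> t < x (S i)) -> points n (update x i t).
Proof.
intros [H0 H] Hi Ht Hl Hu; split.
- destruct i; [rewrite update_eq; exact Ht|rewrite update_neq by lia; exact H0].
- intros k Hk; destruct (Nat.eq_dec k i) as [->|Hki].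
  + rewrite update_eq, update_neq by lia; auto.
  + rewrite (update_neq x i t k) by exact Hki.
    destruct (Nat.eq_dec (S k) i) as [E|E].
    * rewrite E, update_eq; auto.
    * rewrite update_neq by exact E; auto.
Qed.

Lemma even_cases k i : Nat.even k = Nat.even i \/ Nat.even k = Nat.even (S i).
Proof.
rewrite Nat.even_succ, <- Nat.negb_even; destruct (Nat.even k), (Nat.even i); simpl; auto.
Qed.

Lemma vexp_small nu eps :
  0 < nu -> 0 < eps -> exists X, forall s, X <= s -> vexp nu s < eps.
Proof.
intros Hnu He; exists (/ (nu * eps)); intros s Hs.
assert (P : 0 < / (nu * eps)) by (apply Rinv_0_lt_compat, Rmult_lt_0_compat; lra).
unfold vexp; rewrite exp_Ropp.
assert (A : 1 + nu * s < exp (nu * s)) by (apply exp_ineq1; apply Rgt_not_eq, Rmult_lt_0_compat; lra).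
assert (B : / eps <= nu * s).
{ replace (/ eps) with (nu * / (nu * eps)) by (field; lra).
  apply Rmult_le_compat_l; lra. }
rewrite <- (Rinv_inv eps); apply Rinv_lt_contravar.
- apply Rmult_lt_0_compat; [apply Rinv_0_lt_compat, He|apply exp_pos].
- lra.
Qed.

Lemma hprod_lim nu th n :
  0 < nu -> (forall i, (i < n)%nat -> 0 < th i) -> is_lim (hprod nu th n) p_infty (sg n).
Proof.
intros Hnu; induction n as [|n IH]; intros Ht; [apply (is_lim_const 1)|].
replace (Finite (sg (S n))) with (Rbar_mult (sg n) (-1))
  by (simpl; f_equal; rewrite sg_S; ring).
apply (is_lim_mult (hprod nu th n) (switch nu (th n))); [auto| |exact I].
apply is_lim_p_infty_eps; intros eps He.
specialize (Ht n ltac:(lia)).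
destruct (vexp_small nu (eps * th n / 2) Hnu) as [X HX].
{ apply Rdiv_lt_0_compat; [apply Rmult_lt_0_compat|]; lra. }
exists X; intros s Hs; specialize (HX s Hs); assert (A := vexp_pos nu s).
unfold switch; replace ((vexp nu s - th n) / (vexp nu s + th n) - -1)
  with (2 * vexp nu s / (vexp nu s + th n)) by (field; lra).
rewrite Rabs_right by (apply Rle_ge, Rdiv_le_0_compat; lra).
apply Rmult_lt_reg_r with (vexp nu s + th n); [lra|].
unfold Rdiv; rewrite Rmult_assoc, Rinv_l, Rmult_1_r by lra; nra.
Qed.

Lemma descents_between_points n x G :
  points n x -> (forall k, (k < n)%nat -> 0 < sg k * (G (x k) - G (x (S k)))) ->
  descents n 1 (x O) G.
Proof.
intros Hx HG.
enough (H : forall d, (d <= n)%nat -> descents d (sg (n - d)) (x (n - d)%nat) G)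
  by (specialize (H n (le_n _)); rewrite Nat.sub_diag in H; exact H).
induction d as [|d IH]; intros Hd; [exact I|].
specialize (IH ltac:(lia)); replace (n - d)%nat with (S (n - S d)) in IH by lia.
rewrite sg_S in IH.
exists (x (n - S d)%nat), (x (S (n - S d))); repeat split; [lra| | |exact IH].
- apply Hx; lia.
- apply HG; lia.
Qed.

(* The last clause is Assumption 3, as q will be |P_r|. *)
Definition tail_weight (q f : R -> R) (l : R) : Prop :=
  (forall t, continuous f t) /\ (forall s t, s <= t -> f t <= f s) /\ 0 < l /\
  is_lim f p_infty l /\ (forall X eps, 0 < eps -> exists t, X <= t /\ f t - l < eps * q t).

Section Snakes.
Variables (r : nat) (Q : nat -> R -> R).
Hypothesis HQ : tail_chain r Q.
Hypothesis Hr : (1 <= r)%nat.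
Variables (w : nat -> R -> R) (l : nat -> R).
Hypothesis Hw : forall k, tail_weight (Q r) (w k) (l k).
Hypothesis Hper : forall k j, Nat.even k = Nat.even j -> w k = w j /\ l k = l j.

(** An inequality, so that contacts may overshoot while points are exchanged and heights raised; in
    conjunction with [below] it becomes equality. *)
Definition reaches (tau : R) (n : nat) (x : nat -> R) (G : R -> R) : Prop :=
  forall k, (k <= n)%nat -> tau * w k (x k) <= sg k * G (x k).

(** Both bounds in one formula: even [k] give one side of the strip and odd [k] the other, as [w]
    has period two. *)
Definition below (tau : R) (G : R -> R) : Prop :=
  forall k t, 0 <= t -> sg k * G t <= tau * w k t.

Lemma limit_pos k : 0 < l k.
Proof. apply Hw. Qed.

Lemma weight_ge k t : l k <= w k t.
Proof.
destruct (Hw k) as (_ & Hm & _ & HL & _).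
apply Rnot_lt_le; intros C.
destruct (proj1 (is_lim_p_infty_eps _ _) HL (l k - w k t) ltac:(lra)) as [X HX].
specialize (HX (Rmax X t) (Rmax_l _ _)); specialize (Hm t (Rmax X t) (Rmax_r _ _)).
apply Rabs_def2 in HX; lra.
Qed.

Lemma weight_pos k t : 0 < w k t.
Proof. apply Rlt_le_trans with (1 := limit_pos k), weight_ge. Qed.

Lemma reaches_oscillates tau n x G k :
  0 < tau -> reaches tau n x G -> (k < n)%nat -> 0 < sg k * (G (x k) - G (x (S k))).
Proof.
intros Ht HR Hk; assert (A := HR k ltac:(lia)); assert (B := HR (S k) ltac:(lia)).
rewrite sg_S in B.
assert (C := Rmult_lt_0_compat _ _ Ht (weight_pos k (x k))).
assert (D := Rmult_lt_0_compat _ _ Ht (weight_pos (S k) (x (S k)))); lra.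
Qed.

Lemma reaches_update tau n x i t G :
  reaches tau n x G -> tau * w i t <= sg i * G t -> reaches tau n (update x i t) G.
Proof.
intros HR H k Hk; destruct (Nat.eq_dec k i) as [->|E].
- rewrite update_eq; exact H.
- rewrite update_neq by exact E; auto.
Qed.

(* If G leaves the strip, one of the contacts can be moved to where the bound is exceeded. *)
Lemma exchange tau n x (c : R) G :
  0 < tau -> points n x -> reaches tau n x G -> is_lim G p_infty c ->
  sg (S n) * c <= tau * l (S n) ->
  (forall k, descents k 1 0 G -> (k <= n + 1)%nat) ->
  (forall k, descents k (-1) 0 G -> (k <= n)%nat) ->
  ~ below tau G ->
  exists x' j, points n x' /\ reaches tau n x' G /\ (j <= n)%nat /\
    tau * w j (x' j) < sg j * G (x' j).
Proof.
intros Ht Hx HR HL Hc Hp Hm HB.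
assert (Hex : exists k t, 0 <= t /\ tau * w k t < sg k * G t).
{ apply NNPP; intros H; apply HB; intros k t Ht0; apply Rnot_lt_le; intros C.
  apply H; exists k, t; auto. }
destruct Hex as (k & t & Ht0 & Hkt).
assert (Hsame : forall i, Nat.even k = Nat.even i -> tau * w i t < sg i * G t).
{ intros i E; rewrite <- (sg_even k i E); destruct (Hper k i E) as [<- _]; exact Hkt. }
assert (Hosc := fun k => reaches_oscillates tau n x G k Ht HR).
assert (Huse : forall i, (i <= n)%nat -> Nat.even k = Nat.even i ->
   (forall i', S i' = i -> x i' < t) -> ((i < n)%nat -> t < x (S i)) ->
   exists x' j, points n x' /\ reaches tau n x' G /\ (j <= n)%nat /\
     tau * w j (x' j) < sg j * G (x' j)).
{ intros i Hi E H1 H2; exists (update x i t), i.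
  specialize (Hsame i E); split; [apply points_update; auto|].
  split; [apply reaches_update; auto; lra|split; [exact Hi|]].
  rewrite update_eq; exact Hsame. }
assert (Hpos : forall i u, 0 < tau * w i u)
  by (intros; apply Rmult_lt_0_compat; [exact Ht|apply weight_pos]).
destruct (points_locate n x t Hx) as [H|[(i & Hi & H1 & H2)|H]].
- destruct (even_cases k O) as [E|E].
  + apply (Huse O); auto; [lia|discriminate|].
    intros Hn; assert (A := proj2 Hx O Hn); lra.
  (* An excess of the wrong parity before the first contact would start a chain of [n + 1] descents
     with sign -1. *)
  + exfalso; specialize (Hsame 1%nat E).
    assert (HD : descents (S n) (-1) 0 G); [|specialize (Hm _ HD); lia].
    exists t, (x O); repeat split; auto.
    * assert (A := HR O ltac:(lia)); rewrite sg_S in Hsame.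
      assert (B := Hpos O (x O)); assert (C := Hpos 1%nat t).
      unfold sg in *; simpl in *; lra.
    * replace (- -1) with 1 by ring; apply (descents_between_points n); auto.
- destruct (even_cases k i) as [E|E].
  + apply (Huse i); auto; [lia|].
    intros i' Ei; assert (A := points_lt n x i' i Hx ltac:(lia) ltac:(lia)); lra.
  + apply (Huse (S i)); auto.
    * intros i' Ei; injection Ei; intros ->.
      destruct H1 as [H1|H1]; [exact H1|exfalso].
      specialize (Hsame (S i) E); rewrite <- H1, sg_S in Hsame.
      assert (A := HR i ltac:(lia)); assert (B := Hpos i (x i)); assert (C := Hpos (S i) (x i)); lra.
    * intros Hn; assert (A := proj2 Hx (S i) Hn); lra.
- destruct (even_cases k n) as [E|E].
  + apply (Huse n); auto; [|lia].
    intros i' Ei; assert (A := points_lt n x i' n Hx ltac:(lia) (le_n _)); lra.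
  (* Beyond the last contact it would act as a further one; the limit [c], within the bound of that
     parity, completes [n + 2] descents. *)
  + exfalso; specialize (Hsame (S n) E).
    assert (Hxt : x n < t).
    { destruct H as [H|H]; [exact H|exfalso]; rewrite <- H, sg_S in Hsame.
      assert (A := HR n (le_n _)); assert (B := Hpos n (x n)); assert (C := Hpos (S n) (x n)); lra. }
    assert (HD : descents (S (S n)) 1 0 G); [|specialize (Hp _ HD); lia].
    apply (descents_of_points_lim (S n) (update x (S n) t) c); auto.
    * split; [rewrite update_neq by lia; apply Hx|].
      intros i Hi; rewrite (update_neq _ _ _ i) by lia.
      destruct (Nat.eq_dec i n) as [->|]; [rewrite update_eq; exact Hxt|].
      rewrite update_neq by lia; apply Hx; lia.
    * intros i Hi; rewrite (update_neq _ _ _ i) by lia.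
      destruct (Nat.eq_dec i n) as [->|]; [|rewrite update_neq by lia; apply Hosc; lia].
      rewrite update_eq; rewrite sg_S in Hsame.
      assert (A := HR n (le_n _)); assert (B := Hpos n (x n)); assert (C := Hpos (S n) t); lra.
    * rewrite update_eq.
      assert (A := Rmult_le_compat_l tau _ _ ltac:(lra) (weight_ge (S n) t)); lra.
Qed.

Variable nu : R.
Hypothesis Hnu : 0 < nu.
Let sm := smooth r Q nu.

(** [attains] is closed in [c] as long as [sg n * c < tau * l n], and [exceeds] is the open
    counterpart. There the knots are positive, which fixes the sign of the kernel near infinity. *)
Definition attains (tau : R) (n : nat) (c : R) : Prop :=
  exists th x, (forall i, (i < n)%nat -> 0 <= th i <= 1) /\ points n x /\
    reaches tau n x (smooth r Q nu th n c).

Definition exceeds (tau : R) (n : nat) (c : R) : Prop :=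
  exists th x, (forall i, (i < n)%nat -> 0 < th i <= 1) /\ points n x /\
    forall k, (k <= n)%nat -> tau * w k (x k) < sg k * smooth r Q nu th n c (x k).

Definition smooth_snake (tau : R) : Prop :=
  exists n c th x, (forall i, (i < n)%nat -> 0 <= th i <= 1) /\ points n x /\
    below tau (smooth r Q nu th n c) /\ reaches tau n x (smooth r Q nu th n c).

Lemma smooth_shift th n c c' t : sm th n c' t = sm th n c t + (c' - c).
Proof. unfold sm, smooth; ring. Qed.

Lemma exceeds_attains_near tau n c :
  exceeds tau n c -> exists e, 0 < e /\ forall c', Rabs (c' - c) <= e -> attains tau n c'.
Proof.
intros (th & x & Ht & Hx & H).
destruct (finite_min (fun k => sg k * sm th n c (x k) - tau * w k (x k)) n) as (e & He & Hm).
{ intros k Hk; specialize (H k Hk); unfold sm; lra. }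
exists e; split; [exact He|]; intros c' Hc'.
exists th, x; split; [intros i Hi; specialize (Ht i Hi); lra|split; [exact Hx|]].
intros k Hk; specialize (Hm k Hk); simpl in Hm.
change (tau * w k (x k) <= sg k * sm th n c' (x k)).
rewrite (smooth_shift th n c c').
assert (A := sg_abs k (- (c' - c))); rewrite Rabs_Ropp in A; lra.
Qed.

(** [exchange] makes one contact [j] overshoot strictly; [raise] then lifts all the others and
    spends less than the excess at [j]. *)
Lemma exceeds_of_not_below tau n c th x :
  0 < tau -> (forall i, (i < n)%nat -> 0 <= th i <= 1) -> points n x ->
  reaches tau n x (sm th n c) -> sg n * c < tau * l n -> sg (S n) * c <= tau * l (S n) ->
  ~ below tau (sm th n c) -> exceeds tau n c.
Proof.
intros Htau Ht Hx HR Hc1 Hc2 HB.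
assert (Ht0 : forall i, (i < n)%nat -> 0 <= th i) by (intros; apply Ht; auto).
destruct (exchange tau n x c (sm th n c)) as (y & j & Hy & HRy & Hj & Hjy); auto.
- apply (smooth_lim r Q HQ Hr nu); auto.
- intros k; apply (smooth_descents_bound r Q HQ Hr nu Hnu); auto.
- intros k; apply (smooth_descents_bound r Q HQ Hr nu Hnu); auto.
- destruct (raise r Q HQ Hr nu Hnu th n c y j (sg j * sm th n c (y j) - tau * w j (y j)))
    as (th' & Ht' & Hup & Hclose); auto.
  + intros k; apply (reaches_oscillates tau n y (sm th n c) k); auto.
  + assert (A := HRy n (le_n _)).
    assert (B := Rmult_le_compat_l tau _ _ ltac:(lra) (weight_ge n (y n))).
    unfold sm in A; lra.
  + lra.
  + exists th', y; split; [exact Ht'|split; [exact Hy|]].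
    intros k Hk; destruct (Nat.eq_dec k j) as [->|Hkj].
    * assert (A := sg_abs j (- (smooth r Q nu th' n c (y j) - smooth r Q nu th n c (y j)))).
      rewrite Rabs_Ropp in A; unfold sm in *; lra.
    * specialize (Hup k Hk Hkj); specialize (HRy k Hk); unfold sm in *; lra.
Qed.

Lemma Qr_pos t : 0 < Q r t.
Proof. apply (chain_pos r Q HQ); lia. Qed.

(** A knot is inserted far out, at little cost for the existing contacts. Eventually the spline lies
    beyond its limit [c], which is on the bound of parity [S n], by at least [Q r / 2]; by
    Assumption 3 the weight is closer to its own limit than that at some distant point, the new
    contact. *)
Lemma exceeds_extend tau n c :
  0 < tau -> exceeds tau n c -> sg (S n) * c = tau * l (S n) -> exceeds tau (S n) c.
Proof.
intros Htau (th & x & Ht & Hx & H) Hc.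
destruct (finite_min (fun k => sg k * sm th n c (x k) - tau * w k (x k)) n) as (e & He & Hm).
{ intros k Hk; specialize (H k Hk); unfold sm; lra. }
(* The same spline, with a knot at infinity counted as its last one. *)
set (th0 := update th n 0).
assert (E0 : forall t, sm th0 (S n) c t = sm th n c t).
{ intros t; unfold sm, smooth, hkernel; do 3 f_equal.
  apply functional_extensionality; intros s; cbn [hprod]; unfold th0.
  rewrite update_eq, switch_0, Rmult_1_r; f_equal; apply hprod_ext.
  intros i Hi; apply update_neq; lia. }
assert (Ht0 : forall i, (i < S n)%nat -> 0 <= th0 i).
{ intros i Hi; unfold th0, update; destruct (Nat.eqb_spec i n); [lra|].
  apply Rlt_le, Ht; lia. }
destruct (smooth_knot_continuity r Q HQ Hr nu Hnu th0 (S n) c (e / 2) Ht0 ltac:(lra))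
  as (d & Hd & Hcont).
set (th' := update th n (Rmin d 1)).
assert (Hd1 : 0 < Rmin d 1) by (apply Rmin_glb_lt; lra).
assert (Hd2 := Rmin_l d 1); assert (Hd3 := Rmin_r d 1).
assert (Ht' : forall i, (i < S n)%nat -> 0 < th' i <= 1).
{ intros i Hi; unfold th', update; destruct (Nat.eqb_spec i n); [lra|apply Ht; lia]. }
assert (Hclose : forall t, 0 <= t -> Rabs (sm th' (S n) c t - sm th n c t) <= e / 2).
{ intros t Ht1; rewrite <- E0; apply Hcont; auto.
  - intros i Hi; apply Rlt_le, Ht'; auto.
  - intros i Hi; unfold th', th0, update; destruct (Nat.eqb i n).
    + rewrite Rminus_0_r, Rabs_right; lra.
    + rewrite Rminus_diag, Rabs_R0; lra. }
assert (HL := hprod_lim nu th' (S n) Hnu (fun i Hi => proj1 (Ht' i Hi))).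
destruct (proj1 (is_lim_p_infty_eps _ _) HL (/ 2) ltac:(lra)) as [X HX].
assert (Htail : forall t, X <= t -> / 2 * Q r t <= sg (S n) * (sm th' (S n) c t - c)).
{ assert (HK : dominated Q 1 0 (hkernel Q nu th' (S n))).
  { apply (hkernel_dominated r Q HQ nu); intros i Hi; apply Rlt_le, Ht', Hi. }
  assert (HQ0 : dominated Q 1 0 (Q O)).
  { split; [apply HQ|intros t; rewrite Rabs_right; [lra|]].
    apply Rle_ge, Rlt_le, HQ. }
  intros t Ht1.
  enough (0 <= itail r (fun s => sg (S n) * hkernel Q nu th' (S n) s + - / 2 * Q O s) t) as Hn.
  { rewrite (itail_lincomb r Q HQ 1 1 0 r) in Hn by (auto; lia).
    rewrite (chain_itail r Q HQ 0 r) in Hn by lia; simpl (0 + r)%nat in Hn.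
    unfold sm, smooth; lra. }
  apply (itail_nonneg r Q HQ _ 0 r _ X) with (2 := dominated_lincomb Q _ _ 0 (sg (S n)) (- / 2) _ _ HK HQ0);
    [lia| |exact Ht1].
  intros s Hs; specialize (HX s Hs).
  assert (A := sg_abs (S n) (- (hprod nu th' (S n) s - sg (S n)))); rewrite Rabs_Ropp in A.
  assert (B := sg_sq (S n)); unfold hkernel.
  replace (sg (S n) * (hprod nu th' (S n) s * Q O s) + - / 2 * Q O s)
    with ((sg (S n) * hprod nu th' (S n) s - / 2) * Q O s) by ring.
  apply Rmult_le_pos; [lra|apply Rlt_le, HQ]. }
destruct (Hw (S n)) as (_ & _ & _ & _ & HA3).
destruct (HA3 (Rmax X (x n + 1)) (/ (2 * tau)) ltac:(apply Rinv_0_lt_compat; lra))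
  as (t & Ht1 & Ht2).
assert (M1 := Rmax_l X (x n + 1)); assert (M2 := Rmax_r X (x n + 1)).
exists th', (update x (S n) t); split; [exact Ht'|split].
- split; [rewrite update_neq by lia; apply Hx|].
  intros i Hi; rewrite (update_neq _ _ _ i) by lia.
  destruct (Nat.eq_dec i n) as [->|]; [rewrite update_eq; lra|].
  rewrite update_neq by lia; apply Hx; lia.
- intros k Hk; destruct (Nat.eq_dec k (S n)) as [->|Hkn].
  + rewrite update_eq; specialize (Htail t ltac:(lra)); unfold sm in Htail.
    assert (A : tau * (w (S n) t - l (S n)) < tau * (/ (2 * tau) * Q r t))
      by (apply Rmult_lt_compat_l; lra).
    replace (tau * (/ (2 * tau) * Q r t)) with (/ 2 * Q r t) in A by (field; lra); lra.
  + rewrite update_neq by exact Hkn.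
    assert (Hk' : (k <= n)%nat) by lia.
    specialize (Hm k Hk'); simpl in Hm.
    specialize (Hclose (x k) (points_nonneg n x k Hx Hk')).
    assert (A := sg_abs k (- (sm th' (S n) c (x k) - sm th n c (x k)))).
    rewrite Rabs_Ropp in A; unfold sm in *; lra.
Qed.

Lemma exceeds_zero tau : 0 < tau -> exceeds tau 0 (tau * l O).
Proof.
intros Htau; destruct (Hw O) as (_ & _ & _ & _ & HA3).
destruct (HA3 0 (/ tau) ltac:(apply Rinv_0_lt_compat; lra)) as (t & Ht1 & Ht2).
exists (fun _ => 0), (fun _ => t); split; [intros; lia|split].
- split; [exact Ht1|intros; lia].
- intros k Hk; replace k with O by lia.
  assert (E : smooth r Q nu (fun _ => 0) 0 (tau * l O) t = tau * l O + Q r t).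
  { unfold smooth; f_equal; rewrite <- (chain_itail r Q HQ 0 r) by lia.
    f_equal; apply functional_extensionality; intros s; unfold hkernel; simpl; ring. }
  rewrite E; unfold sg; simpl.
  assert (A : tau * (w O t - l O) < tau * (/ tau * Q r t)) by (apply Rmult_lt_compat_l; lra).
  replace (tau * (/ tau * Q r t)) with (Q r t) in A by (field; lra); lra.
Qed.

(** Compactness of the knots in [[0,1]] and of the contacts through [exp (- x)]. The limits of
    successive contacts are distinct because the spline has opposite signs there. *)
Lemma attains_closed tau n (c : nat -> R) (c0 : R) :
  0 < tau -> is_lim_seq c c0 -> (forall j, attains tau n (c j)) -> sg n * c0 < tau * l n ->
  attains tau n c0.
Proof.
intros Htau Hc HA Hc0.
destruct (functional_choice _ HA) as [th Hth]; destruct (functional_choice _ Hth) as [x Hx]; clear HA Hth.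
(* Coordinates below [n] are the knots, coordinates [n] to [n + n] the transformed contacts. *)
destruct (diagonal_extraction
  (fun j i => if Nat.ltb i n then th j i
              else if Nat.leb i (n + n) then exp (- x j (i - n)%nat) else 0) (fun _ => 1))
  as (phi & Hphi & Hlim).
{ intros j i; destruct (Hx j) as (H1 & H2 & _).
  destruct (Nat.ltb_spec i n); [specialize (H1 i H); rewrite Rabs_right; lra|].
  destruct (Nat.leb_spec i (n + n)); [|rewrite Rabs_R0; lra].
  assert (A := points_nonneg n (x j) (i - n) H2 ltac:(lia)).
  assert (B := exp_pos (- x j (i - n)%nat)); rewrite Rabs_right by lra.
  rewrite <- exp_0; destruct A as [A|<-]; [left; apply exp_increasing; lra|right; f_equal; ring]. }
assert (Hc' : is_lim_seq (fun j => c (phi j)) c0).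
{ apply (is_lim_seq_extract c); auto. }
destruct (functional_choice _ Hlim) as [L HL]; clear Hlim.
assert (HLt : forall i, (i < n)%nat -> is_lim_seq (fun j => th (phi j) i) (L i)).
{ intros i Hi; apply (is_lim_seq_ext (fun n0 : nat => if (i <? n)%nat then th (phi n0) i
     else if (i <=? n + n)%nat then exp (- x (phi n0) (i - n)%nat) else 0)); [|apply HL].
  intros j; destruct (Nat.ltb_spec i n); [reflexivity|lia]. }
assert (HLx : forall k, (k <= n)%nat -> is_lim_seq (fun j => exp (- x (phi j) k)) (L (n + k)%nat)).
{ intros k Hk; apply (is_lim_seq_ext (fun j => if (n + k <? n)%nat then th (phi j) (n + k)%nat
     else if (n + k <=? n + n)%nat then exp (- x (phi j) (n + k - n)%nat) else 0)); [|apply HL].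
  intros j; destruct (Nat.ltb_spec (n + k) n); [lia|].
  destruct (Nat.leb_spec (n + k) (n + n)); [|lia].
  do 3 f_equal; lia. }
assert (HT : forall i, (i < n)%nat -> 0 <= L i <= 1).
{ intros i Hi; split.
  - apply (is_lim_seq_le (fun _ => 0) (fun j => th (phi j) i) 0 (L i)).
    + intros j; apply Hx, Hi.
    + apply is_lim_seq_const.
    + apply HLt, Hi.
  - apply (is_lim_seq_le (fun j => th (phi j) i) (fun _ => 1) (L i) 1).
    + intros j; apply Hx, Hi.
    + apply HLt, Hi.
    + apply is_lim_seq_const. }
assert (HT0 : forall i, (i < n)%nat -> 0 <= L i) by (intros; apply HT; auto).
(* The last point stays bounded because sg n * c0 < tau * l n. *)
assert (Hlast : 0 < L (n + n)%nat).
{ assert (H0 : 0 <= L (n + n)%nat).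
  { apply (is_lim_seq_le (fun _ => 0) (fun j => exp (- x (phi j) n)) 0 (L (n + n)%nat)).
    - intros j; left; apply exp_pos.
    - apply is_lim_seq_const.
    - apply HLx; lia. }
  destruct H0 as [H0|H0]; [exact H0|exfalso].
  assert (Hinf : is_lim_seq (fun j => Q r (x (phi j) n)) 0).
  { apply is_lim_seq_spec; intros eps.
    assert (HQr : tail_of (Q (r - 1)%nat) (Q r)).
    { replace r with (S (r - 1)) at 2 by lia; apply HQ; lia. }
    destruct (tail_of_eps _ _ eps HQr (cond_pos eps)) as (X & _ & HX).
    specialize (HLx n (le_n _)); rewrite <- H0 in HLx; apply is_lim_seq_spec in HLx.
    destruct (HLx (mkposreal _ (exp_pos (- X)))) as [N HN]; exists N; intros j Hj.
    specialize (HN j Hj); simpl in HN; rewrite Rminus_0_r in HN |- *.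
    apply HX; apply Rnot_lt_le; intros C.
    assert (exp (- X) < exp (- x (phi j) n)) by (apply exp_increasing; lra).
    rewrite Rabs_right in HN; [lra|left; apply exp_pos]. }
  assert (Hle : tau * l n <= sg n * c0 + 0).
  { apply (is_lim_seq_le (fun _ => tau * l n) (fun j => sg n * c (phi j) + Q r (x (phi j) n))
             (tau * l n) (sg n * c0 + 0)).
    - intros j; destruct (Hx (phi j)) as (H1 & H2 & H3).
      specialize (H3 n (le_n _)); unfold smooth in H3.
      assert (HK : dominated Q 1 0 (hkernel Q nu (th (phi j)) n))
        by (apply (hkernel_dominated r Q HQ nu); intros; apply H1; auto).
      destruct (dominated_itail r Q HQ 1 0 r _ ltac:(lia) HK) as [_ HB].
      specialize (HB (x (phi j) n)); simpl in HB.
      assert (A := sg_abs n (itail r (hkernel Q nu (th (phi j)) n) (x (phi j) n))).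
      assert (B := Rmult_le_compat_l tau _ _ ltac:(lra) (weight_ge n (x (phi j) n))); lra.
    - apply is_lim_seq_const.
    - apply is_lim_seq_plus'; [|exact Hinf].
      apply (is_lim_seq_scal_l (fun j => c (phi j)) (sg n) c0 Hc'). }
  lra. }
set (X := fun k => - ln (L (n + k)%nat)).
assert (Hmono : forall k, (k <= n)%nat -> L (n + n)%nat <= L (n + k)%nat).
{ intros k Hk; apply (is_lim_seq_le (fun j => exp (- x (phi j) n)) (fun j => exp (- x (phi j) k))
    (L (n + n)%nat) (L (n + k)%nat)).
  - intros j; destruct (Hx (phi j)) as (_ & H2 & _).
    destruct (points_le n (x (phi j)) k n H2 Hk (le_n _)) as [A| ->]; [|lra].
    left; apply exp_increasing; lra.
  - apply HLx; lia.
  - apply HLx; lia. }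
assert (HX : forall k, (k <= n)%nat -> is_lim_seq (fun j => x (phi j) k) (X k)).
{ intros k Hk; apply (is_lim_seq_ext (fun j => - ln (exp (- x (phi j) k)))).
  - intros j; rewrite ln_exp; ring.
  - apply (is_lim_seq_opp (fun j => ln (exp (- x (phi j) k))) (ln (L (n + k)%nat))).
    apply (is_lim_seq_continuous ln (fun j => exp (- x (phi j) k))); [|apply HLx, Hk].
    apply continuity_pt_filterlim, (ex_derive_continuous (V := R_NormedModule)).
    specialize (Hmono k Hk); eexists; apply is_derive_ln; lra. }
assert (HX0 : forall k, (k <= n)%nat -> 0 <= X k).
{ intros k Hk; apply (is_lim_seq_le (fun _ => 0) (fun j => x (phi j) k) 0 (X k)).
  - intros j; apply (points_nonneg n); [apply Hx|exact Hk].
  - apply is_lim_seq_const.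
  - apply HX, Hk. }
assert (HR : reaches tau n X (smooth r Q nu L n c0)).
{ intros k Hk.
  assert (Hsm : is_lim_seq (fun j => sm (th (phi j)) n c0 (x (phi j) k)
                                     - sm L n c0 (x (phi j) k)) 0).
  { apply is_lim_seq_spec; intros eps.
    destruct (smooth_knot_continuity r Q HQ Hr nu Hnu L n c0 (eps / 2) HT0
                ltac:(generalize (cond_pos eps); lra)) as (d & Hd & Hcont).
    assert (HN : exists N, forall j, (N <= j)%nat -> forall i, (i < n)%nat ->
                   Rabs (th (phi j) i - L i) < d).
    { assert (G : forall m, (m <= n)%nat -> exists N, forall j, (N <= j)%nat ->
                forall i, (i < m)%nat -> Rabs (th (phi j) i - L i) < d).
      { induction m as [|m IH]; intros Hm; [exists O; intros; lia|].
        destruct (IH ltac:(lia)) as [N1 H1].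
        assert (A := HLt m ltac:(lia)); apply is_lim_seq_spec in A.
        destruct (A (mkposreal d Hd)) as [N2 H2]; simpl in H2.
        exists (max N1 N2); intros j Hj i Hi.
        destruct (Nat.eq_dec i m) as [->|]; [apply H2; lia|apply H1; lia]. }
      apply (G n (le_n _)). }
    destruct HN as [N HN]; exists N; intros j Hj; rewrite Rminus_0_r.
    apply Rle_lt_trans with (eps / 2); [|generalize (cond_pos eps); lra].
    apply Hcont.
    - intros i Hi; apply Hx, Hi.
    - intros i Hi; apply Rlt_le, HN; auto.
    - apply (points_nonneg n); [apply Hx|exact Hk]. }
  assert (Hcomp : forall f, continuous f (X k) ->
            is_lim_seq (fun j => f (x (phi j) k)) (f (X k))).
  { intros f Hf; apply (is_lim_seq_continuous f); [|apply HX, Hk].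
    apply continuity_pt_filterlim, Hf. }
  enough (Hn : Rbar_le (tau * w k (X k)) (sg k * (0 + sm L n c0 (X k) + (c0 - c0))))
    by (simpl in Hn; unfold sm in Hn; lra).
  apply (is_lim_seq_le (fun j => tau * w k (x (phi j) k))
    (fun j => sg k * ((sm (th (phi j)) n c0 (x (phi j) k) - sm L n c0 (x (phi j) k))
                      + sm L n c0 (x (phi j) k) + (c (phi j) - c0)))
    (tau * w k (X k)) (sg k * (0 + sm L n c0 (X k) + (c0 - c0)))).
  - intros j; destruct (Hx (phi j)) as (_ & _ & H3); specialize (H3 k Hk).
    change (smooth r Q nu) with sm in H3.
    rewrite (smooth_shift _ n c0 (c (phi j))) in H3; lra.
  - apply (is_lim_seq_scal_l (fun j => w k (x (phi j) k)) tau (w k (X k))).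
    apply Hcomp, Hw.
  - apply (is_lim_seq_scal_l _ (sg k) (0 + sm L n c0 (X k) + (c0 - c0))).
    apply is_lim_seq_plus'.
    + apply is_lim_seq_plus'; [exact Hsm|].
      apply Hcomp, (smooth_continuous r Q HQ Hr nu); auto.
    + apply is_lim_seq_minus'; [exact Hc'|apply is_lim_seq_const]. }
exists L, X; split; [exact HT|split; [|exact HR]].
split; [apply HX0; lia|]; intros i Hi.
assert (Hle : X i <= X (S i)).
{ apply (is_lim_seq_le (fun j => x (phi j) i) (fun j => x (phi j) (S i)) (X i) (X (S i))).
  - intros j; destruct (Hx (phi j)) as (_ & H2 & _); apply Rlt_le, H2, Hi.
  - apply HX; lia.
  - apply HX; lia. }
destruct Hle as [Hle|Hle]; [exact Hle|exfalso].
assert (A := reaches_oscillates tau n X _ i Htau HR Hi); rewrite <- Hle in A; lra.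
Qed.

(* Push the limit c from the bound of parity n towards the opposite one for as long as n + 1
   contacts survive. Where this stops we have a snake, unless c has reached the opposite
   bound, which then leaves room for one more contact far out. *)
Lemma smooth_stage tau n :
  0 < tau -> exceeds tau n (sg n * (tau * l n)) ->
  smooth_snake tau \/ exceeds tau (S n) (sg (S n) * (tau * l (S n))).
Proof.
intros Htau HE.
assert (Pn := Rmult_lt_0_compat _ _ Htau (limit_pos n)).
assert (PS := Rmult_lt_0_compat _ _ Htau (limit_pos (S n))).
assert (Hsq : forall k y, sg k * (sg k * y) = y)
  by (intros k y; rewrite <- Rmult_assoc, sg_sq; ring).
destruct (exceeds_attains_near tau n _ HE) as (e & He & Hnear).
(* Starting slightly inside the bound yields the strict inequality that [attains_closed] asks
   for. *)
set (k1 := Rmax 0 (tau * l n - e)).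
assert (Hk1 : k1 < tau * l n) by (apply Rmax_lub_lt; lra).
assert (Hk1' := Rmax_r 0 (tau * l n - e)); assert (Hk1'' := Rmax_l 0 (tau * l n - e)).
fold k1 in Hk1', Hk1''.
(* The variable is [y = - sg n * c], so that pushing [c] towards the opposite bound means taking a
   least upper bound. *)
set (E := fun y => - (tau * l (S n)) <= - y /\ attains tau n (sg n * - y)).
assert (HE1 : E (- k1)).
{ split; [lra|]; rewrite Ropp_involutive; apply Hnear.
  replace (sg n * k1 - sg n * (tau * l n)) with (sg n * (k1 - tau * l n)) by ring.
  rewrite Rabs_mult, Rabs_sg, Rmult_1_l.
  rewrite Rabs_left1; lra. }
destruct (completeness E) as [m [Hub Hlub]].
{ exists (tau * l (S n)); intros y [H _]; lra. }
{ exists (- k1); exact HE1. }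
assert (Hm1 : - k1 <= m) by (apply Hub, HE1).
assert (Hm2 : m <= tau * l (S n)) by (apply Hlub; intros y [H _]; lra).
assert (Hseq : forall j : nat, exists y, E y /\ Rabs (y - m) < / (INR j + 1)).
{ intros j; assert (Pj : 0 < / (INR j + 1))
    by (apply Rinv_0_lt_compat; generalize (pos_INR j); lra).
  apply NNPP; intros H.
  assert (m <= m - / (INR j + 1)); [|lra].
  apply Hlub; intros y Hy; apply Rnot_lt_le; intros C; apply H; exists y; split; [exact Hy|].
  specialize (Hub y Hy); apply Rabs_def1; lra. }
destruct (functional_choice _ Hseq) as [y Hy].
assert (HAm : attains tau n (sg n * - m)).
{ apply (attains_closed tau n (fun j => sg n * - y j)); auto.
  - apply (is_lim_seq_scal_l (fun j => - y j) (sg n) (- m)).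
    apply (is_lim_seq_opp y m), is_lim_seq_spec; intros eps.
    destruct (archimed_cor1 eps (cond_pos eps)) as (N & HN & HN0).
    exists N; intros j Hj; apply Rlt_trans with (1 := proj2 (Hy j)).
    apply Rle_lt_trans with (2 := HN), Rinv_le_contravar; [apply lt_0_INR; lia|].
    apply Rle_trans with (INR j); [apply le_INR; lia|lra].
  - intros j; apply Hy.
  - rewrite Hsq; lra. }
destruct HAm as (th & x & Ht & Hx & HR).
destruct (classic (below tau (sm th n (sg n * - m)))) as [HB|HB].
{ left; exists n, (sg n * - m), th, x; auto. }
assert (HX : exceeds tau n (sg n * - m)).
{ apply (exceeds_of_not_below tau n _ th x); auto.
  - rewrite Hsq; lra.
  - rewrite sg_S; replace (- sg n * (sg n * - m)) with (sg n * (sg n * m)) by ring.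
    rewrite Hsq; exact Hm2. }
destruct (Req_dec m (tau * l (S n))) as [Em|Em].
- right; replace (sg (S n) * (tau * l (S n))) with (sg n * - m) by (rewrite sg_S, Em; ring).
  apply exceeds_extend; auto.
  rewrite sg_S; replace (- sg n * (sg n * - m)) with (sg n * (sg n * m)) by ring.
  rewrite Hsq; exact Em.
(* Short of the opposite bound a further push would be possible, against the choice of [m]. *)
- exfalso; destruct (exceeds_attains_near tau n _ HX) as (e' & He' & Hnear').
  set (m' := Rmin (tau * l (S n)) (m + e')).
  assert (A1 : m < m') by (apply Rmin_glb_lt; lra).
  assert (A2 := Rmin_l (tau * l (S n)) (m + e')); assert (A3 := Rmin_r (tau * l (S n)) (m + e')).
  fold m' in A2, A3.
  assert (HE' : E m'); [|specialize (Hub m' HE'); lra].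
  split; [lra|]; apply Hnear'.
  replace (sg n * - m' - sg n * - m) with (sg n * (m - m')) by ring.
  rewrite Rabs_mult, Rabs_sg, Rmult_1_l.
  rewrite Rabs_left1; lra.
Qed.

(** Between successive contacts the spline travels at least [tau] times the smaller limit, while its
    total variation is at most [Q r 0]. This bounds the number of contacts at a given height. *)
Lemma chain_increment_points tau n x G :
  0 < tau -> points n x -> reaches tau n x G ->
  (forall u v, u <= v -> Rabs (G u - G v) <= Q r u - Q r v) ->
  INR n * (tau * Rmin (l O) (l 1%nat)) <= Q r 0.
Proof.
intros Htau Hx HR HG.
assert (Hmin : forall k, Rmin (l O) (l 1%nat) <= l k).
{ intros k; destruct (even_cases k O) as [E|E]; destruct (Hper k _ E) as [_ ->];
    [apply Rmin_l|apply Rmin_r]. }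
assert (H : forall k, (k <= n)%nat ->
          INR k * (tau * Rmin (l O) (l 1%nat)) <= Q r (x O) - Q r (x k)).
{ induction k as [|k IH]; intros Hk; [simpl; lra|]; rewrite S_INR.
  specialize (IH ltac:(lia)).
  assert (A := HR k ltac:(lia)); assert (B := HR (S k) ltac:(lia)); rewrite sg_S in B.
  assert (C := HG (x k) (x (S k)) (Rlt_le _ _ (proj2 Hx k Hk))).
  assert (D := sg_abs k (G (x k) - G (x (S k)))).
  assert (E1 := Rmult_le_compat_l tau _ _ ltac:(lra)
                  (Rle_trans _ _ _ (Hmin k) (weight_ge k (x k)))).
  assert (E2 := Rmult_lt_0_compat _ _ Htau (weight_pos (S k) (x (S k)))).
  lra. }
specialize (H n (le_n _)); assert (A := Qr_pos (x n)).
assert (B : Q r (x O) <= Q r 0); [|lra].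
destruct (proj1 Hx) as [B|<-]; [left|lra].
replace r with (S (r - 1)) by lia; apply (chain_decreasing r Q HQ); [lia|exact B].
Qed.

Lemma smooth_increment th n c u v :
  (forall i, (i < n)%nat -> 0 <= th i) -> u <= v ->
  Rabs (smooth r Q nu th n c u - smooth r Q nu th n c v) <= Q r u - Q r v.
Proof.
intros Ht Huv; unfold smooth.
replace (c + itail r (hkernel Q nu th n) u - (c + itail r (hkernel Q nu th n) v))
  with (itail r (hkernel Q nu th n) u - itail r (hkernel Q nu th n) v) by ring.
assert (HK := hkernel_dominated r Q HQ nu th n Ht).
assert (E : r = S (r - 1)) by lia.
rewrite <- (Rmult_1_l (Q r u - Q r v)).
apply (tail_increment (itail (r - 1) (hkernel Q nu th n)) _ (Q (r - 1)%nat) _ 1); auto.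
- rewrite E at 2; apply (itail_tail r Q HQ 1 0); [lia|exact HK].
- rewrite E at 2; apply HQ; lia.
- apply (dominated_itail r Q HQ 1 0 (r - 1)); [lia|exact HK].
Qed.

(** The stages must stop: [exceeds] with too many contacts contradicts [chain_increment_points]. *)
Lemma smooth_snake_exists tau : 0 < tau -> smooth_snake tau.
Proof.
intros Htau.
assert (Hind : forall n, smooth_snake tau \/ exceeds tau n (sg n * (tau * l n))).
{ induction n as [|n [H|H]]; [right|left; exact H|apply smooth_stage; auto].
  replace (sg 0 * (tau * l O)) with (tau * l O) by (unfold sg; simpl; ring).
  apply exceeds_zero, Htau. }
set (m := tau * Rmin (l O) (l 1%nat)).
assert (Hm : 0 < m) by (apply Rmult_lt_0_compat; [exact Htau|apply Rmin_glb_lt; apply limit_pos]).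
destruct (INR_unbounded (Q r 0 / m)) as [N HN].
destruct (Hind N) as [H|(th & x & Ht & Hx & H)]; [exact H|exfalso].
assert (A := chain_increment_points tau N x _ Htau Hx (fun k Hk => Rlt_le _ _ (H k Hk))
   (fun u v => smooth_increment th N _ u v (fun i Hi => Rlt_le _ _ (proj1 (Ht i Hi))))).
fold m in A.
assert (B : Q r 0 / m * m < INR N * m) by (apply Rmult_lt_compat_r; lra).
replace (Q r 0 / m * m) with (Q r 0) in B by (field; lra); lra.
Qed.

End Snakes.

(** * Limits of splines *)

Lemma finite_eventually (P : nat -> nat -> Prop) m :
  (forall a, (a <= m)%nat -> exists N, forall j, (N <= j)%nat -> P a j) ->
  exists N, forall j, (N <= j)%nat -> forall a, (a <= m)%nat -> P a j.
Proof.
induction m as [|m IH]; intros H.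
- destruct (H O (le_n _)) as [N HN]; exists N; intros j Hj a Ha.
  replace a with O by lia; auto.
- destruct IH as [N1 H1]; [auto|]; destruct (H (S m) (le_n _)) as [N2 H2].
  exists (max N1 N2); intros j Hj a Ha.
  destruct (Nat.eq_dec a (S m)) as [->|]; [apply H2; lia|apply H1; lia].
Qed.

Lemma bounded_constant_subsequence (n : nat -> nat) N :
  (forall j, (n j <= N)%nat) ->
  exists nn f, (nn <= N)%nat /\ (forall j, (j <= f j)%nat) /\ forall j, n (f j) = nn.
Proof.
intros Hn.
assert (H : exists nn, (nn <= N)%nat /\ forall J, exists j, (J <= j)%nat /\ n j = nn).
{ apply NNPP; intros H.
  destruct (finite_eventually (fun a j => n j <> a) N) as [J HJ].
  - intros a Ha; apply NNPP; intros Hno; apply H; exists a; split; [exact Ha|].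
    intros J; apply NNPP; intros Hno'; apply Hno; exists J; intros j Hj E.
    apply Hno'; exists j; auto.
  - apply (HJ J (le_n _) (n J)); auto. }
destruct H as (nn & Hnn & H); destruct (functional_choice _ H) as [f Hf].
exists nn, f; split; [exact Hnn|split; intros j; apply Hf].
Qed.

Lemma slack_chain_weaken (q y : R -> R) k s a eta eta' :
  eta' <= eta -> slack_chain q y k s a eta -> slack_chain q y k s a eta'.
Proof.
intros Hle; revert s a; induction k as [|k IH]; intros s a; [trivial|].
intros (u & v & H1 & H2 & H3 & H4); exists u, v; repeat split; auto; lra.
Qed.

(** Three perturbations enter a link, those of [y] at its two ends and [eta]; a quarter of its slack
    for each leaves it strict. *)
Lemma slack_chain_stable (q y : R -> R) k s a :
  is_unit_sign s -> slack_chain q y k s a 0 ->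
  exists e, 0 < e /\ forall y' eta, (forall t, a <= t -> Rabs (y' t - y t) <= e) ->
    eta <= e -> slack_chain q y' k s a eta.
Proof.
revert s a; induction k as [|k IH]; intros s a Hs.
- intros _; exists 1; split; [lra|]; intros; exact I.
- intros (x & x' & H1 & H2 & H3 & H4).
  destruct (IH (- s) x' (is_unit_sign_opp s Hs) H4) as (e & He & H).
  set (d := q x - q x' - s * (y x - y x')).
  exists (Rmin e (d / 4)).
  assert (M1 := Rmin_l e (d / 4)); assert (M2 := Rmin_r e (d / 4)).
  split; [apply Rmin_glb_lt; unfold d; lra|]; intros y' eta Hy Heta.
  exists x, x'; repeat split; auto.
  + assert (A := Hy x H1); assert (B := Hy x' ltac:(lra)).
    assert (C := unit_sign_abs s (y' x - y x) Hs).
    assert (D := unit_sign_abs (- s) (y' x' - y x') (is_unit_sign_opp s Hs)).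
    unfold d in *; lra.
  + apply H; [|lra]; intros t Ht; specialize (Hy t ltac:(lra)); lra.
Qed.

Section Limits.
Variables (r : nat) (Q : nat -> R -> R).
Hypothesis HQ : tail_chain r Q.
Hypothesis Hr : (1 <= r)%nat.

(** The second condition fixes the additive constant that [contracted] leaves open: [y] tends to 0
    at infinity. *)
Definition slope (y : R -> R) : Prop :=
  contracted (Q 1%nat) y /\ forall t, Rabs (y t) <= Q 1%nat t.

(* For extremal y this is a perfect spline with limit c at infinity; y is its derivative of
   order r - 1, up to the sign and, if r = 1, the constant c. *)
Definition spline (c : R) (y : R -> R) (t : R) : R := c + itail (r - 1) y t.

Lemma slope_dominated y : slope y -> dominated Q 1 1 y.
Proof.
intros [H1 H2]; split.
- apply (contracted_continuous (Q 1%nat)); [exact H1|].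
  apply (chain_continuous r Q HQ); lia.
- intros t; rewrite Rmult_1_l; apply H2.
Qed.

Lemma spline_continuous c y t : slope y -> continuous (spline c y) t.
Proof.
intros Hy; apply (continuous_Rplus (fun _ => c)); [apply continuous_const|].
apply (dominated_itail r Q HQ 1 1 (r - 1)); [lia|apply slope_dominated, Hy].
Qed.

Lemma spline_lim c y : slope y -> is_lim (spline c y) p_infty c.
Proof.
intros Hy; unfold spline; replace (Finite c) with (Finite (c + 0)) by (f_equal; ring).
apply is_lim_plus'; [apply is_lim_const|].
apply (dominated_lim r Q HQ 1 (r - 1)); [lia|].
replace (S (r - 1)) with (1 + (r - 1))%nat by lia.
apply (dominated_itail r Q HQ 1 1); [lia|apply slope_dominated, Hy].
Qed.

Lemma spline_descents c y k s a :
  slope y -> descents k s a (spline c y) -> descents k s a y.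
Proof.
intros Hy; apply (descents_itail r Q HQ 1 0 (r - 1)); [lia|apply slope_dominated, Hy].
Qed.

Lemma spline_close eps :
  0 < eps -> exists d, 0 < d /\ forall c c' y y', slope y -> slope y' ->
    Rabs (c - c') <= d -> (forall t, 0 <= t -> Rabs (y t - y' t) <= d) ->
    forall t, 0 <= t -> Rabs (spline c y t - spline c' y' t) <= eps.
Proof.
intros He.
destruct (itail_small r Q HQ 1 (r - 1) 2 (eps / 2) ltac:(lia) ltac:(lra) ltac:(lra))
  as (d & Hd & H).
exists (Rmin d (eps / 2)).
assert (M1 := Rmin_l d (eps / 2)); assert (M2 := Rmin_r d (eps / 2)).
split; [apply Rmin_glb_lt; lra|]; intros c c' y y' Hy Hy' Hc Hyy t Ht.
assert (D := slope_dominated y Hy); assert (D' := slope_dominated y' Hy').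
assert (DD := dominated_lincomb Q _ _ 1 1 (-1) _ _ D D').
rewrite Rabs_R1, (Rabs_left (-1)) in DD by lra.
replace (1 * 1 + - (-1) * 1) with 2 in DD by ring.
specialize (H _ DD).
assert (E := itail_lincomb r Q HQ 1 1 1 (r - 1) 1 (-1) y y' ltac:(lia) D D' t).
replace (spline c y t - spline c' y' t)
  with ((c - c') + (1 * itail (r - 1) y t + -1 * itail (r - 1) y' t)) by (unfold spline; ring).
rewrite <- E; apply Rle_trans with (1 := Rabs_triang _ _).
assert (F : Rabs (itail (r - 1) (fun t => 1 * y t + -1 * y' t) t) <= eps / 2); [|lra].
apply H; [|exact Ht]; intros u Hu.
replace (1 * y u + -1 * y' u) with (y u - y' u) by ring.
specialize (Hyy u Hu); lra.
Qed.

Lemma Q1_lipschitz s t : 0 <= s -> s <= t -> Q 1%nat s - Q 1%nat t <= Q O 0 * (t - s).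
Proof.
intros Hs Hst; destruct (chain_tail r Q HQ 0 ltac:(lia)) as [Hd _].
enough (- Q 1%nat t - - Q 1%nat s <= Q O 0 * t - Q O 0 * s) by lra.
apply (derive_increment_le (fun t => - Q 1%nat t) (fun t => - - Q O t)
         (fun t => Q O 0 * t) (fun _ => Q O 0)); auto.
- intros u; apply (is_derive_opp (V := R_NormedModule)), Hd.
- intros u; auto_derive; [exact I|ring].
- intros u Hu; rewrite Ropp_involutive; apply HQ; lra.
Qed.

(** The data live on the half-line, whereas [slope] concerns the whole line; a continuation parallel
    to [Q 1] keeps both conditions. *)
Lemma slope_extend y :
  (forall u v, 0 <= u -> u <= v -> Rabs (y u - y v) <= Q 1%nat u - Q 1%nat v) ->
  (forall t, 0 <= t -> Rabs (y t) <= Q 1%nat t) ->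
  slope (fun t => y (Rmax t 0) + (Q 1%nat t - Q 1%nat (Rmax t 0))).
Proof.
intros Hc Hb.
assert (HQdec : forall u v, u <= v -> Q 1%nat v <= Q 1%nat u).
{ intros u v [Huv| ->]; [left; apply (chain_decreasing r Q HQ); [lia|exact Huv]|lra]. }
split.
- intros u v Huv.
  assert (A := Hc (Rmax u 0) (Rmax v 0) (Rmax_r _ _) ltac:(apply Rmax_le_compat; lra)).
  assert (B : 0 <= (Q 1%nat u - Q 1%nat (Rmax u 0)) - (Q 1%nat v - Q 1%nat (Rmax v 0))).
  { unfold Rmax; destruct (Rle_dec u 0), (Rle_dec v 0).
    - specialize (HQdec u v Huv); lra.
    - specialize (HQdec u 0 ltac:(lra)); lra.
    - lra.
    - lra. }
  apply Rabs_le_between in A; apply Rabs_le; lra.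
- intros t; assert (A := Hb (Rmax t 0) (Rmax_r _ _)).
  specialize (HQdec t (Rmax t 0) (Rmax_l _ _)).
  apply Rabs_le_between in A; apply Rabs_le; lra.
Qed.

(** The theorem of Arzela and Ascoli: a common Lipschitz constant gives equicontinuity, the common
    bound [Q 1] uniform decay, and convergence at the rationals becomes uniform. *)
Lemma slope_compactness (y : nat -> R -> R) :
  (forall j, slope (y j)) ->
  exists phi y0, (forall j, (j <= phi j)%nat) /\ slope y0 /\
    forall eps, 0 < eps -> exists N, forall j, (N <= j)%nat ->
      forall t, 0 <= t -> Rabs (y (phi j) t - y0 t) <= eps.
Proof.
intros Hy.
(* All nonnegative rationals, enumerated by Cantor's pairing. *)
set (q := fun i => let (a, b) := of_nat i in INR a / (INR b + 1)).
destruct (diagonal_extraction (fun j i => y j (q i)) (fun i => Q 1%nat (q i)))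
  as (phi & Hphi & Hlim); [intros; apply Hy|].
assert (HQ1 : tail_of (Q O) (Q 1%nat)) by (apply HQ; lia).
assert (g0 : 0 < Q O 0) by apply HQ.
assert (Hcauchy : forall eps, 0 < eps -> exists N, forall j k, (N <= j)%nat -> (N <= k)%nat ->
          forall t, 0 <= t -> Rabs (y (phi j) t - y (phi k) t) <= eps).
{ intros eps He.
  destruct (tail_of_eps _ _ (eps / 2) HQ1 ltac:(lra)) as (X & HX0 & HX).
  (* On a mesh of width [/ (INR c + 1)] every [y j] varies by at most [eps / 6]. *)
  destruct (INR_unbounded (6 * Q O 0 / eps)) as [c Hc].
  assert (Pc : 0 < INR c + 1) by (generalize (pos_INR c); lra).
  assert (Hc' : Q O 0 * / (INR c + 1) <= eps / 6).
  { apply Rmult_le_reg_r with (INR c + 1); [lra|].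
    rewrite Rmult_assoc, Rinv_l, Rmult_1_r by lra.
    assert (A : 6 * Q O 0 / eps * eps < INR c * eps) by (apply Rmult_lt_compat_r; lra).
    replace (6 * Q O 0 / eps * eps) with (6 * Q O 0) in A by (field; lra); lra. }
  destruct (INR_unbounded (X * (INR c + 1))) as [m Hm].
  destruct (functional_choice _ Hlim) as [L HL].
  destruct (finite_eventually (fun a j => Rabs (y (phi j) (q (to_nat (a, c))) - L (to_nat (a, c)))
              <= eps / 6) m) as [N HN].
  { intros a _; specialize (HL (to_nat (a, c))); apply is_lim_seq_spec in HL.
    assert (He6 : 0 < eps / 6) by lra.
    destruct (HL (mkposreal _ He6)) as [N HN]; exists N; intros j Hj.
    apply Rlt_le, HN, Hj. }
  exists N; intros j k Hj Hk t Ht.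
  destruct (Rle_dec X t) as [HXt|HXt].
  - specialize (HX t HXt); assert (A := proj2 (Hy (phi j)) t); assert (B := proj2 (Hy (phi k)) t).
    assert (C := Rle_abs (Q 1%nat t)).
    apply Rabs_le_between in A; apply Rabs_le_between in B; apply Rabs_le; lra.
  - destruct (nfloor_ex (t * (INR c + 1))) as (a & Ha1 & Ha2).
    { apply Rmult_le_pos; lra. }
    assert (Ha : (a <= m)%nat).
    { apply INR_le, Rle_trans with (1 := Ha1), Rlt_le, Rle_lt_trans with (2 := Hm).
      apply Rmult_le_compat_r; lra. }
    assert (Eq : q (to_nat (a, c)) = INR a / (INR c + 1)) by (unfold q; rewrite cancel_of_to; reflexivity).
    set (p := INR a / (INR c + 1)) in *.
    assert (Hp0 : 0 <= p) by (apply Rdiv_le_0_compat; [apply pos_INR|exact Pc]).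
    assert (Hpt : p <= t).
    { apply Rmult_le_reg_r with (INR c + 1); [exact Pc|].
      unfold p; replace (INR a / (INR c + 1) * (INR c + 1)) with (INR a) by (field; lra); exact Ha1. }
    assert (Htp : t - p <= / (INR c + 1)).
    { apply Rmult_le_reg_r with (INR c + 1); [exact Pc|].
      rewrite Rinv_l by lra; unfold p.
      replace ((t - INR a / (INR c + 1)) * (INR c + 1)) with (t * (INR c + 1) - INR a)
        by (field; lra); lra. }
    assert (Hloc : forall i, Rabs (y i p - y i t) <= eps / 6).
    { intros i; apply Rle_trans with (1 := proj1 (Hy i) p t Hpt).
      apply Rle_trans with (1 := Q1_lipschitz p t Hp0 Hpt), Rle_trans with (2 := Hc').
      apply Rmult_le_compat_l; lra. }
    assert (A := HN j Hj a Ha); assert (B := HN k Hk a Ha); cbv beta in A, B; rewrite Eq in A, B.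
    assert (C := Hloc (phi j)); assert (D := Hloc (phi k)).
    apply Rabs_le_between in A; apply Rabs_le_between in B.
    apply Rabs_le_between in C; apply Rabs_le_between in D; apply Rabs_le; lra. }
assert (Hex : forall t, exists l : R, 0 <= t -> is_lim_seq (fun j => y (phi j) t) l).
{ intros t; destruct (Rle_dec 0 t) as [Ht|Ht]; [|exists 0; intros; lra].
  destruct (proj2 (ex_lim_seq_cauchy_corr (fun j => y (phi j) t))) as [l Hl].
  - intros eps; destruct (Hcauchy (eps / 2)) as [N HN]; [generalize (cond_pos eps); lra|].
    exists N; intros j k Hj Hk; apply Rle_lt_trans with (1 := HN j k Hj Hk t Ht).
    generalize (cond_pos eps); lra.
  - exists l; intros _; exact Hl. }
destruct (functional_choice _ Hex) as [L HL].
set (y0 := fun t => L (Rmax t 0) + (Q 1%nat t - Q 1%nat (Rmax t 0))).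
assert (Hy0 : forall t, 0 <= t -> y0 t = L t).
{ intros t Ht; unfold y0; rewrite Rmax_left by exact Ht; ring. }
exists phi, y0; split; [exact Hphi|split; [apply slope_extend|]].
- intros u v Hu Huv.
  apply (is_lim_seq_le (fun j => Rabs (y (phi j) u - y (phi j) v))
           (fun _ => Q 1%nat u - Q 1%nat v) (Rabs (L u - L v)) (Q 1%nat u - Q 1%nat v)).
  + intros j; apply (proj1 (Hy (phi j))), Huv.
  + apply (is_lim_seq_abs _ (L u - L v)), is_lim_seq_minus'; apply HL; lra.
  + apply is_lim_seq_const.
- intros t Ht; apply (is_lim_seq_le (fun j => Rabs (y (phi j) t)) (fun _ => Q 1%nat t)
           (Rabs (L t)) (Q 1%nat t)).
  + intros j; apply Hy.
  + apply (is_lim_seq_abs _ (L t)), HL, Ht.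
  + apply is_lim_seq_const.
- intros eps He; destruct (Hcauchy eps He) as [N HN]; exists N; intros j Hj t Ht.
  rewrite Hy0 by exact Ht.
  apply (is_lim_seq_le_loc (fun k => Rabs (y (phi j) t - y (phi k) t)) (fun _ => eps)
           (Rabs (y (phi j) t - L t)) eps).
  + exists N; intros k Hk; apply HN; auto.
  + apply (is_lim_seq_abs _ (y (phi j) t - L t)), is_lim_seq_minus'; [apply is_lim_seq_const|].
    apply HL, Ht.
  + apply is_lim_seq_const.
Qed.

Lemma extremal_strictly_decreasing y m s a :
  is_unit_sign s -> pieces (extremal_on (Q 1%nat) y) m s a ->
  pieces (strictly_decreasing_on y) m s a.
Proof.
intros Hs; apply pieces_impl; auto; clear s a Hs; intros s a b Hs H u v Hu Huv Hv.
rewrite (H u v Hu ltac:(lra) Hv), <- Rmult_assoc.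
replace (s * s) with 1 by (destruct Hs as [-> | ->]; ring).
assert (A := chain_decreasing r Q HQ 0 u v ltac:(lia) Huv); lra.
Qed.

Lemma extremal_descents_bound y m s a k s' :
  is_unit_sign s -> pieces (extremal_on (Q 1%nat) y) m s a -> descents k s' a y ->
  (s' = s -> (k <= m + 1)%nat) /\ (s' = - s -> (k <= m)%nat).
Proof.
intros Hs HP; apply descents_bound; auto.
apply (pieces_impl (strictly_decreasing_on y)); auto.
- clear s a HP Hs; intros s a b Hs H u v Hu [Huv| ->] Hv; [left; apply H; auto|].
  right; ring.
- apply extremal_strictly_decreasing; auto.
Qed.

(** On the last piece [y] is [Q 1] up to sign and an additive constant, which is 0 as both tend to
    0; the remaining tails turn [Q 1] into [Q r]. *)
Lemma final_piece c y m s :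
  slope y -> pieces (extremal_on (Q 1%nat) y) m s 0 ->
  exists X, 0 <= X /\ forall t, X <= t -> spline c y t = c + s * sg m * Q r t.
Proof.
intros Hy HP.
assert (Hlast := last_piece _ _ _ _ HP).
destruct Hlast as (X & HX & HE); exists X; split; [exact HX|].
set (sf := s * sg m) in *.
assert (Hdom := slope_dominated y Hy).
assert (HQ1 : dominated Q 1 1 (Q 1%nat)).
{ split; [apply (chain_continuous r Q HQ); lia|].
  intros t; rewrite Rabs_right; [lra|]; left; apply (chain_pos r Q HQ); lia. }
assert (Hyt : forall t, X <= t -> y t = sf * Q 1%nat t).
{ intros t Ht; apply Rminus_diag_uniq, Rabs_eq_0, Rle_antisym; [|apply Rabs_pos].
  apply le_epsilon; intros eps He.
  assert (HL : is_lim (fun u => y u - sf * Q 1%nat u) p_infty (0 - sf * 0)).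
  { apply is_lim_minus'.
    - apply (dominated_lim r Q HQ 1 0); [lia|exact Hdom].
    - apply (is_lim_scal_l (Q 1%nat) sf p_infty 0), (chain_tail r Q HQ 0); lia. }
  destruct (proj1 (is_lim_p_infty_eps _ _) HL eps He) as [Y HY].
  set (v := Rmax Y t); specialize (HY v (Rmax_l _ _)).
  assert (A := HE t v Ht (Rmax_r _ _) I).
  replace (y t - sf * Q 1%nat t) with (y v - sf * Q 1%nat v - (0 - sf * 0)) by lra; lra. }
intros t Ht; unfold spline; f_equal.
assert (D1 := itail_lincomb r Q HQ 1 1 1 (r - 1) 1 (- sf) y (Q 1%nat) ltac:(lia) Hdom HQ1 t).
assert (D2 := itail_lincomb r Q HQ 1 1 1 (r - 1) (-1) sf y (Q 1%nat) ltac:(lia) Hdom HQ1 t).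
rewrite (chain_itail r Q HQ 1 (r - 1)) in D1, D2 by lia.
replace (1 + (r - 1))%nat with r in D1, D2 by lia.
assert (N1 : 0 <= itail (r - 1) (fun t => 1 * y t + - sf * Q 1%nat t) t).
{ apply (itail_nonneg r Q HQ _ 1 (r - 1) _ X) with
    (2 := dominated_lincomb Q _ _ 1 1 (- sf) _ _ Hdom HQ1); [lia| |exact Ht].
  intros u Hu; rewrite (Hyt u Hu); right; ring. }
assert (N2 : 0 <= itail (r - 1) (fun t => -1 * y t + sf * Q 1%nat t) t).
{ apply (itail_nonneg r Q HQ _ 1 (r - 1) _ X) with
    (2 := dominated_lincomb Q _ _ 1 (-1) sf _ _ Hdom HQ1); [lia| |exact Ht].
  intros u Hu; rewrite (Hyt u Hu); right; ring. }
lra.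
Qed.

(** On a link where [s * hprod] is nonnegative the slack is the integral of [(1 - |hprod|) * Q O],
    at most the sum of the defects of the switches. Each contributes at most [4 * Q O 0 / nu], as
    [1 - switch ^ 2] is an exact derivative and a switch varies by at most 2. A link with more slack
    thus contains a point where [hprod] has sign [- s], and [S n] links give more alternations than
    [n] knots allow. *)
Lemma smooth_no_slack nu th n :
  0 < nu -> (forall i, (i < n)%nat -> 0 <= th i) ->
  ~ slack_chain (Q 1%nat) (tail (hkernel Q nu th n)) (S n) 1 0 (4 * Q O 0 / nu * INR n).
Proof.
intros Hnu Ht HS.
set (y := tail (hkernel Q nu th n)) in *; set (eta := 4 * Q O 0 / nu * INR n) in *.
assert (g0 : 0 < Q O 0) by apply HQ.
assert (HT : tail_of (hkernel Q nu th n) y)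
  by (apply (dominated_tail r Q HQ 1 0); [lia|apply (hkernel_dominated r Q HQ nu), Ht]).
set (B := fun s => - (2 * Q O 0 / nu) * fsum (fun i => switch nu (th i) s) n).
set (B' := fun s => Q O 0 * fsum (fun i => 1 - switch nu (th i) s ^ 2) n).
assert (HB : forall s, is_derive B s (B' s)).
{ intros s; unfold B, B'; clear - Hnu Ht.
  induction n as [|n IH]; cbn [fsum].
  - rewrite !Rmult_0_r; apply (is_derive_const (V := R_NormedModule)).
  - apply (is_derive_ext (fun s => - (2 * Q O 0 / nu) * fsum (fun i => switch nu (th i) s) n
              + - (2 * Q O 0 / nu) * switch nu (th n) s));
      [intros t; apply eq_sym, Rmult_plus_distr_l|].
    replace (Q O 0 * (fsum (fun i => 1 - switch nu (th i) s ^ 2) n + (1 - switch nu (th n) s ^ 2)))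
      with (Q O 0 * fsum (fun i => 1 - switch nu (th i) s ^ 2) n
            + - (2 * Q O 0 / nu) * (- (nu / 2) * (1 - switch nu (th n) s ^ 2))) by (field; lra).
    apply (is_derive_plus (V := R_NormedModule)); [apply IH; auto|].
    apply is_derive_scal, is_derive_switch; auto. }
assert (HBb : forall u v, B v - B u <= eta).
{ intros u v; unfold B, eta; replace (4 * Q O 0 / nu * INR n)
    with (2 * Q O 0 / nu * (2 * INR n)) by (field; lra).
  replace (- (2 * Q O 0 / nu) * fsum (fun i => switch nu (th i) v) n -
           - (2 * Q O 0 / nu) * fsum (fun i => switch nu (th i) u) n)
    with (2 * Q O 0 / nu * (fsum (fun i => switch nu (th i) u) n
                            - fsum (fun i => switch nu (th i) v) n)) by ring.
  apply Rmult_le_compat_l; [apply Rdiv_le_0_compat; lra|].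
  clear - Ht; induction n as [|n IH]; [simpl; lra|].
  specialize (IH ltac:(auto)); rewrite S_INR; simpl.
  assert (C := switch_abs nu (th n) u ltac:(auto)).
  assert (D := switch_abs nu (th n) v ltac:(auto)).
  apply Rabs_le_between in C; apply Rabs_le_between in D; lra. }
assert (Hh : forall s, 1 - Rabs (hprod nu th n s) <= fsum (fun i => 1 - switch nu (th i) s ^ 2) n).
{ intros s; clear - Ht; induction n as [|n IH]; [simpl; rewrite Rabs_R1; lra|].
  specialize (IH ltac:(auto)); cbn [fsum hprod]; rewrite Rabs_mult.
  assert (C := switch_abs nu (th n) s ltac:(auto)).
  assert (D := hprod_abs nu th n s ltac:(auto)).
  assert (E := Rabs_pos (switch nu (th n) s)).
  assert (F : switch nu (th n) s ^ 2 = Rabs (switch nu (th n) s) ^ 2)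
    by (rewrite RPow_abs, Rabs_right; [reflexivity|apply Rle_ge, pow2_ge_0]).
  rewrite F; set (p := Rabs (hprod nu th n s)) in *; set (f := Rabs (switch nu (th n) s)) in *.
  nra. }
assert (Hall : forall k s a, is_unit_sign s -> 0 <= a -> slack_chain (Q 1%nat) y k s a eta ->
          alternates k (- s) a (hprod nu th n)).
{ induction k as [|k IH]; intros s a Hs Ha; [trivial|]; intros (x & x' & H1 & H2 & H3 & H4).
  assert (Hex : exists t, x <= t <= x' /\ s * hprod nu th n t < 0).
  { apply NNPP; intros Hno.
    assert (Hnn : forall t, x <= t <= x' -> 0 <= s * hprod nu th n t).
    { intros t Ht'; apply Rnot_lt_le; intros C; apply Hno; exists t; auto. }
    destruct HT as [Hd _]; destruct (chain_tail r Q HQ 0 ltac:(lia)) as [Hdq _].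
    assert (A : (s * y x' - Q 1%nat x') - (s * y x - Q 1%nat x) <= B x' - B x).
    { apply (derive_increment_le (fun t => s * y t - Q 1%nat t)
               (fun t => s * - hkernel Q nu th n t - - Q O t) B B'); auto; [| |lra].
      - intros t; apply (is_derive_minus (V := R_NormedModule)); [apply is_derive_scal, Hd|apply Hdq].
      - intros t Ht'; specialize (Hnn t Ht'); specialize (Hh t).
        assert (Eabs : Rabs (hprod nu th n t) = s * hprod nu th n t).
        { rewrite <- (Rabs_right (s * hprod nu th n t)) by lra; rewrite Rabs_mult.
          replace (Rabs s) with 1; [ring|].
          destruct Hs as [-> | ->]; [rewrite Rabs_R1|rewrite Rabs_left]; lra. }
        rewrite Eabs in Hh; unfold hkernel, B'.
        replace (s * - (hprod nu th n t * Q O t) - - Q O t)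
          with (Q O t * (1 - s * hprod nu th n t)) by ring.
        assert (Ab : s * hprod nu th n t <= 1).
        { rewrite <- Eabs; apply hprod_abs, Ht. }
        apply Rmult_le_compat; auto; [left; apply HQ|lra|apply HQ; lra]. }
    specialize (HBb x x'); lra. }
  destruct Hex as (t & Ht1 & Ht2); exists t; split; [lra|split; [lra|]].
  apply (alternates_weaken _ _ x'); [lra|].
  apply IH; auto using is_unit_sign_opp; lra. }
assert (HA := Hall (S n) 1 0 (or_introl eq_refl) (Rle_refl _) HS).
apply (hprod_alternates_bound nu) in HA; auto.
assert (C := count_active_le th n); lia.
Qed.

End Limits.

(** * Limits of snakes *)

Section SnakeLimits.
Variables (r : nat) (Q : nat -> R -> R).
Hypothesis HQ : tail_chain r Q.
Hypothesis Hr : (1 <= r)%nat.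
Variables (w : nat -> R -> R) (l : nat -> R).
Hypothesis Hw : forall k, tail_weight (Q r) (w k) (l k).
Hypothesis Hper : forall k j, Nat.even k = Nat.even j -> w k = w j /\ l k = l j.

(* A perfect spline with n knots that meets the bounds of height tau alternately at the
   n + 1 points x. *)
Definition good (tau : R) (n : nat) : Prop :=
  exists c y x, slope Q y /\ pieces (extremal_on (Q 1%nat) y) n 1 0 /\ points n x /\
    below w tau (spline r c y) /\ reaches w tau n x (spline r c y).

Lemma below_limit tau G (c : R) k :
  below w tau G -> is_lim G p_infty c -> sg k * c <= tau * l k.
Proof.
intros HB HL; destruct (Hw k) as (_ & _ & _ & HLw & _).
apply (is_lim_le_loc (fun t => sg k * G t) (fun t => tau * w k t) p_infty
         (sg k * c) (tau * l k)).
- exists 0; intros t Ht; apply HB; lra.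
- apply (is_lim_scal_l G (sg k) p_infty c HL).
- apply (is_lim_scal_l (w k) tau p_infty (l k) HLw).
Qed.

(** By Assumption 3 the weight comes closer to its limit than [G] at some distant point, where [G]
    would leave the strip. *)
Lemma no_contact_at_infinity tau G X k :
  0 < tau -> below w tau G -> 0 <= X ->
  (forall t, X <= t -> sg k * G t = tau * l k + Q r t) -> False.
Proof.
intros Htau HB HX HG; destruct (Hw k) as (_ & _ & _ & _ & HA).
destruct (HA X (/ tau) ltac:(apply Rinv_0_lt_compat; lra)) as (t & Ht1 & Ht2).
specialize (HB k t ltac:(lra)); rewrite HG in HB by exact Ht1.
assert (A : tau * (w k t - l k) < tau * (/ tau * Q r t)) by (apply Rmult_lt_compat_l; lra).
replace (tau * (/ tau * Q r t)) with (Q r t) in A by (field; lra); lra.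
Qed.

(** As the weight is non-increasing, the spline cannot rise beyond its last contact; nor can it stay
    there, being eventually [c] plus or minus the strictly monotone [Q r]. *)
Lemma last_descent tau n x c y m s :
  is_unit_sign s -> slope Q y -> pieces (extremal_on (Q 1%nat) y) m s 0 -> points n x ->
  below w tau (spline r c y) -> reaches w tau n x (spline r c y) -> 0 < tau ->
  exists X, x n < X /\ 0 < sg n * (spline r c y (x n) - spline r c y X).
Proof.
intros Hs Hy HP Hx HB HR Htau.
destruct (final_piece r Q HQ Hr c y m s Hy HP) as (X & HX & Hfin).
apply NNPP; intros Hno.
assert (Hxn := points_nonneg n x n Hx (le_n _)).
assert (Hconst : forall t, x n < t -> sg n * spline r c y t = sg n * spline r c y (x n)).
{ intros t Ht.
  assert (A : sg n * (spline r c y (x n) - spline r c y t) <= 0).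
  { apply Rnot_lt_le; intros C; apply Hno; exists t; auto. }
  assert (B := HB n t ltac:(lra)); assert (C := HR n (le_n _)).
  destruct (Hw n) as (_ & Hm & _); specialize (Hm (x n) t ltac:(lra)).
  assert (D := Rmult_le_compat_l tau _ _ ltac:(lra) Hm); lra. }
set (t1 := Rmax X (x n + 1)); assert (M1 := Rmax_l X (x n + 1)); assert (M2 := Rmax_r X (x n + 1)).
fold t1 in M1, M2.
assert (E := Hconst t1 ltac:(lra)); rewrite <- (Hconst (t1 + 1) ltac:(lra)) in E.
rewrite !Hfin in E by lra.
assert (D : Q r (t1 + 1) < Q r t1).
{ replace r with (S (r - 1)) by lia; apply (chain_decreasing r Q HQ); [lia|lra]. }
assert (E' : (sg n * s * sg m) * (Q r t1 - Q r (t1 + 1)) = 0) by lra.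
apply Rmult_integral in E'; destruct E' as [E'|E']; [|lra].
destruct (sg_cases n) as [H1|H1], (sg_cases m) as [H2|H2], Hs as [H3|H3];
  rewrite H1, H2, H3 in E'; lra.
Qed.

Lemma good_descents tau n x c y m s :
  is_unit_sign s -> slope Q y -> pieces (extremal_on (Q 1%nat) y) m s 0 -> points n x ->
  below w tau (spline r c y) -> reaches w tau n x (spline r c y) -> 0 < tau ->
  descents (S n) 1 (x O) (spline r c y).
Proof.
intros Hs Hy HP Hx HB HR Htau.
destruct (last_descent tau n x c y m s) as (X & HX1 & HX2); auto.
apply (descents_from_points n x X); auto.
intros k; apply (reaches_oscillates r Q Hr w l Hw tau n x); auto.
Qed.

Lemma spline_limit n (tau c eta : nat -> R) (tau0 : R) (y : nat -> R -> R) :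
  (forall j, slope Q (y j)) ->
  (forall j, ~ slack_chain (Q 1%nat) (y j) (S n) 1 0 (eta j)) ->
  (forall j, below w (tau j) (spline r (c j) (y j))) ->
  is_lim_seq tau tau0 -> is_lim_seq eta 0 ->
  exists phi c0 y0 m s, (forall j, (j <= phi j)%nat) /\ slope Q y0 /\ is_unit_sign s /\
    pieces (extremal_on (Q 1%nat) y0) m s 0 /\
    ((m <= n)%nat /\ s = 1 \/ (m < n)%nat /\ s = - (1)) /\
    below w tau0 (spline r c0 y0) /\ is_lim_seq (fun j => c (phi j)) c0 /\
    forall eps, 0 < eps -> exists N, forall j, (N <= j)%nat -> forall t, 0 <= t ->
      Rabs (spline r (c (phi j)) (y (phi j)) t - spline r c0 y0 t) <= eps.
Proof.
intros Hy HN HB Htau Heta.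
destruct (slope_compactness r Q HQ Hr y Hy) as (phi1 & y0 & Hphi1 & Hy0 & Hconv1).
destruct (filterlim_bounded tau (ex_intro _ tau0 Htau)) as [B HBt].
assert (Hcb : forall j, Rabs (c j) <= B * (l O + l 1%nat)).
{ intros j; assert (A0 := below_limit _ _ _ 0 (HB j) (spline_lim r Q HQ Hr _ _ (Hy j))).
  assert (A1 := below_limit _ _ _ 1 (HB j) (spline_lim r Q HQ Hr _ _ (Hy j))).
  unfold sg in A0, A1; simpl in A0, A1.
  assert (L0 := limit_pos r Q w l Hw 0); assert (L1 := limit_pos r Q w l Hw 1).
  specialize (HBt j); unfold norm in HBt; simpl in HBt; unfold abs in HBt; simpl in HBt.
  assert (T := Rle_abs (tau j)).
  assert (T0 : tau j * l O <= B * l O) by (apply Rmult_le_compat_r; lra).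
  assert (T1 : tau j * l 1%nat <= B * l 1%nat) by (apply Rmult_le_compat_r; lra).
  assert (B0 : 0 <= B) by (apply Rle_trans with (2 := HBt), Rabs_pos).
  assert (0 <= B * l O) by (apply Rmult_le_pos; lra).
  assert (0 <= B * l 1%nat) by (apply Rmult_le_pos; lra).
  apply Rabs_le; lra. }
destruct (bolzano_weierstrass (fun j => c (phi1 j)) _ (fun j => Hcb (phi1 j)))
  as (phi2 & Hphi2 & _ & c0 & Hc0).
set (phi := fun j => phi1 (phi2 j)).
assert (Hphi : forall j, (j <= phi j)%nat)
  by (intros j; unfold phi; specialize (Hphi2 j); specialize (Hphi1 (phi2 j)); lia).
assert (Hconv : forall eps, 0 < eps -> exists N, forall j, (N <= j)%nat -> forall t, 0 <= t ->
          Rabs (y (phi j) t - y0 t) <= eps).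
{ intros eps He; destruct (Hconv1 eps He) as [N H]; exists N; intros j Hj.
  apply H; specialize (Hphi2 j); lia. }
assert (Hunif : forall eps, 0 < eps -> exists N, forall j, (N <= j)%nat -> forall t, 0 <= t ->
      Rabs (spline r (c (phi j)) (y (phi j)) t - spline r c0 y0 t) <= eps).
{ intros eps He; destruct (spline_close r Q HQ Hr eps He) as (d & Hd & H).
  destruct (Hconv d Hd) as [N1 H1].
  assert (A := Hc0); apply is_lim_seq_spec in A; destruct (A (mkposreal d Hd)) as [N2 H2].
  exists (max N1 N2); intros j Hj; apply H; auto.
  - apply Rlt_le, H2; lia.
  - apply H1; lia. }
assert (HNS : ~ slack_chain (Q 1%nat) y0 (S n) 1 0 0).
{ intros HS; destruct (slack_chain_stable _ _ _ _ _ (or_introl eq_refl) HS) as (e & He & H).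
  destruct (Hconv e He) as [N1 H1].
  assert (A := is_lim_seq_extract _ _ _ Hphi Heta); apply is_lim_seq_spec in A.
  destruct (A (mkposreal e He)) as [N2 H2]; simpl in H2.
  set (j := max N1 N2); apply (HN (phi j)), H.
  - intros t Ht; apply (H1 j); [unfold j; lia|exact Ht].
  - specialize (H2 j ltac:(unfold j; lia)); rewrite Rminus_0_r in H2.
    apply Rlt_le, Rle_lt_trans with (2 := H2), Rle_abs. }
destruct (no_slack_pieces _ _ _ _ _ (proj1 Hy0) (chain_continuous r Q HQ 1 ltac:(lia))
            (or_introl eq_refl) HNS) as (m & s & HP & Hms).
exists phi, c0, y0, m, s; split; [exact Hphi|split; [exact Hy0|split]].
{ destruct Hms as [[_ ->]|[_ ->]]; [left|right]; lra. }
split; [exact HP|split; [exact Hms|split; [|split; [exact Hc0|exact Hunif]]]].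
intros k t Ht.
enough (A : Rbar_le (sg k * spline r c0 y0 t) (tau0 * w k t)) by exact A.
apply (is_lim_seq_le (fun j => sg k * spline r (c (phi j)) (y (phi j)) t)
         (fun j => tau (phi j) * w k t)).
- intros j; apply HB, Ht.
- apply (is_lim_seq_scal_l _ (sg k) (spline r c0 y0 t)).
  apply is_lim_seq_spec; intros eps.
  destruct (Hunif (eps / 2)) as [N H]; [generalize (cond_pos eps); lra|].
  exists N; intros j Hj; specialize (H j Hj t Ht); generalize (cond_pos eps); lra.
- apply (is_lim_seq_scal_r (fun j => tau (phi j)) (w k t) tau0).
  apply is_lim_seq_extract; auto.
Qed.

(** If all contacts stay bounded they pass to the limit, and [n + 1] descents force exactly [n]
    knots. Otherwise only the last one escapes, since two successive escapes would put [c] on both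
    bounds. Then [c] is on the bound of parity [n], and [n] knots would carry the spline across it
    far out; so a knot disappears with the contact. *)
Lemma snake_limit_fixed n (tau c eta : nat -> R) (tau0 : R) (y : nat -> R -> R)
  (x : nat -> nat -> R) :
  (forall j, slope Q (y j)) ->
  (forall j, ~ slack_chain (Q 1%nat) (y j) (S n) 1 0 (eta j)) ->
  (forall j, below w (tau j) (spline r (c j) (y j))) ->
  (forall j, points n (x j)) ->
  (forall j, reaches w (tau j) n (x j) (spline r (c j) (y j))) ->
  (forall j, 0 < tau j) -> 0 < tau0 -> is_lim_seq tau tau0 -> is_lim_seq eta 0 ->
  exists m, (m <= n)%nat /\ good tau0 m.
Proof.
intros Hy HN HB Hx HR Htau Htau0 Hlt Heta.
destruct (spline_limit n tau c eta tau0 y Hy HN HB Hlt Heta)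
  as (phi & c0 & y0 & m & s & Hphi & Hy0 & Hs & HP & Hms & HB0 & Hc0 & Hunif).
set (G := spline r c0 y0) in *.
assert (Hlw := limit_pos r Q w l Hw).
destruct (diagonal_extraction (fun j k => if Nat.leb k n then exp (- x (phi j) k) else 0)
            (fun _ => 1)) as (psi & Hpsi & Hlim).
{ intros j k; destruct (Nat.leb_spec k n); [|rewrite Rabs_R0; lra].
  assert (A := points_nonneg n (x (phi j)) k (Hx _) ltac:(lia)).
  rewrite Rabs_right by (left; apply exp_pos); rewrite <- exp_0.
  destruct A as [A|<-]; [left; apply exp_increasing; lra|right; f_equal; ring]. }
set (chi := fun j => phi (psi j)).
assert (Hchi : forall j, (j <= chi j)%nat)
  by (intros j; unfold chi; specialize (Hpsi j); specialize (Hphi (psi j)); lia).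
destruct (functional_choice _ Hlim) as [L HL0]; clear Hlim.
assert (HL : forall k, (k <= n)%nat -> is_lim_seq (fun j => exp (- x (chi j) k)) (L k)).
{ intros k Hk; apply (is_lim_seq_ext (fun j => if (k <=? n)%nat
      then exp (- x (phi (psi j)) k) else 0)); [|apply HL0].
  intros j; destruct (Nat.leb_spec k n); [reflexivity|lia]. }
clear HL0.
assert (Hun : forall eps, 0 < eps -> exists N, forall j, (N <= j)%nat -> forall t, 0 <= t ->
      Rabs (spline r (c (chi j)) (y (chi j)) t - G t) <= eps).
{ intros eps He; destruct (Hunif eps He) as [N H]; exists N; intros j Hj.
  apply H; specialize (Hpsi j); lia. }
assert (Htc : is_lim_seq (fun j => tau (chi j)) tau0) by (apply is_lim_seq_extract; auto).
(* The values at the k-th contacts converge to v as soon as G does along them. *)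
assert (Hval : forall k (v : R), (k <= n)%nat -> is_lim_seq (fun j => G (x (chi j) k)) v ->
   is_lim_seq (fun j => spline r (c (chi j)) (y (chi j)) (x (chi j) k)) v).
{ intros k v Hk Hv.
  apply (is_lim_seq_ext (fun j => (spline r (c (chi j)) (y (chi j)) (x (chi j) k)
           - G (x (chi j) k)) + G (x (chi j) k))); [intros; ring|].
  replace (Finite v) with (Finite (0 + v)) by (f_equal; ring).
  apply is_lim_seq_plus'; [|exact Hv].
  apply is_lim_seq_spec; intros eps.
  destruct (Hun (eps / 2)) as [N H]; [generalize (cond_pos eps); lra|].
  exists N; intros j Hj; rewrite Rminus_0_r.
  specialize (H j Hj _ (points_nonneg n (x (chi j)) k (Hx _) Hk)).
  generalize (cond_pos eps); lra. }
assert (HGlim : is_lim G p_infty c0) by apply (spline_lim r Q HQ Hr _ _ Hy0).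
assert (Hinf : forall k, (k <= n)%nat -> L k = 0 -> tau0 * l k <= sg k * c0).
{ intros k Hk E.
  assert (Hv : is_lim_seq (fun j => G (x (chi j) k)) c0).
  { apply is_lim_seq_spec; intros eps.
    destruct (proj1 (is_lim_p_infty_eps _ _) HGlim eps (cond_pos eps)) as [X HX].
    specialize (HL k Hk); rewrite E in HL; apply is_lim_seq_spec in HL.
    destruct (HL (mkposreal _ (exp_pos (- X)))) as [N H]; exists N; intros j Hj.
    specialize (H j Hj); simpl in H; rewrite Rminus_0_r in H.
    apply HX, Rnot_lt_le; intros C.
    assert (exp (- X) < exp (- x (chi j) k)) by (apply exp_increasing; lra).
    rewrite Rabs_right in H; [lra|left; apply exp_pos]. }
  enough (A : Rbar_le (tau0 * l k) (sg k * c0)) by exact A.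
  apply (is_lim_seq_le (fun j => tau (chi j) * l k)
           (fun j => sg k * spline r (c (chi j)) (y (chi j)) (x (chi j) k))).
  - intros j; apply Rle_trans with (2 := HR (chi j) k Hk).
    apply Rmult_le_compat_l; [apply Rlt_le, Htau|apply (weight_ge r Q w l Hw)].
  - apply (is_lim_seq_scal_r _ (l k) tau0), Htc.
  - apply (is_lim_seq_scal_l _ (sg k) c0), Hval; auto. }
assert (HLpos : forall k, (k <= n)%nat -> 0 <= L k).
{ intros k Hk; apply (is_lim_seq_le (fun _ => 0) (fun j => exp (- x (chi j) k)) 0 (L k)).
  - intros j; left; apply exp_pos.
  - apply is_lim_seq_const.
  - apply HL, Hk. }
assert (HLdec : forall k k', (k <= k')%nat -> (k' <= n)%nat -> L k' <= L k).
{ intros k k' Hkk Hk'; apply (is_lim_seq_le (fun j => exp (- x (chi j) k'))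
    (fun j => exp (- x (chi j) k)) (L k') (L k)).
  - intros j; destruct (points_le n (x (chi j)) k k' (Hx _) Hkk Hk') as [A| ->]; [|lra].
    left; apply exp_increasing; lra.
  - apply HL; lia.
  - apply HL; lia. }
set (X := fun k => - ln (L k)).
assert (HX : forall k, (k <= n)%nat -> 0 < L k -> is_lim_seq (fun j => x (chi j) k) (X k)).
{ intros k Hk HLk; apply (is_lim_seq_ext (fun j => - ln (exp (- x (chi j) k)))).
  - intros j; rewrite ln_exp; ring.
  - apply (is_lim_seq_opp (fun j => ln (exp (- x (chi j) k))) (ln (L k))).
    apply (is_lim_seq_continuous ln (fun j => exp (- x (chi j) k))); [|apply HL, Hk].
    apply continuity_pt_filterlim, (ex_derive_continuous (V := R_NormedModule)).
    eexists; apply is_derive_ln, HLk. }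
assert (HRX : forall k, (k <= n)%nat -> 0 < L k -> tau0 * w k (X k) <= sg k * G (X k)).
{ intros k Hk HLk; specialize (HX k Hk HLk).
  enough (A : Rbar_le (tau0 * w k (X k)) (sg k * G (X k))) by exact A.
  apply (is_lim_seq_le (fun j => tau (chi j) * w k (x (chi j) k))
           (fun j => sg k * spline r (c (chi j)) (y (chi j)) (x (chi j) k))).
  - intros j; apply (HR (chi j) k Hk).
  - apply (is_lim_seq_mult' _ _ tau0 (w k (X k)) Htc).
    apply (is_lim_seq_continuous (w k)); [|exact HX].
    apply continuity_pt_filterlim, Hw.
  - apply (is_lim_seq_scal_l _ (sg k) (G (X k))), Hval; [exact Hk|].
    apply (is_lim_seq_continuous G); [|exact HX].
    apply continuity_pt_filterlim, (spline_continuous r Q HQ Hr), Hy0. }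
assert (Hpts : forall n', (n' <= n)%nat -> 0 < L n' ->
          points n' X /\ reaches w tau0 n' X G).
{ intros n' Hn' HLn'.
  assert (HLk : forall k, (k <= n')%nat -> 0 < L k)
    by (intros k Hk; apply Rlt_le_trans with (1 := HLn'), HLdec; lia).
  assert (HRn : reaches w tau0 n' X G) by (intros k Hk; apply HRX; [lia|auto]).
  split; [split|exact HRn].
  - apply (is_lim_seq_le (fun _ => 0) (fun j => x (chi j) O) 0 (X O)).
    + intros j; apply Hx.
    + apply is_lim_seq_const.
    + apply HX; [lia|apply HLk; lia].
  - intros i Hi.
    assert (Hle : X i <= X (S i)).
    { apply (is_lim_seq_le (fun j => x (chi j) i) (fun j => x (chi j) (S i)) (X i) (X (S i))).
      - intros j; apply Rlt_le, (Hx (chi j)); lia.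
      - apply HX; [lia|apply HLk; lia].
      - apply HX; [lia|apply HLk; lia]. }
    destruct Hle as [Hle|Hle]; [exact Hle|exfalso].
    assert (A := reaches_oscillates r Q Hr w l Hw tau0 n' X G i Htau0 HRn Hi).
    rewrite Hle in A; lra. }
destruct (HLpos n (le_n _)) as [HLn|HLn].
- destruct (Hpts n (le_n _) HLn) as [Hp HRn].
  assert (HD := good_descents tau0 n X c0 y0 m s Hs Hy0 HP Hp HB0 HRn Htau0).
  apply (descents_weaken _ _ _ 0) in HD; [|apply Hp].
  apply (spline_descents r Q HQ Hr) in HD; [|exact Hy0].
  destruct (extremal_descents_bound r Q HQ Hr y0 m s 0 (S n) 1 Hs HP HD) as [B1 B2].
  assert (m = n /\ s = 1) as [-> ->].
  { destruct Hms as [[Hm ->]|[Hm ->]].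
    - specialize (B1 eq_refl); split; [lia|reflexivity].
    - specialize (B2 ltac:(ring)); lia. }
  exists n; split; [lia|]; exists c0, y0, X; auto.
- assert (HC := Hinf n (le_n _) (eq_sym HLn)).
  assert (HC' := below_limit _ _ _ n HB0 HGlim).
  destruct (final_piece r Q HQ Hr c0 y0 m s Hy0 HP) as (X0 & HX0 & Hfin).
  assert (Hno : m = n -> s = 1 -> False).
  { intros -> ->; apply (no_contact_at_infinity tau0 G X0 n Htau0 HB0 HX0).
    intros t Ht; unfold G; rewrite Hfin by exact Ht.
    rewrite Rmult_plus_distr_l, Rmult_1_l, <- Rmult_assoc, sg_sq; lra. }
  destruct n as [|n].
  { exfalso; apply Hno; destruct Hms as [[Hm E]|[Hm E]]; auto; lia. }
  assert (HLn' : 0 < L n).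
  { destruct (HLpos n ltac:(lia)) as [H|H]; [exact H|exfalso].
    assert (A := Hinf n ltac:(lia) (eq_sym H)); rewrite sg_S in HC.
    assert (B := Rmult_lt_0_compat _ _ Htau0 (Hlw n)).
    assert (D := Rmult_lt_0_compat _ _ Htau0 (Hlw (S n))); lra. }
  destruct (Hpts n ltac:(lia) HLn') as [Hp HRn].
  assert (HD : descents (S n) 1 0 G).
  { apply (descents_of_points_lim n X c0); auto.
    - intros k; apply (reaches_oscillates r Q Hr w l Hw tau0 n); auto.
    - assert (A := HRn n (le_n _)); rewrite sg_S in HC.
      assert (B := Rmult_lt_0_compat _ _ Htau0 (weight_pos r Q w l Hw n (X n))).
      assert (D := Rmult_lt_0_compat _ _ Htau0 (Hlw (S n))); lra. }
  apply (spline_descents r Q HQ Hr) in HD; [|exact Hy0].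
  destruct (extremal_descents_bound r Q HQ Hr y0 m s 0 (S n) 1 Hs HP HD) as [B1 B2].
  assert (m = n /\ s = 1) as [-> ->].
  { destruct Hms as [[Hm ->]|[Hm ->]].
    - specialize (B1 eq_refl); split; [|reflexivity].
      destruct (Nat.eq_dec m (S n)) as [E|E]; [exfalso; auto|lia].
    - specialize (B2 ltac:(ring)); lia. }
  exists n; split; [lia|]; exists c0, y0, X; auto.
Qed.

Lemma snake_limit N (n : nat -> nat) (tau c eta : nat -> R) (tau0 : R) (y : nat -> R -> R)
  (x : nat -> nat -> R) :
  (forall j, (n j <= N)%nat) ->
  (forall j, slope Q (y j)) ->
  (forall j, ~ slack_chain (Q 1%nat) (y j) (S (n j)) 1 0 (eta j)) ->
  (forall j, below w (tau j) (spline r (c j) (y j))) ->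
  (forall j, points (n j) (x j)) ->
  (forall j, reaches w (tau j) (n j) (x j) (spline r (c j) (y j))) ->
  (forall j, 0 < tau j) -> 0 < tau0 -> is_lim_seq tau tau0 -> is_lim_seq eta 0 ->
  exists m, (m <= N)%nat /\ good tau0 m.
Proof.
intros HnN Hy HN HB Hx HR Htau Htau0 Hlt Heta.
destruct (bounded_constant_subsequence n N HnN) as (nn & f & Hnn & Hf & E).
destruct (snake_limit_fixed nn (fun j => tau (f j)) (fun j => c (f j)) (fun j => eta (f j)) tau0
            (fun j => y (f j)) (fun j => x (f j))) as (m & Hm & Hg); auto.
- intros j; rewrite <- (E j); auto.
- intros j; rewrite <- (E j); auto.
- intros j; rewrite <- (E j); auto.
- apply is_lim_seq_extract; auto.
- apply is_lim_seq_extract; auto.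
- exists m; split; [lia|exact Hg].
Qed.

Lemma hkernel_slope nu th n :
  (forall i, (i < n)%nat -> 0 <= th i) -> slope Q (tail (hkernel Q nu th n)).
Proof.
intros Ht; assert (HK := hkernel_dominated r Q HQ nu th n Ht).
destruct (dominated_tail r Q HQ 1 0 _ ltac:(lia) HK) as [HT [_ Hb]]; split.
- intros u v Huv; rewrite <- (Rmult_1_l (Q 1%nat u - Q 1%nat v)).
  apply (tail_increment (hkernel Q nu th n) _ (Q O) _ 1); auto.
  + apply HQ; lia.
  + apply HK.
- intros t; rewrite <- (Rmult_1_l (Q 1%nat t)); apply Hb.
Qed.

(** Smoothed snakes with [nu = j + 1]: their number of contacts is bounded independently of [j], and
    the slack left by the smoothing tends to 0. *)
Lemma good_exists tau : 0 < tau -> exists n, good tau n.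
Proof.
intros Htau.
assert (Hs : forall j : nat, smooth_snake r Q w (INR j + 1) tau).
{ intros j; apply (smooth_snake_exists r Q HQ Hr w l Hw Hper); auto.
  generalize (pos_INR j); lra. }
destruct (functional_choice _ Hs) as [n Hn]; destruct (functional_choice _ Hn) as [c Hc].
destruct (functional_choice _ Hc) as [th Hth]; destruct (functional_choice _ Hth) as [x Hx]; clear Hs Hn Hc Hth.
set (m := tau * Rmin (l O) (l 1%nat)).
assert (Hm : 0 < m).
{ apply Rmult_lt_0_compat; [exact Htau|apply Rmin_glb_lt; apply (limit_pos r Q w l Hw)]. }
destruct (INR_unbounded (Q r 0 / m)) as [N HN].
assert (Ht0 : forall j i, (i < n j)%nat -> 0 <= th j i) by (intros j i Hi; apply (Hx j), Hi).
assert (HnN : forall j, (n j <= N)%nat).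
{ intros j; destruct (Hx j) as (H1 & H2 & _ & H4).
  assert (A := chain_increment_points r Q HQ Hr w l Hw Hper tau (n j) (x j) _ Htau H2 H4
    (fun u v => smooth_increment r Q HQ Hr _ (th j) (n j) (c j) u v (Ht0 j))).
  fold m in A; apply INR_le, Rlt_le, Rle_lt_trans with (2 := HN).
  apply Rmult_le_reg_r with m; [exact Hm|].
  replace (Q r 0 / m * m) with (Q r 0) by (field; lra); exact A. }
assert (E : forall j, smooth r Q (INR j + 1) (th j) (n j) (c j)
                      = spline r (c j) (tail (hkernel Q (INR j + 1) (th j) (n j)))).
{ intros j; apply functional_extensionality; intros t; unfold smooth, spline.
  rewrite <- itail_S; replace (S (r - 1)) with r by lia; reflexivity. }
assert (Hpos : forall j : nat, 0 < INR j + 1) by (intros j; generalize (pos_INR j); lra).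
destruct (snake_limit N n (fun _ => tau) c (fun j => 4 * Q O 0 / (INR j + 1) * INR N) tau
  (fun j => tail (hkernel Q (INR j + 1) (th j) (n j))) x) as (k & _ & Hk); auto.
- intros j; apply hkernel_slope, Ht0.
- intros j HS; apply (smooth_no_slack r Q HQ Hr (INR j + 1) (th j) (n j) (Hpos j) (Ht0 j)).
  apply (slack_chain_weaken _ _ _ _ _ (4 * Q O 0 / (INR j + 1) * INR N)); [|exact HS].
  apply Rmult_le_compat_l; [|apply le_INR, HnN].
  apply Rdiv_le_0_compat; [|apply Hpos]; assert (A := Q0_pos r Q HQ 0); lra.
- intros j; rewrite <- E; apply Hx.
- intros j; apply Hx.
- intros j; rewrite <- E; apply Hx.
- apply is_lim_seq_const.
- apply (is_lim_seq_ext (fun j => 4 * Q O 0 * INR N * / (INR j + 1))).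
  { intros j; field; specialize (Hpos j); lra. }
  replace (Finite 0) with (Rbar_mult (4 * Q O 0 * INR N) 0) by (simpl; f_equal; ring).
  apply (is_lim_seq_scal_l (fun j => / (INR j + 1))), is_lim_seq_inv_succ.
- exists k; exact Hk.
Qed.

End SnakeLimits.

(** * Comparison and thresholds *)

Lemma slack_chain_start (q y : R -> R) k s a b eta :
  b <= a -> slack_chain q y k s a eta -> slack_chain q y k s b eta.
Proof.
destruct k; [trivial|]; intros Hb (x & x' & H1 & H2); exists x, x'; split; [lra|exact H2].
Qed.

Lemma slack_chain_shorten (q y : R -> R) k k' s a eta :
  (k' <= k)%nat -> slack_chain q y k s a eta -> slack_chain q y k' s a eta.
Proof.
revert k s a; induction k' as [|k' IH]; intros k s a Hk; [intros; exact I|].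
destruct k as [|k]; [lia|]; intros (x & x' & H1 & H2 & H3 & H4).
exists x, x'; repeat split; auto; apply (IH k); [lia|exact H4].
Qed.

(** A link with slack and with the sign of the current piece must end beyond that piece, so the
    links use up the pieces. *)
Lemma pieces_no_slack (q y : R -> R) m s a :
  is_unit_sign s -> pieces (extremal_on q y) m s a -> ~ slack_chain q y (S m) s a 0.
Proof.
intros Hs; assert (Hss : s * s = 1) by (destruct Hs as [-> | ->]; ring).
revert s a Hs Hss; induction m as [|m IH]; intros s a Hs Hss.
- intros HP (x & x' & H1 & H2 & H3 & _).
  specialize (HP x x' H1 ltac:(lra) I); rewrite HP, <- Rmult_assoc, Hss in H3; lra.
- intros (b & Hb & HP & HPs) (x & x' & H1 & H2 & H3 & H4).
  assert (Hbx : b < x').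
  { apply Rnot_le_lt; intros C; specialize (HP x x' H1 ltac:(lra) C).
    rewrite HP, <- Rmult_assoc, Hss in H3; lra. }
  apply (IH (- s) b); auto using is_unit_sign_opp; [lra|].
  apply (slack_chain_start _ _ _ _ x'); [lra|exact H4].
Qed.

Section Thresholds.
Variables (r : nat) (Q : nat -> R -> R).
Hypothesis HQ : tail_chain r Q.
Hypothesis Hr : (1 <= r)%nat.
Variables (w : nat -> R -> R) (l : nat -> R).
Hypothesis Hw : forall k, tail_weight (Q r) (w k) (l k).
Hypothesis Hper : forall k j, Nat.even k = Nat.even j -> w k = w j /\ l k = l j.

Lemma spline_increment c y u v :
  slope Q y -> u <= v -> Rabs (spline r c y u - spline r c y v) <= Q r u - Q r v.
Proof.
intros Hy Huv; assert (D := slope_dominated r Q HQ Hr y Hy).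
unfold spline; replace (c + itail (r - 1) y u - (c + itail (r - 1) y v))
  with (itail (r - 1) y u - itail (r - 1) y v) by ring.
destruct r as [|[|r']] eqn:E; [lia|apply Hy, Huv|].
replace (S (S r') - 1)%nat with (S r') by lia.
rewrite <- (Rmult_1_l (Q (S (S r')) u - Q (S (S r')) v)).
apply (tail_increment (itail r' y) _ (Q (S r')) _ 1); auto.
- rewrite <- E in *; apply (itail_tail r Q HQ 1 1); [lia|exact D].
- rewrite <- E in *; rewrite E; apply (chain_tail r Q HQ); lia.
- rewrite <- E in *; apply (dominated_itail r Q HQ 1 1 r'); [lia|exact D].
Qed.

Lemma comparison tau tau' n' c y m :
  tau < tau' -> good r Q w tau' n' -> slope Q y -> pieces (extremal_on (Q 1%nat) y) m 1 0 ->
  below w tau (spline r c y) -> (n' <= m)%nat.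
Proof.
intros Htt (c' & y' & x & Hy' & _ & Hx & _ & HR) Hy HP HB.
assert (D := slope_dominated r Q HQ Hr y Hy); assert (D' := slope_dominated r Q HQ Hr y' Hy').
apply (difference_descents_bound (Q 1%nat) y' y m 1 0); auto; [apply Hy'|left; auto|].
apply (descents_ext _ _ _ (fun t => 1 * y' t + -1 * y t)); [intros; ring|].
apply (descents_itail r Q HQ _ 0 (r - 1) _ _ _ _ (c' - c)) with
  (2 := dominated_lincomb Q _ _ 1 1 (-1) _ _ D' D); [lia|].
apply (descents_ext _ _ _ (fun t => spline r c' y' t - spline r c y t)).
{ intros u v _ _; rewrite !(itail_lincomb r Q HQ 1 1 1 (r - 1) 1 (-1) y' y ltac:(lia) D' D).
  unfold spline; ring. }
apply (descents_weaken _ _ (x O)); [apply Hx|].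
(* The strict inequality of the heights makes the difference alternate strictly at the contacts of
   the higher snake. *)
assert (Hd : forall k, (k <= n')%nat ->
  0 < sg k * (spline r c' y' (x k) - spline r c y (x k))).
{ intros k Hk; assert (A := HR k Hk); assert (B := HB k (x k) (points_nonneg n' x k Hx Hk)).
  assert (C := Rmult_lt_compat_r _ _ _ (weight_pos r Q w l Hw k (x k)) Htt); lra. }
apply descents_between_points; [exact Hx|]; intros k Hk.
assert (A := Hd k ltac:(lia)); assert (B := Hd (S k) Hk); rewrite sg_S in B; lra.
Qed.

(** At most [n] knots rather than exactly [n]: this makes the condition monotone in [n] and [tau],
    and stable under limits that lose a knot. *)
Definition admits_snake (n : nat) (tau : R) : Prop :=
  0 < tau /\ exists m, (m <= n)%nat /\ good r Q w tau m.

Lemma admits_snake_up n tau tau' :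
  tau < tau' -> admits_snake n tau -> admits_snake n tau'.
Proof.
intros Htt (Ht & m & Hm & c & y & x & Hy & HP & _ & HB & _); split; [lra|].
destruct (good_exists r Q HQ Hr w l Hw Hper tau' ltac:(lra)) as [n' Hn'].
exists n'; split; [|exact Hn'].
apply Nat.le_trans with (2 := Hm), (comparison tau tau' n' c y m); auto.
Qed.

(** At height [(Q r 0 + 1) / m] the variation of the spline suffices for a single contact only, by
    [chain_increment_points]. *)
Lemma admits_snake_large n : exists tau, admits_snake n tau.
Proof.
set (m := Rmin (l O) (l 1%nat)).
assert (Hm : 0 < m) by (apply Rmin_glb_lt; apply (limit_pos r Q w l Hw)).
assert (HQ0 := chain_pos r Q HQ r (le_n _) 0).
set (tau := (Q r 0 + 1) / m).
assert (Ht : 0 < tau) by (apply Rdiv_lt_0_compat; lra).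
destruct (good_exists r Q HQ Hr w l Hw Hper tau Ht) as [n' Hg].
exists tau; split; [exact Ht|exists n'; split; [|exact Hg]].
destruct Hg as (c & y & x & Hy & _ & Hx & _ & HR).
assert (A := chain_increment_points r Q HQ Hr w l Hw Hper tau n' x _ Ht Hx HR
  (fun u v => spline_increment c y u v Hy)).
fold m in A; replace (tau * m) with (Q r 0 + 1) in A by (unfold tau; field; lra).
destruct n' as [|n']; [lia|exfalso].
rewrite S_INR in A; assert (B := pos_INR n').
assert (0 <= INR n' * (Q r 0 + 1)) by (apply Rmult_le_pos; lra); lra.
Qed.

(** Otherwise some limit of splines with at most [n] knots would vanish on the half-line, although
    it is eventually [c] plus or minus [Q r]. *)
Lemma admits_snake_small n : exists tau0, 0 < tau0 /\ forall tau, admits_snake n tau -> tau0 <= tau.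
Proof.
apply NNPP; intros Hno.
assert (H : forall j : nat, exists tau, tau < / (INR j + 1) /\ admits_snake n tau).
{ intros j; apply NNPP; intros Hj; apply Hno; exists (/ (INR j + 1)).
  split; [apply Rinv_0_lt_compat; generalize (pos_INR j); lra|].
  intros tau Ht; apply Rnot_lt_le; intros C; apply Hj; exists tau; auto. }
destruct (functional_choice _ H) as [tau Ht].
assert (H' : forall j, exists p : R * (R -> R), slope Q (snd p) /\
   ~ slack_chain (Q 1%nat) (snd p) (S n) 1 0 0 /\ below w (tau j) (spline r (fst p) (snd p))).
{ intros j; destruct (Ht j) as (_ & _ & m & Hm & c & y & x & Hy & HP & _ & HB & _).
  exists (c, y); split; [exact Hy|split; [|exact HB]]; intros HS.
  apply (pieces_no_slack (Q 1%nat) y m 1 0 (or_introl eq_refl) HP).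
  apply (slack_chain_shorten _ _ (S n)); [lia|exact HS]. }
destruct (functional_choice _ H') as [p Hp].
destruct (spline_limit r Q HQ Hr w l Hw n tau (fun j => fst (p j)) (fun _ => 0) 0
            (fun j => snd (p j)))
  as (_ & c0 & y0 & m & s & _ & Hy0 & Hs & HP & _ & HB & _).
- intros j; apply Hp.
- intros j; apply Hp.
- intros j; apply Hp.
- apply (is_lim_seq_le_le (fun _ => 0) _ (fun j => / (INR j + 1))); [| |apply is_lim_seq_inv_succ].
  + intros j; destruct (Ht j) as (H1 & H2 & _); lra.
  + apply is_lim_seq_const.
- apply is_lim_seq_const.
- assert (Hz : forall t, 0 <= t -> spline r c0 y0 t = 0).
  { intros t Ht0; assert (A := HB 0%nat t Ht0); assert (B := HB 1%nat t Ht0).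
    unfold sg in A, B; simpl in A, B; lra. }
  destruct (final_piece r Q HQ Hr c0 y0 m s Hy0 HP) as (X & HX & Hfin).
  assert (A := Hfin X ltac:(lra)); assert (B := Hfin (X + 1) ltac:(lra)).
  rewrite Hz in A, B by lra.
  assert (C : Q r (X + 1) < Q r X).
  { replace r with (S (r - 1)) by lia; apply (chain_decreasing r Q HQ); [lia|lra]. }
  assert (E' : (s * sg m) * (Q r X - Q r (X + 1)) = 0) by lra.
  apply Rmult_integral in E'; destruct E' as [E'|E']; [|lra].
  destruct (sg_cases m) as [H2|H2], Hs as [H3|H3]; rewrite H2, H3 in E'; lra.
Qed.

Lemma admits_snake_closed n tau0 :
  0 < tau0 -> (forall tau, tau0 < tau -> admits_snake n tau) -> admits_snake n tau0.
Proof.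
intros Ht0 H; split; [exact Ht0|].
set (tau := fun j : nat => tau0 + / (INR j + 1)).
assert (Hpos : forall j : nat, 0 < / (INR j + 1)).
{ intros j; apply Rinv_0_lt_compat; generalize (pos_INR j); lra. }
assert (Hgood : forall j, exists m, (m <= n)%nat /\ good r Q w (tau j) m).
{ intros j; apply H; unfold tau; specialize (Hpos j); lra. }
destruct (functional_choice _ Hgood) as [m Hm].
destruct (functional_choice (fun j c => exists y x, _) (fun j => proj2 (Hm j))) as [c Hc].
destruct (functional_choice _ Hc) as [y Hy]; destruct (functional_choice _ Hy) as [x Hx].
apply (snake_limit r Q HQ Hr w l Hw n m tau c (fun _ => 0) tau0 y x).
- intros j; apply Hm.
- intros j; apply (Hx j).
- intros j; apply pieces_no_slack; [left; auto|apply (Hx j)].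
- intros j; apply (Hx j).
- intros j; apply (Hx j).
- intros j; apply (Hx j).
- intros j; unfold tau; specialize (Hpos j); lra.
- exact Ht0.
- unfold tau; replace (Finite tau0) with (Finite (tau0 + 0)) by (f_equal; ring).
  apply is_lim_seq_plus'; [apply is_lim_seq_const|apply is_lim_seq_inv_succ].
- apply is_lim_seq_const.
Qed.

(** [b n] is the infimum of an upward closed set that contains it, obtained as a least upper bound
    of negatives. It tends to 0 because at every positive height there is a snake with some number
    of knots. *)
Lemma thresholds :
  exists b : nat -> R, (forall n, 0 < b n) /\ (forall n, b (S n) <= b n) /\ is_lim_seq b 0 /\
    forall n tau, b n <= tau <-> admits_snake n tau.
Proof.
assert (Hb : forall n, exists b, 0 < b /\ forall tau, b <= tau <-> admits_snake n tau).
{ intros n; destruct (admits_snake_small n) as (t0 & Ht0 & Hlow).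
  destruct (completeness (fun z => admits_snake n (- z))) as [m [Hub Hlub]].
  { exists 0; intros z [Hz _]; lra. }
  { destruct (admits_snake_large n) as [tau Ht]; exists (- tau).
    rewrite Ropp_involutive; exact Ht. }
  assert (Hm : t0 <= - m).
  { enough (m <= - t0) by lra; apply Hlub; intros z Hz; specialize (Hlow _ Hz); lra. }
  assert (Hup : forall tau, - m < tau -> admits_snake n tau).
  { intros tau Ht; apply NNPP; intros Hno.
    enough (m <= - tau) by lra; apply Hlub; intros z Hz.
    apply Rnot_lt_le; intros C; apply Hno; apply (admits_snake_up n (- z)); auto; lra. }
  exists (- m); split; [lra|]; intros tau; split.
  - intros [Ht|<-]; [auto|]; apply admits_snake_closed; [lra|exact Hup].
  - intros Ht; enough (- tau <= m) by lra; apply Hub; rewrite Ropp_involutive; exact Ht. }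
destruct (functional_choice _ Hb) as [b Hb']; exists b.
split; [intros n; apply Hb'|split; [|split; [|intros n; apply Hb']]].
- intros n; apply Hb'; destruct (proj1 (proj2 (Hb' n) (b n)) (Rle_refl _)) as (H1 & m & H2 & H3).
  split; [exact H1|exists m; split; [lia|exact H3]].
- apply is_lim_seq_spec; intros eps.
  assert (He : 0 < eps / 2) by (generalize (cond_pos eps); lra).
  destruct (good_exists r Q HQ Hr w l Hw Hper _ He) as [N HN].
  exists N; intros n Hn; rewrite Rminus_0_r.
  assert (A : b n <= eps / 2) by (apply Hb'; split; [exact He|exists N; auto]).
  rewrite Rabs_right; [lra|apply Rle_ge, Rlt_le, Hb'].
Qed.

Lemma threshold_exact (b : nat -> R) n tau :
  (forall n tau, b n <= tau <-> admits_snake n tau) -> b n <= tau ->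
  (forall m, n = S m -> tau < b m) -> good r Q w tau n.
Proof.
intros Hb Hn Hm; destruct (proj1 (Hb n tau) Hn) as (Ht & m & Hmn & Hg).
destruct (Nat.eq_dec m n) as [<-|Hne]; [exact Hg|exfalso].
destruct n as [|n]; [lia|].
assert (b n <= tau) by (apply Hb; split; [exact Ht|exists m; split; [lia|exact Hg]]).
specialize (Hm n eq_refl); lra.
Qed.

End Thresholds.

(** * Derivatives on the half-line *)

(** [filterdiff] quantifies over all limits of the filter; for the filter of [is_derive_half] this
    leaves [t] alone. *)
Lemma half_line_filter_lim (t t' : R) :
  0 <= t -> is_filter_lim (within half_line (locally t)) t' -> t' = t.
Proof.
intros Ht HF; apply NNPP; intros Hne.
assert (Hp : 0 < Rabs (t - t')) by (apply Rabs_pos_lt; lra).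
destruct (HF (fun u => Rabs (u - t') < Rabs (t - t'))) as [d Hd].
{ exists (mkposreal _ Hp); intros u Hu; exact Hu. }
specialize (Hd t (ball_center t d) Ht); lra.
Qed.

Lemma is_derive_half_eps (x : R -> R) (t l : R) :
  0 <= t ->
  (is_derive_half x t l <->
   forall eps, 0 < eps -> exists d, 0 < d /\ forall u, 0 <= u -> Rabs (u - t) < d ->
     Rabs (x u - x t - l * (u - t)) <= eps * Rabs (u - t)).
Proof.
intros Ht; split.
- intros [_ H] eps He.
  assert (HF : is_filter_lim (within half_line (locally t)) t).
  { intros P HP; unfold within; apply (filter_imp P); auto. }
  destruct (H t HF (mkposreal eps He)) as [d Hd].
  exists d; split; [apply cond_pos|]; intros u Hu Hut.
  specialize (Hd u Hut Hu).
  unfold norm, minus, plus, opp, scal in Hd; simpl in Hd.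
  unfold abs, mult in Hd; simpl in Hd.
  replace (x u - x t - l * (u - t)) with (x u + - x t + - ((u + - t) * l)) by ring.
  exact Hd.
- intros H; split; [apply (is_linear_scal_l (K := R_AbsRing) (V := R_NormedModule) l)|].
  intros t' HF; rewrite (half_line_filter_lim t t' Ht HF).
  intros eps; destruct (H eps (cond_pos eps)) as (d & Hd & Hd').
  exists (mkposreal d Hd); intros u Hut Hu; specialize (Hd' u Hu Hut).
  unfold norm, minus, plus, opp, scal; simpl.
  unfold abs, mult; simpl.
  replace (x u + - x t + - ((u + - t) * l)) with (x u - x t - l * (u - t)) by ring.
  exact Hd'.
Qed.

Lemma is_derive_half_of_is_derive (x : R -> R) (t l : R) :
  0 <= t -> is_derive x t l -> is_derive_half x t l.
Proof.
intros Ht [H1 H2]; split; [exact H1|]; intros t' HF eps.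
rewrite (half_line_filter_lim t t' Ht HF).
specialize (H2 t (fun P HP => HP) eps).
unfold within; revert H2; apply filter_imp; auto.
Qed.

Lemma is_derive_half_interior (x : R -> R) (t l : R) :
  0 < t -> is_derive_half x t l -> is_derive x t l.
Proof.
intros Ht H; split; [apply (is_linear_scal_l (K := R_AbsRing) (V := R_NormedModule) l)|].
intros t' HF eps.
rewrite <- (is_filter_lim_locally_unique (K := R_AbsRing) (V := R_NormedModule) t t' HF).
destruct (proj1 (is_derive_half_eps x t l ltac:(lra)) H eps (cond_pos eps)) as (d & Hd & Hd').
assert (Hm : 0 < Rmin d t) by (apply Rmin_glb_lt; lra).
exists (mkposreal _ Hm); intros u Hu.
change (Rabs (u - t) < Rmin d t) in Hu.
assert (A := Rmin_l d t); assert (B := Rmin_r d t).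
assert (C := Rabs_def2 _ _ Hu).
specialize (Hd' u ltac:(lra) ltac:(lra)).
unfold norm, minus, plus, opp, scal; simpl; unfold abs, mult; simpl.
replace (x u + - x t + - ((u + - t) * l)) with (x u - x t - l * (u - t)) by ring.
exact Hd'.
Qed.

Lemma is_derive_half_lincomb (x x' : R -> R) (k t l l' : R) :
  0 <= t -> is_derive_half x t l -> is_derive_half x' t l' ->
  is_derive_half (fun t => x t + k * x' t) t (l + k * l').
Proof.
intros Ht H H'; apply is_derive_half_eps; [exact Ht|]; intros eps He.
assert (Hk := Rabs_pos k).
set (e := eps / (1 + Rabs k)).
assert (He' : 0 < e) by (apply Rdiv_lt_0_compat; lra).
destruct (proj1 (is_derive_half_eps _ _ _ Ht) H e He') as (d & Hd & D).
destruct (proj1 (is_derive_half_eps _ _ _ Ht) H' e He') as (d' & Hd' & D').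
exists (Rmin d d'); split; [apply Rmin_glb_lt; lra|]; intros u Hu Hut.
assert (A := Rmin_l d d'); assert (B := Rmin_r d d').
specialize (D u Hu ltac:(lra)); specialize (D' u Hu ltac:(lra)).
replace (x u + k * x' u - (x t + k * x' t) - (l + k * l') * (u - t))
  with ((x u - x t - l * (u - t)) + k * (x' u - x' t - l' * (u - t))) by ring.
apply Rle_trans with (1 := Rabs_triang _ _); rewrite Rabs_mult.
apply (Rmult_le_compat_l (Rabs k)) in D'; [|exact Hk].
replace (eps * Rabs (u - t)) with (e * Rabs (u - t) + Rabs k * (e * Rabs (u - t)))
  by (unfold e; field; lra); lra.
Qed.

Lemma is_derive_n_half_lincomb s (x x' y y' : R -> R) k :
  is_derive_n_half s x y -> is_derive_n_half s x' y' ->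
  is_derive_n_half s (fun t => x t + k * x' t) (fun t => y t + k * y' t).
Proof.
revert y y'; induction s as [|s IH]; intros y y'; simpl.
- intros H H' t Ht; rewrite H, H' by exact Ht; reflexivity.
- intros (z & Hz & H) (z' & Hz' & H'); exists (fun t => z t + k * z' t).
  split; [auto|]; intros t Ht; apply is_derive_half_lincomb; auto.
Qed.

Lemma is_derive_n_half_ext s (x y y' : R -> R) :
  (forall t, 0 <= t -> y t = y' t) -> is_derive_n_half s x y -> is_derive_n_half s x y'.
Proof.
intros He; destruct s as [|s]; simpl.
- intros H t Ht; rewrite <- He; auto.
- intros (z & Hz & H); exists z; split; [exact Hz|].
  intros t Ht; rewrite <- He; auto.
Qed.

(** The constant continuation to the left of 0 keeps continuity, positivity and monotonicity, and
    gives access to the results on the whole line. *)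
Definition ext (f : R -> R) (t : R) : R := f (Rmax t 0).

Lemma ext_nonneg f t : 0 <= t -> ext f t = f t.
Proof. intros Ht; unfold ext; rewrite Rmax_left by exact Ht; reflexivity. Qed.

Lemma ext_continuous (f : R -> R) : continuous_on half_line f -> forall t, continuous (ext f) t.
Proof.
intros H t; apply filterlim_locally; intros eps.
assert (Ht : half_line (Rmax t 0)) by apply Rmax_r.
destruct (proj1 (filterlim_locally _ _) (H _ Ht) eps) as [d Hd].
exists d; intros u Hu; apply Hd; [|apply Rmax_r].
change (Rabs (u - t) < d) in Hu; change (Rabs (Rmax u 0 - Rmax t 0) < d).
apply Rle_lt_trans with (2 := Hu).
unfold Rmax; destruct (Rle_dec u 0), (Rle_dec t 0); unfold Rabs;
  repeat destruct (Rcase_abs _); lra.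
Qed.

Lemma continuous_on_half_line (f : R -> R) : (forall t, continuous f t) -> continuous_on half_line f.
Proof.
intros H t _; apply (filterlim_filter_le_1 _ (F := locally t)); [|apply H].
intros P; unfold within; apply filter_imp; auto.
Qed.

Lemma is_derive_half_continuous (z y : R -> R) :
  (forall t, 0 <= t -> is_derive_half z t (y t)) -> continuous_on half_line z.
Proof.
intros H t Ht; apply filterlim_locally; intros eps.
destruct (proj1 (is_derive_half_eps _ _ _ Ht) (H t Ht) 1 ltac:(lra)) as (d & Hd & D).
set (b := eps / (1 + Rabs (y t))).
assert (Hy := Rabs_pos (y t)).
assert (Hb : 0 < b) by (apply Rdiv_lt_0_compat; [apply cond_pos|lra]).
assert (Hm : 0 < Rmin d b) by (apply Rmin_glb_lt; lra).
exists (mkposreal _ Hm); intros u Hu Hu0.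
change (Rabs (u - t) < Rmin d b) in Hu; change (Rabs (z u - z t) < eps).
assert (A := Rmin_l d b); assert (B := Rmin_r d b).
specialize (D u Hu0 ltac:(lra)).
replace (z u - z t) with ((z u - z t - y t * (u - t)) + y t * (u - t)) by ring.
apply Rle_lt_trans with (1 := Rabs_triang _ _); rewrite Rabs_mult.
assert (C : (1 + Rabs (y t)) * Rabs (u - t) < (1 + Rabs (y t)) * b)
  by (apply Rmult_lt_compat_l; lra).
replace ((1 + Rabs (y t)) * b) with (pos eps) in C by (unfold b; field; lra); lra.
Qed.

Lemma half_line_mvt (z y : R -> R) a b :
  (forall t, 0 <= t -> is_derive_half z t (y t)) -> 0 <= a -> a < b ->
  exists c, a <= c <= b /\ z b - z a = y c * (b - a).
Proof.
intros H Ha Hab.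
destruct (MVT_gen (ext z) a b y) as (c & Hc & Hc').
- intros t Ht; rewrite Rmin_left, Rmax_right in Ht by lra.
  apply (is_derive_ext_loc z); [|apply is_derive_half_interior; [lra|apply H; lra]].
  assert (Ht0 : 0 < t) by lra; exists (mkposreal t Ht0); intros u Hu.
  change (Rabs (u - t) < t) in Hu; apply Rabs_def2 in Hu.
  rewrite ext_nonneg by lra; reflexivity.
- intros t _; apply continuity_pt_filterlim, ext_continuous.
  apply (is_derive_half_continuous z y), H.
- rewrite Rmin_left, Rmax_right in Hc by lra; exists c; split; [exact Hc|].
  rewrite !ext_nonneg in Hc' by lra; exact Hc'.
Qed.

(** A derivative bounded away from 0 makes the function unbounded, hence itself bounded away from 0
    far out; this climbs through all orders. *)
Lemma derive_n_half_unbounded s (x y : R -> R) sigma :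
  is_derive_n_half (S s) x y ->
  (exists X d, 0 < d /\ forall t, X <= t -> d <= sigma * y t) ->
  forall B, exists X, forall t, X <= t -> B <= sigma * x t.
Proof.
assert (K : forall z y : R -> R, (forall t, 0 <= t -> is_derive_half z t (y t)) ->
  (exists X d, 0 < d /\ forall t, X <= t -> d <= sigma * y t) ->
  forall B, exists X, 0 <= X /\ forall t, X <= t -> B <= sigma * z t).
{ clear; intros z y H (X & d & Hd & HX) B.
  set (X0 := Rmax X 0); assert (M1 := Rmax_l X 0); assert (M2 := Rmax_r X 0).
  fold X0 in M1, M2.
  set (D := Rabs (B - sigma * z X0) / d).
  assert (HD : 0 <= D) by (apply Rdiv_le_0_compat; [apply Rabs_pos|exact Hd]).
  exists (X0 + D + 1); split; [lra|]; intros t Ht.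
  destruct (half_line_mvt z y X0 t H M2 ltac:(lra)) as (c & Hc & E).
  specialize (HX c ltac:(lra)).
  assert (A : d * (t - X0) <= (sigma * y c) * (t - X0)) by (apply Rmult_le_compat_r; lra).
  assert (C : d * D <= d * (t - X0)) by (apply Rmult_le_compat_l; lra).
  replace (d * D) with (Rabs (B - sigma * z X0)) in C by (unfold D; field; lra).
  assert (F := Rle_abs (B - sigma * z X0)).
  replace ((sigma * y c) * (t - X0)) with (sigma * (z t - z X0)) in A by (rewrite E; ring); lra. }
revert y; induction s as [|s IH]; intros y (z & Hz & H) Hy B.
- destruct (K z y H Hy B) as (X & HX & HB); exists X; intros t Ht.
  rewrite <- (Hz t) by lra; apply HB, Ht.
- apply (IH z Hz); destruct (K z y H Hy 1) as (X & HX & H1).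
  exists X, 1; split; [lra|exact H1].
Qed.

(** A nonzero top derivative would make [x] unbounded; so it is 0, and the derivative one order
    lower is constant. *)
Lemma bounded_primitive_constant s (x : R -> R) (L B : R) :
  is_derive_n_half s x (fun _ => L) -> (forall t, 0 <= t -> Rabs (x t) <= B) ->
  forall t, 0 <= t -> x t = x 0.
Proof.
revert L; induction s as [|s IH]; intros L Hx HB.
- intros t Ht; simpl in Hx; rewrite <- (Hx t Ht), <- (Hx 0); [reflexivity|lra].
- assert (L0 : L = 0).
  { apply NNPP; intros HL.
    set (sigma := sign L).
    assert (Hs : 0 < sigma * L /\ is_unit_sign sigma).
    { unfold sigma; destruct (Rdichotomy _ _ HL) as [N|P].
      - rewrite sign_eq_m1 by exact N; split; [lra|right; lra].
      - rewrite sign_eq_1 by exact P; split; [lra|left; lra]. }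
    destruct (derive_n_half_unbounded s x (fun _ => L) sigma Hx) with (B := B + 1) as [X HX].
    { exists 0, (sigma * L); split; [apply Hs|intros; lra]. }
    specialize (HX (Rmax X 0) (Rmax_l _ _)); specialize (HB (Rmax X 0) (Rmax_r _ _)).
    assert (A := unit_sign_abs sigma (x (Rmax X 0)) (proj2 Hs)); lra. }
  destruct Hx as (z & Hz & H).
  apply (IH (z 0)); [|exact HB].
  apply (is_derive_n_half_ext s x z); [|exact Hz].
  intros t [Ht|<-]; [|reflexivity].
  destruct (half_line_mvt z (fun _ => L) 0 t H ltac:(lra) Ht) as (c & _ & E).
  rewrite L0 in E; lra.
Qed.

(** * Perfect splines *)

Lemma itail_add i j z : itail (i + j) z = itail i (itail j z).
Proof. induction i as [|i IH]; [reflexivity|]; simpl; rewrite IH; reflexivity. Qed.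

Lemma strictly_decreasing_weakly phi s a b :
  strictly_decreasing_on phi s a b -> weakly_decreasing_on phi s a b.
Proof.
intros H u v Hu [Huv| ->] Hv; [left; apply H; auto|right; ring].
Qed.

(** A full set of [S n] descents after [x] leaves [x] no place but the first piece, where [phi]
    decreases. This transfers the sign of a spline from its first contact to 0. *)
Lemma descents_start_above (phi : R -> R) n a x :
  pieces (strictly_decreasing_on phi) n 1 a -> a <= x -> descents (S n) 1 x phi ->
  phi x <= phi a.
Proof.
intros HP Hax HD; destruct n as [|n].
- destruct Hax as [Hax| ->]; [|lra].
  specialize (HP a x ltac:(lra) Hax I); lra.
- destruct HP as (b & Hb & HP & HPs).
  destruct (Rle_dec x b) as [Hxb|Hxb].
  + destruct Hax as [Hax| ->]; [|lra].
    specialize (HP a x ltac:(lra) Hax Hxb); lra.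
  + exfalso.
    apply (descents_weaken _ _ _ b) in HD; [|lra].
    destruct (descents_bound phi n (- (1)) b (S (S n)) 1) as [_ B]; auto.
    * right; ring.
    * apply (pieces_impl (strictly_decreasing_on phi)); [right; ring| |exact HPs].
      intros; apply strictly_decreasing_weakly; auto.
    * specialize (B ltac:(ring)); lia.
Qed.

Lemma pieces_piecewise_monotone (phi x : R -> R) n eps k :
  is_unit_sign eps -> continuous_on half_line x ->
  (forall t, 0 <= t -> x t = eps * phi t + k) ->
  pieces (strictly_decreasing_on phi) n 1 0 -> piecewise_monotone (n + 1) x.
Proof.
intros He Hc Hx HP; split; [exact Hc|].
destruct (pieces_subdivision _ _ _ _ HP) as (t & T0 & T1 & HT).
exists eps, t; split; [exact He|split].
- rewrite Nat.add_1_r; split; [exact T0|split; [exact T1|]].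
  intros i Hi; apply HT; lia.
(* [piecewise_monotone] counts from 1 and [pieces] from 0: decreasing with sign [(-1) ^ i] is
   increasing with sign [(-1) ^ S i]. *)
- intros i u v Hi Hu Huv Hv; destruct i as [|i]; [lia|].
  replace (S i - 1)%nat with i in Hu by lia.
  destruct (HT i ltac:(lia)) as (F & _ & HS).
  assert (Hiu : t i <= u) by (rewrite <- F in Hu; apply Rlt_le, Hu).
  assert (H0 : 0 <= t i).
  { enough (E : forall j, (j <= i)%nat -> 0 <= t j) by (apply E; lia).
    induction j as [|j IH]; intros Hj; [rewrite T0; simpl; lra|].
    destruct (HT j ltac:(lia)) as (F1 & L & _); destruct (HT (S j) ltac:(lia)) as (F2 & _).
    rewrite <- F1, <- F2 in L; simpl in L; specialize (IH ltac:(lia)); lra. }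
  specialize (HS u v Hiu Huv (Rbar_lt_le _ _ Hv)).
  rewrite !Hx by lra; simpl.
  replace (eps * (-1 * (-1) ^ i) * (eps * phi u + k))
    with ((eps * eps) * (- (1 * (-1) ^ i) * phi u) + eps * (-1 * (-1) ^ i) * k) by ring.
  replace (eps * (-1 * (-1) ^ i) * (eps * phi v + k))
    with ((eps * eps) * (- (1 * (-1) ^ i) * phi v) + eps * (-1 * (-1) ^ i) * k) by ring.
  replace (eps * eps) with 1 by (destruct He as [-> | ->]; ring); lra.
Qed.

Lemma pieces_sgn_derivative (phi x : R -> R) n eps k :
  is_unit_sign eps -> (forall t, 0 <= t -> x t = eps * phi t + k) ->
  pieces (strictly_decreasing_on phi) n 1 0 -> sgn_derivative x 0 (- eps).
Proof.
intros He Hx HP; destruct (first_piece _ _ _ _ HP) as (b & Hb & HS).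
assert (Hd : exists d : posreal, Rbar_le d b).
{ destruct b as [b| |]; [exists (mkposreal b Hb); simpl; lra|exists (mkposreal 1 Rlt_0_1)|]; easy. }
destruct Hd as [d Hd]; exists d.
assert (HS' : forall u v, 0 <= u -> u < v -> v < 0 + d -> phi v < phi u).
{ intros u v Hu Huv Hv.
  assert (A := HS u v Hu Huv); rewrite Rmult_1_l in A.
  enough (0 < phi u - phi v) by lra; apply A, Rbar_le_trans with d; [simpl; lra|exact Hd]. }
destruct He as [-> | ->]; [right|left]; (split; [lra|]);
  intros u v Hu _ Huv Hv; rewrite !Hx by lra; specialize (HS' u v Hu Huv Hv); lra.
Qed.

Section Properties.
Variables (r : nat) (Q : nat -> R -> R).
Hypothesis HQ : tail_chain r Q.
Hypothesis Hr : (1 <= r)%nat.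
Variable g : R -> R.
Hypothesis Hg : forall t, 0 <= t -> Q O t = g t.

(** The derivative of order [s]: each differentiation undoes a tail with a change of sign, the first
    one also removes [c]. *)
Definition spline_derivative (e c : R) (y : R -> R) (s : nat) (t : R) : R :=
  e * sg s * itail (r - 1 - s) y t + match s with O => e * c | _ => 0 end.

Lemma spline_derivative_n e c y s :
  slope Q y -> (s < r)%nat ->
  is_derive_n_half s (fun t => e * spline r c y t) (spline_derivative e c y s).
Proof.
intros Hy; assert (HD := slope_dominated r Q HQ Hr y Hy).
induction s as [|s IH]; intros Hs.
- intros t _; unfold spline_derivative, spline, sg; simpl; rewrite Nat.sub_0_r; ring.
- exists (spline_derivative e c y s); split; [apply IH; lia|].
  intros t Ht; apply is_derive_half_of_is_derive; [exact Ht|].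
  unfold spline_derivative at 2.
  replace (e * sg (S s) * itail (r - 1 - S s) y t + 0)
    with (e * sg s * - itail (r - 1 - S s) y t + 0) by (rewrite sg_S; ring).
  apply (is_derive_plus (V := R_NormedModule)); [|apply (is_derive_const (V := R_NormedModule))].
  apply is_derive_scal.
  replace (r - 1 - s)%nat with (S (r - 1 - S s)) by lia.
  apply (itail_tail r Q HQ 1 1); [lia|exact HD].
Qed.

Lemma spline_derivative_continuous e c y s :
  slope Q y -> (s < r)%nat -> continuous_on half_line (spline_derivative e c y s).
Proof.
intros Hy Hs; apply continuous_on_half_line; intros t.
apply continuous_Rplus; [|apply continuous_const].
apply continuous_Rmult; [apply continuous_const|].
apply (dominated_itail r Q HQ 1 1); [lia|apply (slope_dominated r Q HQ Hr), Hy].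
Qed.

Lemma spline_perfect e c y n :
  is_unit_sign e -> slope Q y -> pieces (extremal_on (Q 1%nat) y) n 1 0 ->
  perfect_spline r g n (fun t => e * spline r c y t).
Proof.
intros He Hy HP; exists (spline_derivative e c y (r - 1)).
split; [apply spline_derivative_n; [exact Hy|lia]|].
split; [apply spline_derivative_continuous; [exact Hy|lia]|].
destruct (pieces_subdivision _ _ _ _ HP) as (t & T0 & T1 & HT).
(* [r - 1] signs come from the tails undone, one more from the derivative [- Q O] of [Q 1]. *)
exists (e * sg r), t; split.
{ destruct He as [-> | ->], (sg_cases r) as [-> | ->]; [left|right|right|left]; ring. }
split; [split; [exact T0|split; [exact T1|intros i Hi; apply HT; lia]]|].
intros i u Hi Hu1 Hu2; destruct (HT i Hi) as (F & _ & HE).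
assert (H0 : forall j, (j <= n)%nat -> 0 <= t j).
{ induction j as [|j IH]; intros Hj; [rewrite T0; simpl; lra|].
  destruct (HT j ltac:(lia)) as (F1 & L & _); destruct (HT (S j) ltac:(lia)) as (F2 & _).
  rewrite <- F1, <- F2 in L; simpl in L; specialize (IH ltac:(lia)); lra. }
specialize (H0 i Hi); rewrite <- F in Hu1; simpl in Hu1.
replace (r - 1 - (r - 1))%nat with O by lia.
assert (Hloc : locally u (fun v => y u - (1 * (-1) ^ i) * (Q 1%nat u - Q 1%nat v) = y v)).
{ assert (L1 : locally u (fun v => t i < v)) by apply (open_gt (t i) u Hu1).
  assert (L2 : locally u (fun v => Rbar_lt v (t (S i)))) by apply (open_Rbar_lt (t (S i)) u Hu2).
  generalize (filter_and _ _ L1 L2); apply filter_imp; intros v [Hv1 Hv2].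
  destruct (Rle_dec u v) as [Huv|Huv].
  - assert (A := HE u v ltac:(lra) Huv (Rbar_lt_le _ _ Hv2)); lra.
  - assert (A := HE v u ltac:(lra) ltac:(lra) (Rbar_lt_le _ _ Hu2)); lra. }
apply (is_derive_ext_loc (fun v => e * sg (r - 1) * (y u - (1 * (-1) ^ i) * (Q 1%nat u - Q 1%nat v))
   + match (r - 1)%nat with O => e * c | _ => 0 end)).
{ revert Hloc; apply filter_imp; intros v Hv; unfold spline_derivative.
  replace (r - 1 - (r - 1))%nat with O by lia; simpl; rewrite Hv; reflexivity. }
replace (e * sg r * (-1) ^ i * g u)
  with (e * sg (r - 1) * (0 - (1 * (-1) ^ i) * (0 - - Q O u)) + 0).
2: { rewrite Hg by lra; replace r with (S (r - 1)) at 2 by lia; rewrite sg_S; ring. }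
apply (is_derive_plus (V := R_NormedModule)); [|apply (is_derive_const (V := R_NormedModule))].
apply is_derive_scal.
apply (is_derive_minus (V := R_NormedModule)); [apply (is_derive_const (V := R_NormedModule))|].
apply is_derive_scal.
apply (is_derive_minus (V := R_NormedModule)); [apply (is_derive_const (V := R_NormedModule))|].
apply (chain_tail r Q HQ 0); lia.
Qed.

(** Induction from [y] upwards with [strict_pieces_tail]; the alternations it asks for are brought
    down from the descents of the whole spline. *)
Lemma itail_strict_pieces c y n i :
  slope Q y -> pieces (extremal_on (Q 1%nat) y) n 1 0 ->
  descents (S n) 1 0 (spline r c y) -> (i < r)%nat ->
  pieces (strictly_decreasing_on (itail i y)) n 1 0.
Proof.
intros Hy HP HD; assert (Hdom := slope_dominated r Q HQ Hr y Hy).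
induction i as [|i IH]; intros Hi.
- apply (extremal_strictly_decreasing r Q HQ Hr); auto; left; auto.
- apply (strict_pieces_tail (itail i y)).
  + apply (dominated_itail r Q HQ 1 1); [lia|exact Hdom].
  + apply (dominated_lim r Q HQ 1 i); [lia|].
    apply (dominated_itail r Q HQ 1 1); [lia|exact Hdom].
  + apply (itail_tail r Q HQ 1 1); [lia|exact Hdom].
  + left; reflexivity.
  + apply (descents_alternates _ (itail (S i) y)).
    * apply (itail_tail r Q HQ 1 1); [lia|exact Hdom].
    * apply (descents_itail r Q HQ 1 (S i) (r - 1 - S i) _ _ _ _ c); [lia| |].
      -- apply (dominated_itail r Q HQ 1 1); [lia|exact Hdom].
      -- rewrite <- itail_add; replace (r - 1 - S i + S i)%nat with (r - 1)%nat by lia.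
         exact HD.
  + apply IH; lia.
Qed.

Lemma spline_monotone e c y n s :
  is_unit_sign e -> slope Q y -> pieces (extremal_on (Q 1%nat) y) n 1 0 ->
  descents (S n) 1 0 (spline r c y) -> (s < r)%nat ->
  derivative_piecewise_monotone (n + 1) s (fun t => e * spline r c y t).
Proof.
intros He Hy HP HD Hs; exists (spline_derivative e c y s).
split; [apply spline_derivative_n; auto|].
apply (pieces_piecewise_monotone (itail (r - 1 - s) y) _ n (e * sg s)
         match s with O => e * c | _ => 0 end).
- destruct He as [-> | ->], (sg_cases s) as [-> | ->]; [left|right|right|left]; ring.
- apply spline_derivative_continuous; auto.
- reflexivity.
- apply (itail_strict_pieces c); auto; lia.
Qed.

(** For [s >= 1] the sign is that of the first monotone piece of the derivative of order [s - 1].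
    For [s = 0] the spline is at 0 no smaller than at [x], where it is positive. *)
Lemma spline_signs e c y n x s :
  is_unit_sign e -> slope Q y -> pieces (extremal_on (Q 1%nat) y) n 1 0 -> 0 <= x ->
  descents (S n) 1 x (spline r c y) -> 0 < spline r c y x -> (s <= r)%nat ->
  sgn_derivative_n_at_0 s (fun t => e * spline r c y t) (e * (-1) ^ s).
Proof.
intros He Hy HP Hx HD Hpos Hs.
assert (HD0 := descents_weaken _ _ _ 0 _ Hx HD).
destruct s as [|s]; simpl.
- assert (HP' : pieces (strictly_decreasing_on (spline r c y)) n 1 0).
  { apply (pieces_impl (strictly_decreasing_on (itail (r - 1) y))).
    - left; reflexivity.
    - intros s a b _ H u v Hu Huv Hv; specialize (H u v Hu Huv Hv); unfold spline.
      replace (c + itail (r - 1) y u - (c + itail (r - 1) y v))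
        with (itail (r - 1) y u - itail (r - 1) y v) by ring; exact H.
    - apply (itail_strict_pieces c); auto; lia. }
  assert (A := descents_start_above _ n 0 x HP' Hx HD).
  destruct He as [-> | ->].
  + rewrite sign_eq_1; lra.
  + rewrite sign_eq_m1; lra.
- exists (spline_derivative e c y s); split; [apply spline_derivative_n; auto|].
  replace (e * (-1 * (-1) ^ s)) with (- (e * sg s)) by (unfold sg; ring).
  apply (pieces_sgn_derivative (itail (r - 1 - s) y) _ n (e * sg s)
         match s with O => e * c | _ => 0 end).
  + destruct He as [-> | ->], (sg_cases s) as [-> | ->]; [left|right|right|left]; ring.
  + reflexivity.
  + apply (itail_strict_pieces c); auto; lia.
Qed.

End Properties.

Lemma pieces_extremal_affine (q y y' : R -> R) m s a k d :
  (forall t, a <= t -> y' t = k * y t + d) ->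
  pieces (extremal_on q y) m s a -> pieces (extremal_on q y') m (k * s) a.
Proof.
revert s a; induction m as [|m IH]; intros s a He.
- intros H u v Hu Huv Hv; specialize (H u v Hu Huv Hv).
  rewrite !He, Rmult_assoc, <- H by lra; ring.
- intros (b & Hb & H & HP); exists b; split; [exact Hb|split].
  + intros u v Hu Huv Hv; specialize (H u v Hu Huv Hv).
    rewrite !He, Rmult_assoc, <- H by lra; ring.
  + replace (- (k * s)) with (k * - s) by ring.
    apply IH; [intros; apply He; lra|exact HP].
Qed.

Lemma pieces_contracted (q y : R -> R) m s a :
  (forall u v, u <= v -> q v <= q u) -> is_unit_sign s -> pieces (extremal_on q y) m s a ->
  forall u v, a <= u -> u <= v -> Rabs (y u - y v) <= q u - q v.
Proof.
intros Hq; assert (K : forall s a b u v, is_unit_sign s -> extremal_on q y s a b ->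
  a <= u -> u <= v -> Rbar_le v b -> Rabs (y u - y v) <= q u - q v).
{ intros s' a' b u v Hs H Hu Huv Hv; rewrite (H u v Hu Huv Hv); specialize (Hq u v Huv).
  rewrite Rabs_mult, (Rabs_right (q u - q v)) by lra.
  replace (Rabs s') with 1; [lra|].
  destruct Hs as [-> | ->]; [rewrite Rabs_R1|rewrite Rabs_left]; lra. }
revert s a; induction m as [|m IH]; intros s a Hs HP u v Hu Huv.
- apply (K s a p_infty); simpl; auto.
- destruct HP as (b & Hb & HE & HP).
  assert (HI := IH (- s) b (is_unit_sign_opp s Hs) HP).
  destruct (Rle_dec v b) as [Hvb|Hvb]; [apply (K s a b); auto|].
  destruct (Rle_dec b u) as [Hbu|Hbu]; [apply HI; lra|].
  replace (y u - y v) with ((y u - y b) + (y b - y v)) by ring.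
  apply Rle_trans with (1 := Rabs_triang _ _).
  assert (A := K s a b u b Hs HE Hu ltac:(lra) ltac:(simpl; lra)).
  assert (B := HI b v ltac:(lra) ltac:(lra)); lra.
Qed.

(** * Bounded perfect splines as iterated tails *)

Section Decode.
Variables (r : nat) (Q : nat -> R -> R).
Hypothesis HQ : tail_chain r Q.
Hypothesis Hr : (1 <= r)%nat.
Variable g : R -> R.
Hypothesis Hg : forall t, 0 <= t -> Q O t = g t.

(** On the [i]-th interval [y + eps * (-1) ^ i * Q 1] has derivative 0, and continuity extends its
    constancy to the knots. The sign is [- eps] because [Q 1] has derivative [- g]. *)
Lemma subdivision_extremal_pieces (y : R -> R) m (eps : R) (t : nat -> Rbar) :
  continuous_on half_line y -> Defs.subdivision (S m) t ->
  (forall (i : nat) (u : R), (i <= m)%nat -> Rbar_lt (t i) u -> Rbar_lt u (t (S i)) ->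
     is_derive y u (eps * (-1) ^ i * g u)) ->
  pieces (extremal_on (Q 1%nat) y) m (- eps) 0.
Proof.
intros Hc (T0 & T1 & HT) Hd.
assert (HF : forall i, (i <= m)%nat -> is_finite (t i) /\ 0 <= t i).
{ induction i as [|i IH]; intros Hi; [rewrite T0; split; [reflexivity|simpl; lra]|].
  destruct (IH ltac:(lia)) as [F H]; assert (L1 := HT i ltac:(lia)).
  assert (L2 := HT (S i) ltac:(lia)); rewrite <- F in L1.
  destruct (t (S i)) as [x| |]; simpl in L1; [|destruct (t (S (S i))); easy|easy].
  split; [reflexivity|simpl; lra]. }
apply (subdivision_pieces _ m _ 0 t T0 T1); [intros; apply HT; lia|].
intros i Hi u v Hu [Huv| ->] Hv; [|ring].
destruct (HF i Hi) as [F H0].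
destruct (MVT_gen (fun x => ext y x + eps * (-1) ^ i * Q 1%nat x) u v (fun _ => 0))
  as (c & _ & E).
- intros x Hx; rewrite Rmin_left, Rmax_right in Hx by lra.
  assert (Hx1 : Rbar_lt (t i) x) by (rewrite <- F; simpl; lra).
  assert (Hx2 : Rbar_lt x (t (S i))) by (apply Rbar_lt_le_trans with v; [simpl; lra|exact Hv]).
  replace 0 with (eps * (-1) ^ i * g x + eps * (-1) ^ i * - Q O x)
    by (rewrite Hg by lra; ring).
  apply (is_derive_plus (V := R_NormedModule)).
  + apply (is_derive_ext_loc y); [|apply Hd; auto].
    assert (L : locally x (fun z => 0 < z)) by (apply (open_gt 0 x); lra).
    revert L; apply filter_imp; intros z Hz; rewrite ext_nonneg by lra; reflexivity.
  + apply is_derive_scal, (chain_tail r Q HQ 0); lia.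
- intros x _; apply continuity_pt_filterlim.
  apply (continuous_Rplus (ext y) (fun x => eps * (-1) ^ i * Q 1%nat x)); [apply ext_continuous, Hc|].
  apply (continuous_Rmult (fun _ => eps * (-1) ^ i)); [apply continuous_const|].
  apply (chain_continuous r Q HQ); lia.
- rewrite !ext_nonneg in E by lra; lra.
Qed.

(** The derivative of order [r - 1] of [F] has a limit [L] at infinity; without [L] and up to sign
    it is a slope [y]. The difference between [F] and the spline of [y] is bounded with constant
    derivative of order [r - 1], hence constant. *)
Lemma perfect_spline_decode m F B :
  perfect_spline r g m F -> (forall t, 0 <= t -> Rabs (F t) <= B) ->
  exists e c y, is_unit_sign e /\ slope Q y /\ pieces (extremal_on (Q 1%nat) y) m 1 0 /\
    forall t, 0 <= t -> F t = e * spline r c y t.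
Proof.
intros (y0 & Hy0 & Hc0 & eps & t & Heps & Ht & Hd) HB.
assert (HP0 := subdivision_extremal_pieces y0 m eps t Hc0 Ht Hd); clear Hd Ht t.
assert (HQdec : forall u v, u <= v -> Q 1%nat v <= Q 1%nat u).
{ intros u v [Huv| ->]; [left; apply (chain_decreasing r Q HQ); [lia|exact Huv]|lra]. }
assert (Hcon := pieces_contracted _ _ _ _ _ HQdec (is_unit_sign_opp _ Heps) HP0).
destruct (last_piece _ _ _ _ HP0) as (X & HX & HE).
set (sf := - eps * sg m) in *; set (L := y0 X - sf * Q 1%nat X).
assert (Hsf : is_unit_sign sf).
{ unfold sf; destruct Heps as [-> | ->], (sg_cases m) as [-> | ->]; [right|left|left|right]; ring. }
assert (HL : forall t, X <= t -> y0 t - L = sf * Q 1%nat t).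
{ intros t Ht; assert (A := HE X t ltac:(lra) Ht I); unfold L; lra. }
assert (Hbd : forall t, 0 <= t -> Rabs (y0 t - L) <= Q 1%nat t).
{ intros t Ht; set (v := Rmax t X); assert (M1 := Rmax_l t X); assert (M2 := Rmax_r t X).
  fold v in M1, M2; assert (A := Hcon t v Ht M1); assert (C := HL v M2).
  replace (y0 t - L) with ((y0 t - y0 v) + (y0 v - L)) by ring.
  apply Rle_trans with (1 := Rabs_triang _ _); rewrite C, Rabs_mult.
  assert (D := chain_pos r Q HQ 1 ltac:(lia) v); rewrite (Rabs_right (Q 1%nat v)) by lra.
  replace (Rabs sf) with 1; [lra|].
  destruct Hsf as [-> | ->]; [rewrite Rabs_R1|rewrite Rabs_left]; lra. }
assert (Hee : eps * eps = 1) by (destruct Heps as [-> | ->]; ring).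
assert (Hae : Rabs (- eps) = 1)
  by (rewrite Rabs_Ropp; destruct Heps as [-> | ->]; [apply Rabs_R1|rewrite Rabs_left; lra]).
set (y := fun t => (- eps * (y0 (Rmax t 0) - L)) + (Q 1%nat t - Q 1%nat (Rmax t 0))).
assert (Hy : slope Q y).
{ apply (slope_extend r Q HQ Hr (fun t => - eps * (y0 t - L))).
  - intros u v Hu Huv; replace (- eps * (y0 u - L) - - eps * (y0 v - L))
      with (- eps * (y0 u - y0 v)) by ring.
    rewrite Rabs_mult, Hae, Rmult_1_l; apply Hcon; auto.
  - intros t Ht; rewrite Rabs_mult, Hae, Rmult_1_l; apply Hbd, Ht. }
assert (Hyt : forall t, 0 <= t -> y t = - eps * y0 t + eps * L).
{ intros t Ht; unfold y; rewrite Rmax_left by exact Ht; ring. }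
(* [- eps] normalizes the first piece to sign 1, [sg (r - 1)] compensates the [r - 1]
   differentiations. *)
set (e := - eps * sg (r - 1)).
assert (He : is_unit_sign e).
{ unfold e; destruct Heps as [-> | ->], (sg_cases (r - 1)) as [-> | ->];
    [right|left|left|right]; ring. }
assert (Hdom := slope_dominated r Q HQ Hr y Hy).
assert (Hconst : forall t, 0 <= t ->
          F t + -1 * (e * spline r 0 y t) = F 0 + -1 * (e * spline r 0 y 0)).
{ apply (bounded_primitive_constant (r - 1) (fun t => F t + -1 * (e * spline r 0 y t)) L (B + Q r 0)).
  - apply (is_derive_n_half_ext _ _ (fun t => y0 t + -1 * spline_derivative r e 0 y (r - 1) t)).
    + intros t Ht; unfold spline_derivative; replace (r - 1 - (r - 1))%nat with O by lia.
      simpl; rewrite Hyt by exact Ht.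
      replace (match (r - 1)%nat with O => e * 0 | S _ => 0 end) with 0
        by (destruct (r - 1)%nat; ring).
      replace (e * sg (r - 1)) with (- eps)
        by (unfold e; destruct (sg_cases (r - 1)) as [-> | ->]; ring).
      replace (y0 t + -1 * (- eps * (- eps * y0 t + eps * L) + 0))
        with ((1 - eps * eps) * y0 t + (eps * eps) * L) by ring.
      rewrite Hee; ring.
    + apply is_derive_n_half_lincomb; [exact Hy0|].
      apply (spline_derivative_n r Q HQ Hr); [exact Hy|lia].
  - intros t Ht; apply Rle_trans with (1 := Rabs_triang _ _); apply Rplus_le_compat; [auto|].
    assert (A := proj2 (dominated_itail r Q HQ 1 1 (r - 1) y ltac:(lia) Hdom) t).
    replace (1 + (r - 1))%nat with r in A by lia.
    replace (-1 * (e * spline r 0 y t)) with (- e * itail (r - 1) y t) by (unfold spline; ring).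
    rewrite Rabs_mult; replace (Rabs (- e)) with 1.
    2: { rewrite Rabs_Ropp; destruct He as [-> | ->]; [rewrite Rabs_R1|rewrite Rabs_left]; lra. }
    assert (C : Q r t <= Q r 0); [|lra].
    destruct Ht as [Ht|<-]; [left|lra].
    replace r with (S (r - 1)) by lia; apply (chain_decreasing r Q HQ); [lia|exact Ht]. }
set (d := F 0 + -1 * (e * spline r 0 y 0)) in *.
exists e, (e * d), y; split; [exact He|split; [exact Hy|split]].
- replace 1 with (- eps * - eps) by lra.
  apply (pieces_extremal_affine _ y0 _ _ _ _ _ (eps * L)); [exact Hyt|exact HP0].
- intros t Ht; specialize (Hconst t Ht); unfold spline in *.
  assert (E : e * e = 1) by (destruct He as [-> | ->]; ring).
  replace (e * (e * d + itail (r - 1) y t)) with ((e * e) * d + e * itail (r - 1) y t) by ring.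
  rewrite E; lra.
Qed.

End Decode.

(** * The kernel and the weights *)

Lemma sum_n_vanish (f : nat -> R) n : (forall s, (s <= n)%nat -> f s = 0) -> sum_n f n = 0.
Proof.
intros H; induction n as [|n IH]; [rewrite sum_O; auto|].
rewrite sum_Sn, IH, H by auto; apply (plus_zero_l (G := R_AbelianMonoid)).
Qed.

Lemma sum_n_opposite (f : nat -> R) n : sum_n (fun s => -1 * f s) n = - sum_n f n :> R.
Proof.
induction n as [|n IH]; [rewrite !sum_O; ring|].
rewrite !sum_Sn, IH; unfold plus; simpl; ring.
Qed.

Lemma poly_part_0 A k : poly_part A (S k) 0 = A k.
Proof.
unfold poly_part; replace (S k - 1)%nat with k by lia.
destruct k as [|k]; [rewrite sum_O; simpl; field|].
rewrite sum_Sn, sum_n_vanish.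
- rewrite (plus_zero_l (G := R_AbelianMonoid)).
  replace (S (S k) - S k - 1)%nat with O by lia; simpl; field.
- intros s Hs; replace (S (S k) - s - 1)%nat with (S (k - s)) by lia; simpl; ring.
Qed.

(** Differentiation lowers each power by one with opposite sign, and the constant term [A k] drops
    out. *)
Lemma poly_part_derive A k t :
  is_derive (poly_part A (S k)) t (- match k with O => 0 | _ => poly_part A k t end).
Proof.
unfold poly_part; replace (S k - 1)%nat with k by lia.
destruct k as [|k].
- apply (is_derive_ext (fun _ => A O)).
  + intros u; rewrite sum_O; simpl; field.
  + replace (- 0) with 0 by ring; apply (is_derive_const (V := R_NormedModule)).
- replace (S k - 1)%nat with k by lia.
  set (f := fun s t => (-1) ^ (S (S k) - s - 1) * A s / INR (fact (S (S k) - s - 1))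
                       * t ^ (S (S k) - s - 1)).
  apply (is_derive_ext (fun u => sum_n (fun s => f s u) k + A (S k))).
  { intros u; rewrite sum_Sn; unfold f.
    replace (S (S k) - S k - 1)%nat with O by lia; change plus with Rplus; simpl; field. }
  rewrite <- (Rplus_0_r (- _)).
  apply (is_derive_plus (V := R_NormedModule)); [|apply (is_derive_const (V := R_NormedModule))].
  replace (- sum_n (fun s => (-1) ^ (S k - s - 1) * A s / INR (fact (S k - s - 1))
             * t ^ (S k - s - 1)) k)
    with (sum_n (fun s => -1 * ((-1) ^ (S k - s - 1) * A s / INR (fact (S k - s - 1))
             * t ^ (S k - s - 1))) k)
    by apply sum_n_opposite.
  apply (is_derive_sum_n (V := R_NormedModule)); intros s Hs; unfold f.
  replace (S (S k) - s - 1)%nat with (S (S k - s - 1)) by lia.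
  set (j := (S k - s - 1)%nat).
  auto_derive; [exact I|].
  change (fact j + j * fact j)%nat with (S j * fact j)%nat; rewrite mult_INR.
  change (match j with 0%nat => 1 | S _ => INR j + 1 end) with (INR (S j)).
  assert (INR (fact j) <> 0) by apply INR_fact_neq_0.
  assert (INR (S j) <> 0) by (apply not_0_INR; lia).
  field; auto.
Qed.

Lemma primitive_ext g k : forall t, 0 <= t -> Defs.primitive (ext g) k t = Defs.primitive g k t.
Proof.
induction k as [|k IH]; intros t Ht; [apply ext_nonneg, Ht|]; simpl.
apply RInt_ext; intros x Hx; rewrite Rmin_left in Hx by exact Ht; apply IH; lra.
Qed.

Lemma A_integrand_ext g A k t : 0 <= t -> A_integrand (ext g) A k t = A_integrand g A k t.
Proof.
intros Ht; destruct k; simpl; [apply ext_nonneg, Ht|].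
f_equal; f_equal; apply (primitive_ext g (S k)), Ht.
Qed.

Lemma primitive_derive (h : R -> R) k t :
  (forall t, continuous h t) ->
  continuous (Defs.primitive h k) t /\ is_derive (Defs.primitive h (S k)) t (Defs.primitive h k t).
Proof.
intros Hh; revert t; induction k as [|k IH]; intros t.
- split; [apply Hh|apply is_derive_RInt_from_0, Hh].
- assert (Hc : forall t, continuous (Defs.primitive h (S k)) t)
    by (intros u; eapply is_derive_continuous, IH).
  split; [apply Hc|apply (is_derive_RInt_from_0 (Defs.primitive h (S k))), Hc].
Qed.

Lemma A_integrand_derive (h : R -> R) A k t :
  (forall t, continuous h t) ->
  is_derive (A_integrand h A (S k)) t (- A_integrand h A k t).
Proof.
intros Hh; unfold A_integrand.
replace (- match k with O => h t | _ => poly_part A k t + (-1) ^ k * Defs.primitive h k t end)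
  with (- match k with O => 0 | _ => poly_part A k t end + (-1) ^ S k * Defs.primitive h k t)
  by (destruct k; simpl; ring).
apply (is_derive_plus (V := R_NormedModule)); [apply poly_part_derive|].
apply is_derive_scal, primitive_derive, Hh.
Qed.

Lemma A_integrand_0 h A k : A_integrand h A (S k) 0 = A k.
Proof.
unfold A_integrand; rewrite poly_part_0; simpl; rewrite RInt_point.
unfold zero; simpl; ring.
Qed.

Lemma RInt_half_lim (h : R -> R) :
  ex_RInt_half h -> is_lim (fun X => RInt h 0 X) p_infty (RInt_half h).
Proof.
intros H; apply (RInt_gen_correct (V := R_CompleteNormedModule)) in H.
apply is_lim_p_infty_eps; intros eps He.
destruct (H (fun v => Rabs (v - RInt_half h) < eps)) as [P P' HP [M HM] HPP].
{ exists (mkposreal eps He); intros v Hv; exact Hv. }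
exists (M + 1); intros t Ht.
destruct (HPP 0 t HP ltac:(apply HM; lra)) as (v & Hv & Hv').
simpl in Hv; rewrite (is_RInt_unique _ _ _ _ Hv); exact Hv'.
Qed.

(** The integrand of A_k is itself the k-fold tail of g: for [k >= 1] its derivative is minus the
    integrand before it, and its value at 0 is the whole integral of that integrand, so under
    Assumption 1 it vanishes at infinity. *)
Definition kernel_chain (g : R -> R) (k : nat) : R -> R := A_integrand (ext g) (A_coef g) k.

Lemma ext_non_increasing f : non_increasing f -> forall s t, s <= t -> ext f t <= ext f s.
Proof.
intros H s t Hst; apply H; [apply Rmax_r|apply Rmax_le_compat; lra].
Qed.

Lemma kernel_chain_tail r g : admissible_kernel r g -> tail_chain r (kernel_chain g).
Proof.
intros (Hc & Hp & Hm & HA).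
assert (Hec := ext_continuous g Hc).
split; [exact Hec|split; [intros t; apply Hp, Rmax_r|split; [apply ext_non_increasing, Hm|]]].
intros k Hk; split; [intros t; apply A_integrand_derive, Hec|].
assert (Hd : forall t, is_derive (kernel_chain g (S k)) t (- kernel_chain g k t))
  by (intros t; apply A_integrand_derive, Hec).
assert (Hcont : forall t, continuous (kernel_chain g k) t).
{ destruct k; [exact Hec|intros t; eapply is_derive_continuous, A_integrand_derive, Hec]. }
specialize (HA k Hk); apply RInt_half_lim in HA; rewrite <- A_coefE in HA.
apply (is_lim_ext_loc (fun X => A_coef g k - RInt (A_integrand g (A_coef g) k) 0 X)).
- exists 0; intros X HX.
  rewrite <- (A_integrand_0 (ext g) (A_coef g) k).
  assert (E : RInt (A_integrand g (A_coef g) k) 0 X = RInt (kernel_chain g k) 0 X).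
  { apply RInt_ext; intros x Hx; rewrite Rmin_left in Hx by lra.
    symmetry; apply A_integrand_ext; lra. }
  rewrite E.
  destruct (mvt (fun X => kernel_chain g (S k) X + RInt (kernel_chain g k) 0 X)
              (fun t => - kernel_chain g k t + kernel_chain g k t) 0 X) as (c & Hc' & _); auto.
  + intros t; apply (is_derive_plus (V := R_NormedModule)); [apply Hd|].
    apply is_derive_RInt_from_0, Hcont.
  + rewrite RInt_point in Hc'; change zero with 0 in Hc'.
    change (A_integrand (ext g) (A_coef g) (S k)) with (kernel_chain g (S k)); lra.
- replace (Finite 0) with (Finite (A_coef g k - A_coef g k)) by (f_equal; ring).
  apply is_lim_minus'; [apply is_lim_const|exact HA].
Qed.

Lemma kernel_chain_P r g t :
  (1 <= r)%nat -> 0 <= t -> P_fun r g t = (-1) ^ r * kernel_chain g r t.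
Proof.
intros Hr Ht; unfold kernel_chain; rewrite A_integrand_ext by exact Ht.
destruct r as [|r]; [lia|]; unfold P_fun, A_integrand.
assert (E : (-1) ^ S r * (-1) ^ S r = 1) by (fold (sg (S r)); destruct (sg_cases (S r)) as [-> | ->]; ring).
rewrite Rmult_plus_distr_l, <- Rmult_assoc, E; ring.
Qed.

Lemma weight_limit f : admissible_weight f -> is_lim f p_infty (at_infinity f).
Proof.
intros (_ & Hm & Hp & _).
destruct (completeness (fun z => exists t, 0 <= t /\ z = - f t)) as [m [Hub Hlub]].
{ exists 0; intros z (t & Ht & ->); specialize (Hp t Ht); lra. }
{ exists (- f 0), 0; split; [lra|reflexivity]. }
assert (HL : is_lim f p_infty (- m)).
{ apply is_lim_p_infty_eps; intros eps He.
  assert (Hex : exists t, 0 <= t /\ f t < - m + eps).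
  { apply NNPP; intros Hno; enough (m <= m - eps) by lra.
    apply Hlub; intros z (t & Ht & ->); apply Rnot_lt_le; intros C.
    apply Hno; exists t; split; [exact Ht|lra]. }
  destruct Hex as (X & HX & HX'); exists X; intros t Ht.
  assert (A := Hm X t HX Ht).
  assert (B := Hub (- f t) ltac:(exists t; split; [lra|reflexivity])).
  apply Rabs_def1; lra. }
unfold at_infinity; rewrite (is_lim_unique _ _ _ HL); exact HL.
Qed.

(** The liminf condition provides distant points where the quotient is below [eps]; by
    [kernel_chain_P] its denominator is the last member of the chain. *)
Lemma tail_weight_ext r g f :
  (1 <= r)%nat -> admissible_kernel r g -> admissible_weight f ->
  weight_kernel_condition r g f -> tail_weight (kernel_chain g r) (ext f) (at_infinity f).
Proof.
intros Hr Hg Hf Hc; assert (HL := weight_limit f Hf).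
destruct Hf as (H1 & H2 & H3 & H4).
split; [apply ext_continuous, H1|split; [apply ext_non_increasing, H2|split; [exact H4|split]]].
- apply (is_lim_ext_loc f); [|exact HL].
  exists 0; intros t Ht; rewrite ext_nonneg by lra; reflexivity.
- intros X eps He; destruct (Hc (mkposreal eps He)) as [H _].
  destruct (H (Rmax X 0)) as (t & Ht & Hlt); simpl in Hlt; rewrite Rplus_0_l in Hlt.
  assert (M1 := Rmax_l X 0); assert (M2 := Rmax_r X 0).
  exists t; split; [lra|]; rewrite ext_nonneg by lra.
  assert (HP := chain_pos r _ (kernel_chain_tail r g Hg) r (le_n _) t).
  assert (E : Rabs (P_fun r g t) = kernel_chain g r t).
  { rewrite kernel_chain_P by (auto; lra); rewrite Rabs_mult, (Rabs_right (kernel_chain g r t)) by lra.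
    fold (sg r); rewrite Rabs_sg; ring. }
  rewrite E in Hlt.
  apply (Rmult_lt_compat_r (kernel_chain g r t)) in Hlt; [|exact HP].
  unfold Rdiv in Hlt; rewrite Rmult_assoc, Rinv_l, Rmult_1_r in Hlt by lra; exact Hlt.
Qed.

(** * Snakes of either orientation *)

Section OneSign.
Variables (r : nat) (Q : nat -> R -> R).
Hypothesis HQ : tail_chain r Q.
Hypothesis Hr : (1 <= r)%nat.
Variable g : R -> R.
Hypothesis Hg : forall t, 0 <= t -> Q O t = g t.
Variables (w : nat -> R -> R) (l : nat -> R).
Hypothesis Hw : forall k, tail_weight (Q r) (w k) (l k).
Hypothesis Hper : forall k j, Nat.even k = Nat.even j -> w k = w j /\ l k = l j.

Definition snake (e : R) (n : nat) (tau : R) (G : R -> R) : Prop :=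
  perfect_spline r g n G /\ continuous_on half_line G /\
  (forall k t, 0 <= t -> sg k * (e * G t) <= tau * w k t) /\
  (exists x, points n x /\ forall k, (k <= n)%nat -> sg k * (e * G (x k)) = tau * w k (x k)) /\
  (forall s, (s < r)%nat -> derivative_piecewise_monotone (n + 1) s G) /\
  (forall s, (s <= r)%nat -> sgn_derivative_n_at_0 s G (e * (-1) ^ s)).

Lemma good_snake e n tau :
  is_unit_sign e -> 0 < tau -> good r Q w tau n -> exists G, snake e n tau G.
Proof.
intros He Ht (c & y & x & Hy & HP & Hx & HB & HR).
assert (Hee : e * e = 1) by (destruct He as [-> | ->]; ring).
assert (HD := good_descents r Q HQ Hr w l Hw tau n x c y n 1 (or_introl eq_refl) Hy HP Hx HB HR Ht).
assert (HD0 := descents_weaken _ _ _ 0 _ (proj1 Hx) HD).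
assert (Eq : forall t, e * (e * spline r c y t) = spline r c y t)
  by (intros t; rewrite <- Rmult_assoc, Hee; ring).
exists (fun t => e * spline r c y t).
split; [apply (spline_perfect r Q HQ Hr); auto|].
split; [|split; [intros k t Ht0; rewrite Eq; apply HB, Ht0|split; [|split]]].
- apply continuous_on_half_line; intros t.
  apply (continuous_Rmult (fun _ => e)); [apply continuous_const|].
  apply (spline_continuous r Q HQ Hr), Hy.
- exists x; split; [exact Hx|]; intros k Hk; rewrite Eq.
  apply Rle_antisym; [apply HB, (points_nonneg n x k Hx Hk)|apply HR, Hk].
- intros s Hs; apply (spline_monotone r Q HQ Hr); auto.
- intros s Hs; apply (spline_signs r Q HQ Hr e c y n (x O)); auto; [apply Hx|].
  assert (A := HR O ltac:(lia)); unfold sg in A; simpl in A.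
  assert (B := Rmult_lt_0_compat _ _ Ht (weight_pos r Q w l Hw 0 (x O))); lra.
Qed.

(** One choice of [G] for all heights, with the least [N] such that [b N <= tau]. At [a (S n)] it
    may have fewer than [n] knots, since thresholds may coincide and the step between them be empty.
    The last clause is the lower bound behind (c). *)
Lemma snakes e :
  is_unit_sign e ->
  exists (a : nat -> R) (G : R -> R -> R), threshold_sequence a /\
    (forall n tau, in_step a n tau -> snake e n tau (G tau)) /\
    (forall n, exists m, (m <= n)%nat /\ snake e m (a (S n)) (G (a (S n)))) /\
    (forall n m c y v, (m <= n)%nat -> slope Q y -> pieces (extremal_on (Q 1%nat) y) m 1 0 ->
       below w v (spline r c y) -> a (S n) <= v).
Proof.
intros He; destruct (thresholds r Q HQ Hr w l Hw Hper) as (b & Hb0 & Hdec & Hlim & Hb).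
assert (Hmon : forall n n', (n <= n')%nat -> b n' <= b n).
{ intros n n' H; induction H as [|n' _ IH]; [lra|]; specialize (Hdec n'); lra. }
assert (Hex : forall tau, exists G, 0 < tau ->
          exists N, b N <= tau /\ (forall n, b n <= tau -> (N <= n)%nat) /\ snake e N tau G).
{ intros tau; destruct (Rlt_dec 0 tau) as [Ht|Ht]; [|exists (fun _ => 0); intros; lra].
  destruct (good_exists r Q HQ Hr w l Hw Hper tau Ht) as [n Hn].
  assert (Hbn : b n <= tau) by (apply Hb; split; [exact Ht|exists n; auto]).
  clear Hn; assert (HN : exists N, b N <= tau /\ forall M, N = S M -> tau < b M).
  { induction n as [|n IH]; [exists O; split; [exact Hbn|discriminate]|].
    destruct (Rle_dec (b n) tau) as [H|H]; [auto|].
    exists (S n); split; [exact Hbn|]; intros M E; injection E; intros <-; lra. }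
  destruct HN as (N & HN & HM).
  destruct (good_snake e N tau He Ht (threshold_exact r Q Hr w b N tau Hb HN HM)) as [G HG].
  exists G; intros _; exists N; split; [exact HN|split; [|exact HG]].
  intros n' Hn'; destruct N as [|N]; [lia|].
  apply Nat.nlt_ge; intros C; specialize (HM N eq_refl).
  specialize (Hmon n' N ltac:(lia)); lra. }
destruct (functional_choice _ Hex) as [G HG]; clear Hex.
(* The shift gives [a (S n) = b n]. *)
exists (fun n => b (n - 1)%nat), G; split; [split; [|split]|split; [|split]].
- intros n _; apply Hb0.
- intros n _; apply Hmon; lia.
- apply is_lim_seq_incr_1; apply (is_lim_seq_ext b); [|exact Hlim].
  intros n; f_equal; lia.
- intros n tau [H1 H2]; simpl in H1; rewrite Nat.sub_0_r in H1.
  destruct (HG tau ltac:(specialize (Hb0 n); lra)) as (N & HN & HM & HS).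
  replace n with N; [exact HS|].
  apply Nat.le_antisymm; [auto|]; apply Nat.nlt_ge; intros C.
  destruct n as [|n]; [lia|]; simpl in H2; rewrite Nat.sub_0_r in H2.
  specialize (Hmon N n ltac:(lia)); lra.
- intros n; replace (S n - 1)%nat with n by lia.
  destruct (HG (b n) (Hb0 n)) as (N & _ & HM & HS).
  exists N; split; [apply HM; lra|exact HS].
- intros n m c y v Hm Hy HP HB; replace (S n - 1)%nat with n by lia.
  apply Rnot_lt_le; intros C; specialize (Hb0 n).
  (* A positive height strictly between [v] and [b n]: by [comparison] its snake has at most [n]
     knots, against the minimality of [b n]. *)
  set (tau := (Rmax v 0 + b n) / 2).
  assert (Hv : Rmax v 0 < b n) by (apply Rmax_lub_lt; lra).
  assert (M1 := Rmax_l v 0); assert (M2 := Rmax_r v 0).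
  assert (Ht : v < tau < b n /\ 0 < tau) by (unfold tau; lra).
  destruct (good_exists r Q HQ Hr w l Hw Hper tau ltac:(lra)) as [n' Hn'].
  assert (Hle := comparison r Q HQ Hr w l Hw v tau n' c y m ltac:(lra) Hn' Hy HP HB).
  assert (b n <= tau) by (apply Hb; split; [lra|exists n'; split; [lia|exact Hn']]).
  lra.
Qed.

End OneSign.

Definition alternating {T : Type} (a b : T) (k : nat) : T := if Nat.even k then a else b.

Lemma alternating_even {T : Type} (a b : T) k : Nat.Even k -> alternating a b k = a /\ sg k = 1.
Proof.
intros H; unfold alternating, sg; rewrite (proj2 (Nat.even_spec k) H).
destruct H as [j ->]; split; [reflexivity|apply pow_1_even].
Qed.

Lemma alternating_odd {T : Type} (a b : T) k : Nat.Odd k -> alternating a b k = b /\ sg k = -1.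
Proof.
intros H; unfold alternating, sg; rewrite <- Nat.negb_odd, (proj2 (Nat.odd_spec k) H).
destruct H as [j ->]; split; [reflexivity|rewrite Nat.add_1_r; apply pow_1_odd].
Qed.

Lemma alternating_periodic {T : Type} (a b : T) k j :
  Nat.even k = Nat.even j -> alternating a b k = alternating a b j.
Proof. unfold alternating; intros ->; reflexivity. Qed.

Lemma oscillation_points n x :
  points n x -> increasing_points (n + 1) (fun k => x (k - 1)%nat).
Proof.
intros Hx; split.
- intros k Hk; apply (points_nonneg n); [exact Hx|lia].
- intros k H1 H2; replace (S k - 1)%nat with (S (k - 1)) by lia; apply Hx; lia.
Qed.

Lemma Odd_pred k : Nat.Odd k -> Nat.Even (k - 1).
Proof. intros [j ->]; exists j; lia. Qed.

Lemma Even_pred k : (1 <= k)%nat -> Nat.Even k -> Nat.Odd (k - 1).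
Proof. intros Hk [j ->]; exists (j - 1)%nat; lia. Qed.

Lemma wnorm_attained (fm fp x : R -> R) tau :
  Defs.positive fm -> Defs.positive fp -> 0 <= tau ->
  (forall t, 0 <= t -> x t <= tau * fp t /\ - x t <= tau * fm t) ->
  (exists t, 0 <= t /\ (x t = tau * fp t \/ - x t = tau * fm t)) ->
  wnorm fm fp x = Finite tau.
Proof.
intros Hm Hp Ht Hx (t0 & Ht0 & Hc).
assert (K : forall t, 0 <= t -> Rabs (Rmax (x t) 0 / fp t + Rmax (- x t) 0 / fm t)
          = Rmax (x t) 0 / fp t + Rmax (- x t) 0 / fm t).
{ intros t H; apply Rabs_right, Rle_ge, Rplus_le_le_0_compat;
    (apply Rdiv_le_0_compat; [apply Rmax_r|auto]). }
assert (Z : forall a, 0 / a = 0) by (intros; unfold Rdiv; ring).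
apply is_lub_Rbar_unique; split.
- intros v (t & H & ->); simpl; rewrite K by exact H.
  specialize (Hx t H); specialize (Hm t H); specialize (Hp t H).
  destruct (Rle_dec 0 (x t)).
  + rewrite Rmax_left, Rmax_right, Z by lra.
    apply Rmult_le_reg_r with (fp t); [lra|].
    replace ((x t / fp t + 0) * fp t) with (x t) by (field; lra); lra.
  + rewrite Rmax_right, Rmax_left, Z by lra.
    apply Rmult_le_reg_r with (fm t); [lra|].
    replace ((0 + - x t / fm t) * fm t) with (- x t) by (field; lra); lra.
- intros B HB; apply HB; exists t0; split; [exact Ht0|]; rewrite K by exact Ht0.
  specialize (Hm t0 Ht0); specialize (Hp t0 Ht0).
  assert (A := Rmult_le_pos _ _ Ht (Rlt_le _ _ Hm)).
  assert (C := Rmult_le_pos _ _ Ht (Rlt_le _ _ Hp)).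
  destruct Hc as [E|E].
  + rewrite Rmax_left, Rmax_right, Z, E by lra; field; lra.
  + rewrite Rmax_right, Rmax_left, Z, E by lra; field; lra.
Qed.

Lemma wnorm_bounds (fm fp x : R -> R) v :
  Defs.positive fm -> Defs.positive fp -> wnorm fm fp x = Finite v ->
  forall t, 0 <= t -> x t <= v * fp t /\ - x t <= v * fm t.
Proof.
intros Hm Hp Hv t Ht.
assert (A : Rbar_le (Rabs (Rmax (x t) 0 / fp t + Rmax (- x t) 0 / fm t)) v).
{ rewrite <- Hv; apply (proj1 (Lub_Rbar_correct _)); exists t; auto. }
simpl in A; apply Rle_trans with (1 := Rle_abs _) in A.
specialize (Hm t Ht); specialize (Hp t Ht).
assert (B : 0 <= Rmax (x t) 0 / fp t) by (apply Rdiv_le_0_compat; [apply Rmax_r|lra]).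
assert (C : 0 <= Rmax (- x t) 0 / fm t) by (apply Rdiv_le_0_compat; [apply Rmax_r|lra]).
assert (D : Rmax (x t) 0 / fp t * fp t <= v * fp t) by (apply Rmult_le_compat_r; lra).
assert (E : Rmax (- x t) 0 / fm t * fm t <= v * fm t) by (apply Rmult_le_compat_r; lra).
assert (F : Rmax (x t) 0 / fp t * fp t = Rmax (x t) 0) by (field; lra).
assert (G : Rmax (- x t) 0 / fm t * fm t = Rmax (- x t) 0) by (field; lra).
generalize (Rmax_l (x t) 0) (Rmax_l (- x t) 0); lra.
Qed.

Theorem theorem2 (r : nat) (g fp fm : R -> R)
  (hr : (1 <= r)%nat)
  (hg : admissible_kernel r g)
  (hfp : admissible_weight fp) (hfm : admissible_weight fm)
  (hlp : weight_kernel_condition r g fp)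
  (hlm : weight_kernel_condition r g fm) :
  exists (ap am : nat -> R) (Gp Gm : R -> R -> R),
    threshold_sequence ap /\ threshold_sequence am /\
    (forall n tau, in_step ap n tau -> Gamma r n g (Gp tau)) /\
    (forall n tau, in_step am n tau -> Gamma r n g (Gm tau)) /\
    (* (a) *)
    (forall n tau, in_step ap n tau ->
       perfect_spline r g n (Gp tau) /\
       oscillates_pos (n + 1) (fun t => - (tau * fm t)) (fun t => tau * fp t)
         (Gp tau)) /\
    (forall n tau, in_step am n tau ->
       perfect_spline r g n (Gm tau) /\
       oscillates_neg (n + 1) (fun t => - (tau * fm t)) (fun t => tau * fp t)
         (Gm tau)) /\
    (* (b) *)
    (forall n tau, in_step ap n tau ->
       (forall s, (s < r)%nat ->
          derivative_piecewise_monotone (n + 1) s (Gp tau)) /\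
       (forall s, (s <= r)%nat ->
          sgn_derivative_n_at_0 s (Gp tau) ((-1) ^ s))) /\
    (forall n tau, in_step am n tau ->
       (forall s, (s < r)%nat ->
          derivative_piecewise_monotone (n + 1) s (Gm tau)) /\
       (forall s, (s <= r)%nat ->
          sgn_derivative_n_at_0 s (Gm tau) (- (-1) ^ s))) /\
    (* (c) *)
    (forall n : nat,
       let m := Rmin (ap (S n)) (am (S n)) in
       Rbar_glb (fun v => exists G, Gamma r n g G /\ v = wnorm fm fp G)
         = Finite m /\
       (ap (S n) < am (S n) ->
          Gamma r n g (Gp (ap (S n))) /\
          wnorm fm fp (Gp (ap (S n))) = Finite m) /\
       (am (S n) <= ap (S n) ->
          Gamma r n g (Gm (am (S n))) /\
          wnorm fm fp (Gm (am (S n))) = Finite m)).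
Proof.
assert (HQ := kernel_chain_tail r g hg); set (Q := kernel_chain g) in *.
assert (Hg : forall t, 0 <= t -> Q O t = g t) by (intros; apply ext_nonneg; auto).
assert (Hwp := tail_weight_ext r g fp hr hg hfp hlp); fold Q in Hwp.
assert (Hwm := tail_weight_ext r g fm hr hg hfm hlm); fold Q in Hwm.
set (lp := at_infinity fp) in *; set (lm := at_infinity fm) in *.
assert (Hp : Defs.positive fp) by apply hfp; assert (Hm : Defs.positive fm) by apply hfm.
destruct (snakes r Q HQ hr g Hg (alternating (ext fp) (ext fm)) (alternating lp lm)) with (e := 1)
  as (ap & Gp & Hap & Hsp & Hcp & Hlp).
{ intros k; unfold alternating; destruct (Nat.even k); assumption. }
{ intros k j E; split; apply alternating_periodic, E. }
{ left; reflexivity. }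
(* Negative orientation is the positive one of [- G], with the weights exchanged. *)
destruct (snakes r Q HQ hr g Hg (alternating (ext fm) (ext fp)) (alternating lm lp)) with (e := -1)
  as (am & Gm & Ham & Hsm & Hcm & Hlm).
{ intros k; unfold alternating; destruct (Nat.even k); assumption. }
{ intros k j E; split; apply alternating_periodic, E. }
{ right; reflexivity. }
assert (Bp : forall n tau G, snake r g (alternating (ext fp) (ext fm)) 1 n tau G ->
          forall t, 0 <= t -> G t <= tau * fp t /\ - G t <= tau * fm t).
{ intros n tau G (_ & _ & HB & _) t Ht; assert (B0 := HB 0%nat t Ht); assert (B1 := HB 1%nat t Ht).
  unfold alternating, sg in B0, B1; simpl in B0, B1; rewrite ext_nonneg in B0, B1 by exact Ht; lra. }
assert (Bm : forall n tau G, snake r g (alternating (ext fm) (ext fp)) (-1) n tau G ->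
          forall t, 0 <= t -> G t <= tau * fp t /\ - G t <= tau * fm t).
{ intros n tau G (_ & _ & HB & _) t Ht; assert (B0 := HB 0%nat t Ht); assert (B1 := HB 1%nat t Ht).
  unfold alternating, sg in B0, B1; simpl in B0, B1; rewrite ext_nonneg in B0, B1 by exact Ht; lra. }
assert (Np : forall n, wnorm fm fp (Gp (ap (S n))) = Finite (ap (S n))).
{ intros n; destruct (Hcp n) as (m & _ & HS).
  apply wnorm_attained; auto; [left; apply Hap; lia|apply (Bp m), HS|].
  destruct HS as (_ & _ & _ & (x & Hx & HR) & _); exists (x O); split; [apply Hx|left].
  specialize (HR O ltac:(lia)); unfold alternating, sg in HR; simpl in HR.
  rewrite ext_nonneg in HR by apply Hx; lra. }
assert (Nm : forall n, wnorm fm fp (Gm (am (S n))) = Finite (am (S n))).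
{ intros n; destruct (Hcm n) as (m & _ & HS).
  apply wnorm_attained; auto; [left; apply Ham; lia|apply (Bm m), HS|].
  destruct HS as (_ & _ & _ & (x & Hx & HR) & _); exists (x O); split; [apply Hx|right].
  specialize (HR O ltac:(lia)); unfold alternating, sg in HR; simpl in HR.
  rewrite ext_nonneg in HR by apply Hx; lra. }
assert (Gp_in : forall n, Gamma r n g (Gp (ap (S n)))).
{ intros n; destruct (Hcp n) as (m & Hmn & HS); exists m; split; [exact Hmn|apply HS]. }
assert (Gm_in : forall n, Gamma r n g (Gm (am (S n)))).
{ intros n; destruct (Hcm n) as (m & Hmn & HS); exists m; split; [exact Hmn|apply HS]. }
exists ap, am, Gp, Gm.
split; [exact Hap|split; [exact Ham|]].
split; [intros n tau H; exists n; split; [lia|apply (Hsp n tau H)]|].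
split; [intros n tau H; exists n; split; [lia|apply (Hsm n tau H)]|].
split; [|split; [|split; [|split]]].
- intros n tau H; specialize (Hsp n tau H); assert (B := Bp n tau _ Hsp).
  destruct Hsp as (H1 & H2 & _ & (x & Hx & HR) & _).
  split; [exact H1|split; [split; [exact H2|intros t Ht; specialize (B t Ht); lra]|]].
  exists (fun k => x (k - 1)%nat); split; [apply oscillation_points, Hx|].
  intros k Hk; specialize (HR (k - 1)%nat ltac:(lia)).
  assert (Hxk := points_nonneg n x (k - 1) Hx ltac:(lia)); split; intros Hpar.
  + apply Odd_pred in Hpar; destruct (alternating_even (ext fp) (ext fm) _ Hpar) as [E1 E2].
    rewrite E1, E2, ext_nonneg in HR by exact Hxk; lra.
  + apply Even_pred in Hpar; [|lia]; destruct (alternating_odd (ext fp) (ext fm) _ Hpar) as [E1 E2].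
    rewrite E1, E2, ext_nonneg in HR by exact Hxk; lra.
- intros n tau H; specialize (Hsm n tau H); assert (B := Bm n tau _ Hsm).
  destruct Hsm as (H1 & H2 & _ & (x & Hx & HR) & _).
  split; [exact H1|split; [split; [exact H2|intros t Ht; specialize (B t Ht); lra]|]].
  exists (fun k => x (k - 1)%nat); split; [apply oscillation_points, Hx|].
  intros k Hk; specialize (HR (k - 1)%nat ltac:(lia)).
  assert (Hxk := points_nonneg n x (k - 1) Hx ltac:(lia)); split; intros Hpar.
  + apply Even_pred in Hpar; [|lia]; destruct (alternating_odd (ext fm) (ext fp) _ Hpar) as [E1 E2].
    rewrite E1, E2, ext_nonneg in HR by exact Hxk; lra.
  + apply Odd_pred in Hpar; destruct (alternating_even (ext fm) (ext fp) _ Hpar) as [E1 E2].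
    rewrite E1, E2, ext_nonneg in HR by exact Hxk; lra.
- intros n tau H; destruct (Hsp n tau H) as (_ & _ & _ & _ & H1 & H2); split; [exact H1|].
  intros s Hs; specialize (H2 s Hs); rewrite Rmult_1_l in H2; exact H2.
- intros n tau H; destruct (Hsm n tau H) as (_ & _ & _ & _ & H1 & H2); split; [exact H1|].
  intros s Hs; specialize (H2 s Hs).
  replace (- (-1) ^ s) with (-1 * (-1) ^ s) by ring; exact H2.
- intros n m; split; [|split].
  + assert (Hatt : exists G, Gamma r n g G /\ Finite m = wnorm fm fp G).
    { unfold m, Rmin; destruct (Rle_dec (ap (S n)) (am (S n))).
      - exists (Gp (ap (S n))); auto.
      - exists (Gm (am (S n))); auto. }
    assert (Hlow : forall G, Gamma r n g G -> Rbar_le m (wnorm fm fp G)).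
    { intros G (m' & Hm' & HG).
      (* An infinite norm makes the bound trivial, and minus infinity is excluded since the supremum
         is over a nonempty set. *)
      destruct (wnorm fm fp G) as [v| |] eqn:E; [|exact I|].
      - assert (B := wnorm_bounds fm fp G v Hm Hp E).
        destruct (perfect_spline_decode r Q HQ hr g Hg m' G (v * fp 0 + v * fm 0) HG)
          as (e & c & y & He & Hy & HP & HF).
        { intros t Ht; specialize (B t Ht).
          assert (A1 := proj1 (proj2 hfp) 0 t (Rle_refl _) Ht).
          assert (A2 := proj1 (proj2 hfm) 0 t (Rle_refl _) Ht).
          assert (P1 := Hp t Ht); assert (P2 := Hm t Ht).
          assert (Hv : 0 <= v) by nra.
          assert (A3 := Rmult_le_compat_l v _ _ Hv A1); assert (A4 := Rmult_le_compat_l v _ _ Hv A2).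
          assert (A5 := Rmult_le_pos _ _ Hv (Rlt_le _ _ P1)).
          assert (A6 := Rmult_le_pos _ _ Hv (Rlt_le _ _ P2)).
          apply Rabs_le; lra. }
        (* The sign of the decoded spline decides which of the two threshold sequences bounds its
           norm. *)
        simpl; destruct He as [-> | ->].
        + apply Rle_trans with (1 := Rmin_l _ _), (Hlp n m' c y); auto.
          intros k t Ht; specialize (B t Ht); specialize (HF t Ht).
          destruct (Nat.Even_or_Odd k) as [Hk|Hk].
          * destruct (alternating_even (ext fp) (ext fm) k Hk) as [-> ->].
            rewrite ext_nonneg by exact Ht; lra.
          * destruct (alternating_odd (ext fp) (ext fm) k Hk) as [-> ->].
            rewrite ext_nonneg by exact Ht; lra.
        + apply Rle_trans with (1 := Rmin_r _ _), (Hlm n m' c y); auto.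
          intros k t Ht; specialize (B t Ht); specialize (HF t Ht).
          destruct (Nat.Even_or_Odd k) as [Hk|Hk].
          * destruct (alternating_even (ext fm) (ext fp) k Hk) as [-> ->].
            rewrite ext_nonneg by exact Ht; lra.
          * destruct (alternating_odd (ext fm) (ext fp) k Hk) as [-> ->].
            rewrite ext_nonneg by exact Ht; lra.
      - assert (A : Rbar_le (Rabs (Rmax (G 0) 0 / fp 0 + Rmax (- G 0) 0 / fm 0)) m_infty).
        { rewrite <- E; apply (proj1 (Lub_Rbar_correct _)); exists 0; split; [lra|reflexivity]. }
        destruct A. }
    apply Rbar_is_glb_unique; split.
    * intros v (G & HG & ->); apply Hlow, HG.
    * intros b Hb; apply Hb, Hatt.
  + intros H; split; [apply Gp_in|]; unfold m; rewrite Rmin_left by lra; apply Np.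
  + intros H; split; [apply Gm_in|]; unfold m; rewrite Rmin_right by lra; apply Nm.
Qed.
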